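(* Let $x:[0,1]^2\to\mathbb{R}$ be a path whose rectangular increments satisfy $\delta x\in\mathcal{P}_{2,2}^{\gamma_1,\gamma_2}$ with $\gamma_1,\gamma_2>1/2$, let $\varphi\in C^4(\mathbb{R})$, and put $y=\varphi(x)$, $y^j=\varphi^{(j)}(x)$ for $j\ge1$. Then the increments $$z^1=\int_1\int_2 y^1\,d_{12}x,\qquad z^2=\int_1\int_2 y^2\,d_{\hat1\hat2}x$$ are well defined in the two-dimensional Young sense. Moreover: (i) Both $z^1$ and $z^2$ can be decomposed as $z^1=y^1\,\mathbf{x}^{1;2}+\rho^1$ and $z^2=y^2\,\mathbf{x}^{\hat1;\hat2}+\rho^2$, where $\rho^1,\rho^2$ are sums of increments with double regularity $(2\gamma_1,2\gamma_2)$ in at least one direction. (ii) Provided $x$ is a smooth path, the increments $z^1$ and $z^2$ are defined as Riemann–Stieltjes integrals. (iii) If $x^n$ is a sequence of smooth functions such that the related increments $\mathbf{x}^{n;1;2}$, $\mathbf{x}^{n;\hat1;\hat2}$ converge respectively to $\mathbf{x}^{1;2}$ and $\mathbf{x}^{\hat1;\hat2}$ in $\mathcal{P}_{2,2}^{\gamma_1,\gamma_2}$, then $z^{1,n},z^{2,n}$ (the increments $z^1,z^2$ computed from $x^n$) also converge respectively to $z^1$ and $z^2$. (iv) Some Riemann sums convergences hold true: if $\pi^1_n=(\sigma_i)_i$ and $\pi^2_n=(\tau_j)_j$ are partitions of $[s_1,s_2]$ and $[t_1,t_2]$ respectively, whose mesh goes to $0$ as $n\to\infty$, then $$\lim_{n\to\infty}\sum_{\pi^1_n,\pi^2_n}y^1_{\sigma_i;\tau_j}\,\mathbf{x}^{1;2}_{\sigma_i\sigma_{i+1};\tau_j\tau_{j+1}}=z^1_{s_1s_2;t_1t_2},\qquad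 \lim_{n\to\infty}\sum_{\pi^1_n,\pi^2_n}y^2_{\sigma_i;\tau_j}\,\mathbf{x}^{\hat1;\hat2}_{\sigma_i\sigma_{i+1};\tau_j\tau_{j+1}}=z^2_{s_1s_2;t_1t_2}.$$ (v) The change of variables formula $$\delta y=\int_1\int_2y^1\,d_{12}x+\int_1\int_2y^2\,d_{\hat1\hat2}x,$$ valid for smooth $x$, still holds true when the integrals are understood in the Young sense.
   Context: Increments. $\mathcal{P}_{k,l}$ is the set of continuous real functions $f_{s_1\cdots s_k;t_1\cdots t_l}$ on $[0,1]^k\times[0,1]^l$ vanishing whenever $s_i=s_{i+1}$ for some $i$ or $t_j=t_{j+1}$ for some $j$. The operator $\delta_1:\mathcal{P}_{k,l}\to\mathcal{P}_{k+1,l}$ is $(\delta_1g)_{s_1\cdots s_{k+1};t_1\cdots t_l}=\sum_{i=1}^{k+1}(-1)^{k-i}g_{s_1\cdots\hat s_i\cdots s_{k+1};t_1\cdots t_l}$ ($\hat s_i$: argument omitted); $\delta_2$ is defined in the same way in the $t$ variables, and $\delta=\delta_1\delta_2$. For a function $f$ on $[0,1]^2$, $\delta f_{s_1s_2;t_1t_2}=f_{s_2;t_2}-f_{s_1;t_2}-f_{s_2;t_1}+f_{s_1;t_1}$. Norms. For $f\in\mathcal{P}_{2,2}$, $\|f\|_{\alpha;\beta}=\sup\frac{|f_{s_1s_2;t_1t_2}|}{|s_2-s_1|^{\alpha}|t_2-t_1|^{\beta}}$, the supremum being over $s_1,s_2,t_1,t_2\in[0,1]$, and $\mathcal{P}_{2,2}^{\alpha,\beta}$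 is the set of $f\in\mathcal{P}_{2,2}$ with finite norm. Products glue one variable in each direction: for $g\in\mathcal{P}_{n_1,n_2}$, $h\in\mathcal{P}_{m_1,m_2}$, $(gh)_{s_1\ldots s_{n_1+m_1-1};t_1\ldots t_{n_2+m_2-1}}=g_{s_1\ldots s_{n_1};t_1\ldots t_{n_2}}h_{s_{n_1}\ldots s_{n_1+m_1-1};t_{n_2}\ldots t_{n_2+m_2-1}}$. Sewing maps. If $h$ has three variables in direction $j$, lies in the image of $\delta_j$ and has Hölder regularity $\mu>1$ in direction $j$ (total exponent over the two consecutive intervals), then $\Lambda_jh$ is the increment with two variables in direction $j$, of Hölder regularity $\mu$ in direction $j$, such that $\delta_j\Lambda_jh=h$ (the variables of the other direction being parameters). First order increments: $\mathbf{x}^{1;2}=\delta x$ and $\mathbf{x}^{\hat1;\hat2}=[\mathrm{Id}-\Lambda_1\delta_1][\mathrm{Id}-\Lambda_2\delta_2](\delta_1x\,\delta_2x)$. For smooth $x$, $d_{12}x=\partial_s\partial_tx\,ds\,dt$, $d_{\hat1\hat2}x=d_1x\,d_2x=\partial_sx\,\partial_tx\,ds\,dt$, and $\mathbf{x}^{1;2}=\int_1\int_2d_{12}x$, $\mathbf{x}^{\hat1;\hat2}=\int_1\int_2d_{\hat1\hat2}x$, where $\int_1\int_2$ evaluated at $(s_1,s_2;t_1,t_2)$ means the integral over $[s_1,s_2]\times[t_1,t_2]$. The increments $\mathbf{x}^{n;1;2},\mathbf{x}^{n;\hat1;\hat2}$ are those built from $x^n$. Young sense: $z^1=[\mathrm{Id}-\Lambda_1\delta_1][\mathrm{Id}-\Lambda_2\delta_2](y^1\,\mathbf{x}^{1;2})$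 and $z^2=[\mathrm{Id}-\Lambda_1\delta_1][\mathrm{Id}-\Lambda_2\delta_2](y^2\,\mathbf{x}^{\hat1;\hat2})$.
   Formalization: It is additionally assumed that s↦x(s,0) is γ1-Hölder and t↦x(0,t) is γ2-Hölder, and in (iii) that x^n converges to x at (0,0) and on both axes in these Hölder norms; without such conditions the claim fails, since δx carries no information on the axes. *)

(* Defs.v *)
From HB Require Import structures.
From mathcomp Require Import all_boot all_order all_algebra.
From mathcomp Require Import all_classical all_reals all_analysis.

Set Implicit Arguments.
Unset Strict Implicit.
Unset Printing Implicit Defensive.

Import Order.TTheory GRing.Theory Num.Theory.
Import numFieldNormedType.Exports.

Local Open Scope classical_set_scope.
Local Open Scope ring_scope.

(* Functions on [0,1]^k x [0,1]^l are represented by total functions of which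
   only the values on the cube matter: every condition below is restricted to
   the cube, and increments are compared with [eq_cube] rather than with [=]. *)
Definition incr (R : realType) (k l : nat) := 'rV[R]_k -> 'rV[R]_l -> R.

Definition cube (R : realType) (k : nat) : set 'rV[R]_k :=
  [set s | forall i, 0 <= s ord0 i <= 1].

Definition eq_cube (R : realType) k l (f g : incr R k l) : Prop :=
  forall s t, cube s -> cube t -> f s t = g s t.

Definition incr_add (R : realType) k l (f g : incr R k l) : incr R k l :=
  fun s t => f s t + g s t.

Definition incr_sub (R : realType) k l (f g : incr R k l) : incr R k l :=
  fun s t => f s t - g s t.

(* Exchange of the two directions; all notions in direction 2 are those of
   direction 1 read through this exchange. *)
Definition flip (R : realType) k l (f : incr R k l) : incr R l k :=
  fun t s => f s t.

Definition repeated (R : realType) k (s : 'rV[R]_k) : Prop :=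
  exists i j : 'I_k, j = i.+1 :> nat /\ s ord0 i = s ord0 j.

Definition Pspace (R : realType) (k l : nat) : set (incr R k l) :=
  [set f | {within cube (R:=R) (k:=k) `*` cube (R:=R) (k:=l),
              continuous (fun p : 'rV[R]_k * 'rV[R]_l => f p.1 p.2)} /\
           (forall s t, cube s -> cube t -> repeated s \/ repeated t ->
              f s t = 0)].

(* The sum over i = 1, ..., k+1 with sign (-1)^(k-i) is indexed here by
   i - 1 : 'I_k.+1, hence the exponent k - i.+1, of the same parity as
   k + i.+1. [col' i s] omits the argument of index i. *)
Definition delta1 (R : realType) k l (g : incr R k l) : incr R k.+1 l :=
  fun s t => \sum_(i < k.+1) (-1) ^+ (k + i.+1) * g (col' i s) t.

Definition delta2 (R : realType) k l (g : incr R k l) : incr R k l.+1 :=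
  flip (delta1 (flip g)).

Definition glue (R : realType) n1 n2 m1 m2
    (g : incr R n1.+1 n2.+1) (h : incr R m1.+1 m2.+1) :
    incr R (n1 + m1).+1 (n2 + m2).+1 :=
  fun s t =>
    g (\row_(i < n1.+1) s ord0 (inord i)) (\row_(j < n2.+1) t ord0 (inord j)) *
    h (\row_(i < m1.+1) s ord0 (inord (n1 + i)))
      (\row_(j < m2.+1) t ord0 (inord (n2 + j))).

(* At s_1 = s_2 or t_1 = t_2 the quotient is 0 / 0 = 0. *)
Definition holder_norm (R : realType) (a b : R) (f : incr R 2 2) : \bar R :=
  ereal_sup [set r | exists s t, [/\ cube s, cube t &
    r = (`|f s t| / (`|s ord0 1 - s ord0 0| `^ a *
                     `|t ord0 1 - t ord0 0| `^ b))%:E]].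

Definition Pholder (R : realType) (a b : R) : set (incr R 2 2) :=
  [set f | Pspace f /\ (holder_norm a b f < +oo)%E].

Definition cvg_Pholder (R : realType) (a b : R)
    (fn : nat -> incr R 2 2) (f : incr R 2 2) : Prop :=
  [/\ forall n, Pholder a b (fn n), Pholder a b f &
      holder_norm a b (incr_sub (fn n) f) @[n --> \oo] --> 0%E].

Definition regular2 (R : realType) l (mu : R) (g : incr R 2 l) : Prop :=
  exists C : R, forall s t, cube s -> cube t ->
    `|g s t| <= C * `|s ord0 1 - s ord0 0| `^ mu.

(* Total exponent mu, shared in finitely many ways between [s_1, s_2] and
   [s_2, s_3]. *)
Definition regular3 (R : realType) l (mu : R) (h : incr R 3 l) : Prop :=
  exists (C : R) (m : nat) (a : 'I_m -> R), (forall i, 0 < a i < mu) /\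
    forall s t, cube s -> cube t ->
      `|h s t| <= C * \sum_(i < m) `|s ord0 1 - s ord0 0| `^ a i *
                                   `|s ord0 2 - s ord0 1| `^ (mu - a i).

Definition is_sewing1 (R : realType) l (h : incr R 3 l) (g : incr R 2 l)
    : Prop :=
  exists2 mu : R, 1 < mu &
    [/\ regular3 mu h, Pspace g, regular2 mu g & eq_cube (delta1 g) h].

(* Meaningful only for those h with [sewing1_defined h]; the default value 0 is
   used otherwise. *)
Definition Lambda1 (R : realType) l (h : incr R 3 l) : incr R 2 l :=
  xget (fun _ _ => 0) [set g : 'rV[R]_2 -> 'rV[R]_l -> R | is_sewing1 h g].

Definition sewing1_defined (R : realType) l (h : incr R 3 l) : Prop :=
  is_sewing1 h (Lambda1 h) /\
  forall g, is_sewing1 h g -> eq_cube g (Lambda1 h).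

Definition Lambda2 (R : realType) k (h : incr R k 3) : incr R k 2 :=
  flip (Lambda1 (flip h)).

Definition sewing2_defined (R : realType) k (h : incr R k 3) : Prop :=
  sewing1_defined (flip h).

Definition Id_Lambda_delta1 (R : realType) l (A : incr R 2 l) : incr R 2 l :=
  incr_sub A (Lambda1 (delta1 A)).

Definition Id_Lambda_delta2 (R : realType) k (A : incr R k 2) : incr R k 2 :=
  incr_sub A (Lambda2 (delta2 A)).

Definition young (R : realType) (A : incr R 2 2) : incr R 2 2 :=
  Id_Lambda_delta1 (Id_Lambda_delta2 A).

Definition young_defined (R : realType) (A : incr R 2 2) : Prop :=
  [/\ Pspace A, sewing2_defined (delta2 A) &
      sewing1_defined (delta1 (Id_Lambda_delta2 A))].

(* A path [x : R -> R -> R], looked at on [0,1]^2, as a (1,1)-increment. *)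
Definition path_incr (R : realType) (x : R -> R -> R) : incr R 1 1 :=
  fun s t => x (s ord0 ord0) (t ord0 ord0).

Definition rect (R : realType) (x : R -> R -> R) : incr R 2 2 :=
  delta1 (delta2 (path_incr x)).

Definition x12 (R : realType) (x : R -> R -> R) : incr R 2 2 := rect x.

Definition x12hat_germ (R : realType) (x : R -> R -> R) : incr R 2 2 :=
  glue (delta1 (path_incr x)) (delta2 (path_incr x)).

Definition x12hat (R : realType) (x : R -> R -> R) : incr R 2 2 :=
  young (x12hat_germ x).

Definition comp_path (R : realType) (phi : R -> R) (j : nat)
    (x : R -> R -> R) : R -> R -> R :=
  fun s t => derive1n j phi (x s t).

Definition germ1 (R : realType) (phi : R -> R) (x : R -> R -> R)
    : incr R 2 2 :=
  glue (path_incr (comp_path phi 1 x)) (x12 x).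

Definition germ2 (R : realType) (phi : R -> R) (x : R -> R -> R)
    : incr R 2 2 :=
  glue (path_incr (comp_path phi 2 x)) (x12hat x).

Definition z1 (R : realType) (phi : R -> R) (x : R -> R -> R) : incr R 2 2 :=
  young (germ1 phi x).

Definition z2 (R : realType) (phi : R -> R) (x : R -> R -> R) : incr R 2 2 :=
  young (germ2 phi x).

Definition regular_sum (R : realType) (a b : R) (rho : incr R 2 2) : Prop :=
  exists (m : nat) (r : 'I_m -> incr R 2 2),
    (forall i, Pholder (2 * a) b (r i) \/ Pholder a (2 * b) (r i)) /\
    eq_cube rho (fun s t => \sum_(i < m) r i s t).

Definition class_C (R : realType) (n : nat) (phi : R -> R) : Prop :=
  (forall k (u : R), (k < n)%N -> derivable (derive1n k phi) u 1) /\
  continuous (derive1n n phi).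

Definition holder_norm_1d (R : realType) (a : R) (f : R -> R) : \bar R :=
  ereal_sup [set r | exists u v, [/\ 0 <= u <= 1, 0 <= v <= 1 &
    r = (`|f v - f u| / `|v - u| `^ a)%:E]].

(* The rectangular increments of a path carry no information on its values on
   the axes, which the statement controls separately by these two notions. *)
Definition axes_holder (R : realType) (a b : R) (x : R -> R -> R) : Prop :=
  (holder_norm_1d a (x ^~ 0%R) < +oo)%E /\ (holder_norm_1d b (x 0%R) < +oo)%E.

Definition axes_cvg (R : realType) (a b : R) (xn : nat -> R -> R -> R)
    (x : R -> R -> R) : Prop :=
  [/\ xn n 0 0 @[n --> \oo] --> x 0 0,
      holder_norm_1d a (fun s => xn n s 0 - x s 0) @[n --> \oo] --> 0%E &
      holder_norm_1d b (fun t => xn n 0 t - x 0 t) @[n --> \oo] --> 0%E].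

Definition partial1 (R : realType) (x : R -> R -> R) : R -> R -> R :=
  fun s t => derive1 (x ^~ t) s.

Definition partial2 (R : realType) (x : R -> R -> R) : R -> R -> R :=
  fun s t => derive1 (x s) t.

Fixpoint partials (R : realType) (w : seq bool) (x : R -> R -> R)
    : R -> R -> R :=
  if w is b :: w' then
    (if b then partial2 (partials w' x) else partial1 (partials w' x))
  else x.

Definition smooth (R : realType) (X : R -> R -> R) : Prop :=
  forall w,
    continuous (fun p : R * R => partials w X p.1 p.2) /\
    forall s t, derivable (partials w X ^~ t) s 1 /\
                derivable (partials w X s) t 1.

(* A smooth path on [0,1]^2 is the restriction of a smooth function on R^2;
   its partial derivatives on [0,1]^2 do not depend on the extension X. *)
Definition smooth_extension (R : realType) (x X : R -> R -> R) : Prop :=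
  smooth X /\ forall s t, 0 <= s <= 1 -> 0 <= t <= 1 -> X s t = x s t.

Definition smooth_path (R : realType) (x : R -> R -> R) : Prop :=
  exists X, smooth_extension x X.

Definition oriented_int (R : realType) (a b : R) (f : R -> R) : R :=
  if a <= b then \int[lebesgue_measure]_(u in `[a, b]) f u
  else - \int[lebesgue_measure]_(u in `[b, a]) f u.

Definition double_int (R : realType) (f : R -> R -> R) : incr R 2 2 :=
  fun s t => oriented_int (s ord0 0) (s ord0 1)
    (fun u => oriented_int (t ord0 0) (t ord0 1) (fun v => f u v)).

Definition pair_rv (R : realType) (a b : R) : 'rV[R]_2 :=
  \row_(i < 2) [:: a; b]`_i.

(* With [itv_partition a b p] the nodes are a :: p, i.e. a, p_0, ..., b. *)
Definition node (R : realType) (a : R) (p : seq R) (i : nat) : R :=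
  (a :: p)`_i.

Definition cell (R : realType) (a : R) (p : seq R) (i : nat) : 'rV[R]_2 :=
  pair_rv (node a p i) (node a p i.+1).

Definition mesh (R : realType) (a : R) (p : seq R) : R :=
  \big[Num.max/0]_(i < size p) (node a p i.+1 - node a p i).

Definition tagged_sum (R : realType) (f : R -> R -> R) (m : incr R 2 2)
    (s1 t1 : R) (p q : seq R) (xi eta : nat -> nat -> R) : R :=
  \sum_(i < size p) \sum_(j < size q)
    f (xi i j) (eta i j) * m (cell s1 p i) (cell t1 q j).

Definition left_sum (R : realType) (f : R -> R -> R) (m : incr R 2 2)
    (s1 t1 : R) (p q : seq R) : R :=
  tagged_sum f m s1 t1 p q (fun i _ => node s1 p i) (fun _ j => node t1 q j).

Definition is_RS_integral (R : realType) (f : R -> R -> R) (m : incr R 2 2)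
    (s1 s2 t1 t2 : R) (I : R) : Prop :=
  forall e : R, 0 < e -> exists2 d : R, 0 < d &
    forall (p q : seq R) (xi eta : nat -> nat -> R),
      itv_partition s1 s2 p -> itv_partition t1 t2 q ->
      mesh s1 p < d -> mesh t1 q < d ->
      (forall i j, (i < size p)%N -> (j < size q)%N ->
         node s1 p i <= xi i j <= node s1 p i.+1 /\
         node t1 q j <= eta i j <= node t1 q j.+1) ->
      `|tagged_sum f m s1 t1 p q xi eta - I| < e.

(* Main.v *)
Require Import Defs.
From HB Require Import structures.
From mathcomp Require Import all_boot all_order all_algebra.
From mathcomp Require Import all_classical all_reals all_analysis.
From mathcomp Require Import ring lra.

Set Implicit Arguments.
Unset Strict Implicit.
Unset Printing Implicit Defensive.

Import Order.TTheory GRing.Theory Num.Theory.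
Import numFieldNormedType.Exports.

Local Open Scope classical_set_scope.
Local Open Scope ring_scope.

(** The sewing lemma in one direction says that a germ A(s, t) whose defect
    A(s1, s3) - A(s1, s2) - A(s2, s3) is bounded by
    K |s2 - s1|^a |s3 - s2|^g with a + g > 1 is at distance O(|t - s|^(a + g))
    of exactly one additive increment, the limit [sew A] of its Riemann sums
    ([partition_sum_bound], [sew_bound], [additive_eq0]). In these terms
    Lambda delta A is A - sew A, hence Id - Lambda delta is the operator sew
    itself ([sewing_mat]), and the Young integral of a germ in two directions is
    the sewing in the second direction followed by the sewing in the first one
    ([sew12], [young_mat]). All the estimates are made on functions of four real
    variables; increments on matrices only appear when these are translated.

    For the two sewings to be possible a germ has to be controlled in each
    direction separately and in both directions together: this is [bigerm]. It
    holds for the germ (d1 x)(d2 x), for biadditive Hoelder increments, and is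
    stable by multiplication by a path that is Hoelder in each direction and
    whose rectangular increments are Hoelder ([hol2], [bigerm_mulp]). The paths
    y^1 and y^2 are such, because phi has four derivatives ([hol2_comp]); so z^1
    and z^2 are well defined. The exponent a of the path and the exponent g of
    the integrator are kept distinct, for one may exceed 1 while the other does
    not.

    The remainders z - germ split as (z - sew2 germ) + (sew2 germ - germ), whose
    terms have the double regularity in the first and in the second direction
    respectively. Riemann sums over arbitrary partitions converge because a sum
    in the second direction minus its limit is again a germ in the first
    direction, with a small constant ([grid_sum_dist]).

    The Young integral is bilinear in the path and the integrator and is bounded
    by the constants of their estimates ([sew12_mulp_cvg]). Its continuity thus
    reduces to that of x |-> phi'(x), phi''(x) for the norm of [hol2], which the
    mean value theorem applied along the segment between two paths gives
    ([hol2_comp_sub]).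

    A smooth path has exponents 1 and 1, and then a Young integral is at distance
    o(ds dt) of its germ. It is therefore the unique biadditive increment with
    the density of the germ ([density_unique]), a property shared by the
    iterated Lebesgue integral of this density ([dint_density]).

    For the change of variables, the one-dimensional formula in the second
    direction expresses the increment d2 phi(x) as the sewing of
    phi'(x) d2 x. Its increment in the first direction is the sewing of
    phi'(x) (delta x) + (d1 phi'(x)) (d2 x), and d1 phi'(x) may be replaced by
    phi''(x) d1 x at the price of an error of order more than 1 in the first
    direction, which the first sewing cancels ([change_of_variables]). In the
    same way (d1 x)(d2 x) may be replaced by its Young integral
    ([sew12_mulp_sew12]). *)

(** * Powers of lengths *)

Section Powers.
Variable R : realType.
Implicit Types (a b x y K : R).

Lemma eq_imp_le x y : x = y -> x <= y. Proof. by move->. Qed.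

Lemma powR_exprD a b x : 0 < a -> 0 < b -> x `^ (a + b) = x `^ a * x `^ b.
Proof. by move=> a0 b0; rewrite powRD// gt_eqF ?addr_gt0. Qed.

Lemma norm_powR_le a x y : 0 < a -> `|x| <= y -> `|x| `^ a <= y `^ a.
Proof.
move=> a0 xy; apply: ge0_ler_powR => //; first exact: ltW.
by rewrite nnegrE (le_trans _ xy).
Qed.

Lemma powR_mono a x y : 0 <= a -> 0 <= x -> x <= y -> x `^ a <= y `^ a.
Proof.
by move=> a0 x0 xy; apply: ge0_ler_powR => //; rewrite nnegrE ?(le_trans x0).
Qed.

Lemma powR_gtl1 a x : 0 < a -> 0 <= x < 1 -> x `^ a < 1.
Proof.
move=> a0 /andP[x0 x1]; have <- : 1 `^ a = 1 :> R by rewrite powR1.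
by apply: gt0_ltr_powR => //; rewrite nnegrE.
Qed.

Lemma powR_le1 a x : 0 <= a -> 0 <= x <= 1 -> x `^ a <= 1.
Proof.
move=> a0 /andP[x0 x1]; have <- : 1 `^ a = 1 :> R by rewrite powR1.
by apply: ge0_ler_powR => //; rewrite nnegrE.
Qed.

Lemma powR_ler_exp a b x : 0 < a <= b -> 0 <= x <= 1 -> x `^ b <= x `^ a.
Proof.
move=> /andP[a0]; rewrite le_eqVlt => /orP[/eqP->//|ab] x01.
have -> : b = a + (b - a) by rewrite addrC subrK.
rewrite powR_exprD ?subr_gt0// ler_piMr ?powR_ge0//.
by apply: powR_le1 => //; rewrite subr_ge0 ltW.
Qed.

Lemma powR_split1 mu x : 1 < mu -> 0 <= x -> x `^ mu = x `^ (mu - 1) * x.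
Proof.
move=> mu1 x0; have {1}-> : mu = (mu - 1) + 1 by rewrite subrK.
by rewrite powR_exprD ?subr_gt0// powRr1.
Qed.

Lemma small_powR0 (a C e : R) : 0 < a -> 0 <= C -> 0 < e ->
  exists2 d, 0 < d & forall h, 0 <= h < d -> C * h `^ a < e.
Proof.
move=> a0 C0 e0; have z0 : 0 < e / (C + 1) by rewrite !divr_gt0// ltr_wpDl.
exists ((e / (C + 1)) `^ a^-1); first by rewrite powR_gt0.
move=> h /andP[h0 hd]; apply: (@le_lt_trans _ _ (C * (e / (C + 1)))).
  rewrite ler_wpM2l//; apply: (@le_trans _ _ ((e / (C + 1)) `^ a^-1 `^ a)).
    by apply: powR_mono => //; exact: ltW.
  by rewrite -powRrM mulVf ?gt_eqF// powRr1// ltW.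
by rewrite mulrA ltr_pdivrMr ?ltr_wpDl// mulrC ltr_pM2l ?divr_gt0// ltrDl.
Qed.

Definition half_ratio mu : R := 2^-1 `^ (mu - 1).

Lemma half_ratio_ge0 mu : 0 <= half_ratio mu. Proof. exact: powR_ge0. Qed.

Lemma half_ratio_lt1 mu : 1 < mu -> half_ratio mu < 1.
Proof. by move=> mu1; apply: powR_gtl1; rewrite ?subr_gt0//; lra. Qed.

Lemma half_powR mu : 1 < mu -> 2^-1 `^ mu = 2^-1 * half_ratio mu.
Proof.
move=> mu1; rewrite /half_ratio -{1}[mu](subrK 1) addrC.
by rewrite powR_exprD ?subr_gt0// powRr1// invr_ge0.
Qed.

End Powers.

(** * Germs in one direction and their sums over partitions *)

Section Sewing1.
Variable R : realType.
Implicit Types (a g K mu : R) (A F : R -> R -> R).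

Definition in01 (s : R) : bool := 0 <= s <= 1.

Definition additive01 A :=
  forall s1 s2 s3, in01 s1 -> in01 s2 -> in01 s3 -> A s1 s3 = A s1 s2 + A s2 s3.

(** The points are not ordered. With three equal points the bound forces
    [A s s = 0] when [0 < a], and with [s3 = s1] it compares [A s1 s2] with
    [- A s2 s1]. *)
Definition germ a g K A :=
  forall s1 s2 s3, in01 s1 -> in01 s2 -> in01 s3 ->
    `|A s1 s3 - A s1 s2 - A s2 s3| <= K * (`|s2 - s1| `^ a * `|s3 - s2| `^ g).

Lemma germ_diag a g K A s : 0 < a -> germ a g K A -> in01 s -> A s s = 0.
Proof.
move=> a0 gA s01; have := gA _ _ _ s01 s01 s01.
rewrite !subrr normr0 powR0 ?gt_eqF// mul0r mulr0 sub0r normrN normr_le0.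
by move/eqP.
Qed.

Lemma in010 : in01 0. Proof. by rewrite /in01 lexx ler01. Qed.
Lemma in011 : in01 1. Proof. by rewrite /in01 lexx ler01. Qed.

Lemma germ_ge0 a g K A : germ a g K A -> 0 <= K.
Proof.
move=> /(_ 0 1 0 in010 in011 in010).
rewrite subr0 sub0r normrN normr1 !powR1 !mulr1; exact: le_trans.
Qed.

Lemma in01_dist s t : in01 s -> in01 t -> `|s - t| <= 1.
Proof. by move=> /andP[? ?] /andP[? ?]; rewrite ler_norml; lra. Qed.

(** The solution C of C = 2 (1/2)^mu C + 2, the recursion on the length of an
    interval that bounds the sums of a germ over its partitions. *)
Definition split_cst mu : R := 2 / (1 - half_ratio mu).

Lemma split_cst_ge0 mu : 1 < mu -> 0 <= split_cst mu.
Proof.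
move=> mu1; rewrite /split_cst divr_ge0// subr_ge0.
by rewrite ltW// half_ratio_lt1.
Qed.

(** A partition of an interval of length h is cut at the cell that straddles
    its midpoint. Both remaining pieces have length at most h / 2, and as the
    exponent exceeds 1 their errors add up to less than the error allowed for
    h; the room left pays for the two applications of the germ bound. *)
Lemma partition_sum_bound a g K A (u : nat -> R) m n :
  0 < a -> 0 < g -> 1 < a + g -> germ a g K A ->
  (forall i, in01 (u i)) -> {homo u : i j / (i <= j)%N >-> i <= j} ->
  (m <= n)%N ->
  `|A (u m) (u n) - \sum_(m <= i < n) A (u i) (u i.+1)|
     <= split_cst (a + g) * K * (u n - u m) `^ (a + g).
Proof.
move=> a0 g0 mu1 gA u01 umono; have K0 := germ_ge0 gA.
set mu := a + g; set C := split_cst mu.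
have C0 : 0 <= C by exact: split_cst_ge0.
have [d] := ubnP (n - m)%N; elim: d m n => // d IH m n dmn mn.
move: mn; rewrite leq_eqVlt => /predU1P[->|mn].
  rewrite big_geq// (germ_diag a0 gA)// subr0 normr0.
  by apply: mulr_ge0; [exact: mulr_ge0|exact: powR_ge0].
set h := u n - u m.
have h0 : 0 <= h by rewrite subr_ge0 umono// ltnW.
pose P k := (m < k <= n)%N && (u m + h / 2 <= u k).
have exP : exists k, P k.
  by exists n; rewrite /P mn leqnn/=; rewrite /h in h0 *; lra.
(* k.+1 is the first node beyond the midpoint: neither of the intervals
   [u m, u k] and [u k.+1, u n] is longer than h / 2. *)
case: (ex_minnP exP) => -[//|k] /andP[/andP[mk kn] uk] kmin.
have uk' : u k - u m <= h / 2.
  move: mk; rewrite ltnS leq_eqVlt => /predU1P[<-|mk]; first by lra.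
  rewrite leNgt; apply/negP => uk1.
  have /kmin : P k by rewrite /P mk (ltnW kn)/=; lra.
  by rewrite ltnn.
have mk' : (m <= k)%N by [].
have kn' : (k <= n)%N by exact: ltnW.
have IH1 := IH m k (leq_trans (leq_ltn_trans (leq_sub2r _ (leqnn _)) (ltn_sub2r mn kn)) (ltnSE dmn)) mk'.
have IH2 : _ := IH k.+1 n _ kn.
have {}IH2 : `|A (u k.+1) (u n) - \sum_(k.+1 <= i < n) A (u i) (u i.+1)|
     <= C * K * (h / 2) `^ mu.
  apply: le_trans (IH2 _) _.
    by rewrite (leq_trans (ltn_sub2l _ mk) (ltnSE dmn)).
  apply: ler_wpM2l; first exact: mulr_ge0.
  apply: powR_mono; first by rewrite /mu; lra.
  - by rewrite subr_ge0 umono.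
  - by rewrite /h in uk *; lra.
have {}IH1 : `|A (u m) (u k) - \sum_(m <= i < k) A (u i) (u i.+1)|
     <= C * K * (h / 2) `^ mu.
  apply: le_trans IH1 _.
  apply: ler_wpM2l; first exact: mulr_ge0.
  apply: powR_mono; first by rewrite /mu; lra.
  - by rewrite subr_ge0 umono.
  - by [].
have D i j l : (m <= i)%N -> (i <= j)%N -> (j <= l)%N -> (l <= n)%N ->
    `|A (u i) (u l) - A (u i) (u j) - A (u j) (u l)| <= K * h `^ mu.
  move=> mi ij jl ln; apply: (le_trans (gA _ _ _ (u01 _) (u01 _) (u01 _))).
  have := (umono _ _ mi, umono _ _ ij, umono _ _ jl, umono _ _ ln).
  move=> [[[? ?] ?] ?].
  rewrite ler_wpM2l// powR_exprD// ler_pM ?powR_ge0//;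
    apply: norm_powR_le => //; rewrite ger0_norm ?subr_ge0// /h; lra.
have D1 := D m k n (leqnn _) mk' kn' (leqnn _).
have D2 := D k k.+1 n mk' (leqnSn _) kn (leqnn _).
have hmu : C * K * (h / 2) `^ mu = C * half_ratio mu / 2 * K * h `^ mu.
  by rewrite powRM// half_powR//; ring.
rewrite hmu in IH1 IH2.
have CE : C * K * h `^ mu
    = (C * half_ratio mu / 2 * K * h `^ mu) *+ 2 + (K * h `^ mu) *+ 2.
  rewrite /C /split_cst; field.
  by rewrite subr_eq0 gt_eqF// half_ratio_lt1.
rewrite (big_cat_nat mk' kn')/= (big_ltn kn) CE.
move: IH1 IH2 D1 D2; set S1 := \sum_(m <= i < k) _.
set S2 := \sum_(k.+1 <= i < n) _.
rewrite !ler_norml; lra.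
Qed.

End Sewing1.

(** * The sewing of a germ *)

Section Sewing2. Variable R : realType.
Implicit Types (a g K mu s t : R) (A F : R -> R -> R).
Definition grid (n i : nat) : R := i%:R * 2^-1 ^+ n.

Lemma grid_mono n : {homo grid n : i j / (i <= j)%N >-> i <= j}.
Proof.
by move=> i j ij; rewrite /grid ler_wpM2r ?exprn_ge0 ?invr_ge0// ler_nat.
Qed.

Lemma grid_ge0 n i : 0 <= grid n i.
Proof. by rewrite mulr_ge0 ?exprn_ge0 ?invr_ge0. Qed.

Lemma grid0 n : grid n 0 = 0. Proof. by rewrite /grid mul0r. Qed.

Lemma gridS n i : grid n i.+1 = grid n i + 2^-1 ^+ n.
Proof. by rewrite /grid -natr1 mulrDl mul1r. Qed.

Lemma grid_end n : grid n (2 ^ n) = 1.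
Proof. by rewrite /grid natrX exprVn divff// expf_neq0. Qed.

Lemma grid_double n i : grid n.+1 i.*2 = grid n i.
Proof.
by rewrite /grid exprS -muln2 natrM; set h := _ ^+ n; field.
Qed.

(** Beyond [s] the cells degenerate to a point, where a germ vanishes, so that
    this is the sum of [A] over the dyadic partition of [0, s]. With the grid
    independent of [s], the increments of the limit are additive01 by
    construction. *)
Definition dyadic_sum A (n : nat) (s : R) : R :=
  \sum_(0 <= i < 2 ^ n) A (Num.min (grid n i) s) (Num.min (grid n i.+1) s).

Definition dyadic_lim A (s : R) : R := limn (dyadic_sum A ^~ s).

Definition sew A (s1 s2 : R) : R := dyadic_lim A s2 - dyadic_lim A s1.

Lemma big_nat_double (F : nat -> R) m :
  \sum_(0 <= i < m.*2) F i = \sum_(0 <= i < m) (F i.*2 + F i.*2.+1).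
Proof.
elim: m => [|m IH]; first by rewrite double0 !big_geq.
by rewrite doubleS !big_nat_recr//= IH addrA.
Qed.

Lemma in01_min s t : in01 s -> 0 <= t -> in01 (Num.min t s).
Proof. by rewrite /in01; case: (leP t s) => ?; lra. Qed.

Lemma sum_cells_le (F : nat -> R) K mu n : 1 < mu ->
  (forall i, `|F i| <= K * (2^-1 ^+ n) `^ mu) ->
  `|\sum_(0 <= i < 2 ^ n) F i| <= K * half_ratio mu ^+ n.
Proof.
move=> mu1 FK; apply: (le_trans (ler_norm_sum _ _ _)).
apply: (@le_trans _ _ (\sum_(0 <= i < 2 ^ n) K * (2^-1 ^+ n) `^ mu)).
  by apply: ler_sum.
rewrite sumr_const_nat subn0 -[_ *+ (2 ^ n)]mulr_natr -mulrA.
rewrite le_eqVlt; apply/orP; left; apply/eqP; congr (_ * _).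
have -> : (2^-1 ^+ n) `^ mu = (2^-1 `^ mu) ^+ n :> R.
  by rewrite -!powR_mulrn ?powR_ge0 ?invr_ge0// -!powRrM mulrC.
by rewrite half_powR// exprMn mulrAC natrX -exprMn mulVf ?expr1n ?mul1r.
Qed.

Section Germ.
Variables (a g K : R) (A : R -> R -> R).
Hypotheses (a0 : 0 < a) (g0 : 0 < g) (mu1 : 1 < a + g) (gA : germ a g K A).
Let mu := a + g.
Let q := half_ratio mu.
Let K0 : 0 <= K := germ_ge0 gA.

Let germ_le s1 s2 s3 h : in01 s1 -> in01 s2 -> in01 s3 ->
  `|s2 - s1| <= h -> `|s3 - s2| <= h ->
  `|A s1 s3 - A s1 s2 - A s2 s3| <= K * h `^ mu.
Proof.
move=> i1 i2 i3 h1 h2; apply: (le_trans (gA i1 i2 i3)).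
rewrite ler_wpM2l// powR_exprD//.
by rewrite ler_pM ?powR_ge0// norm_powR_le.
Qed.

(** Each cell of the coarser grid is cut at its middle, at the cost of one defect
    of the germ; the sum of the 2^n defects is geometrically small since
    [1 < a + g]. *)
Lemma dyadic_step n s : in01 s ->
  `|dyadic_sum A n.+1 s - dyadic_sum A n s| <= K * q ^+ n.
Proof.
move=> s01; rewrite /dyadic_sum expnS mul2n big_nat_double -sumrB.
apply: sum_cells_le => // i.
rewrite -doubleS !grid_double !gridS grid_double.
have x0 := grid_ge0 n i; set x := grid n i in x0 *.
have h0 : 0 <= 2^-1 ^+ n :> R by rewrite exprn_ge0 ?invr_ge0.
rewrite exprS; set h := 2^-1 ^+ n in h0 *.
rewrite -normrN opprB opprD addrA.
apply: germ_le; rewrite ?in01_min// ?addr_ge0// ?mulr_ge0//.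
- by move: (leP x s) (leP (x + 2^-1 * h) s) => [] ? [] ?; rewrite ler_norml; lra.
- move: (leP (x + h) s) (leP (x + 2^-1 * h) s) => [] ? [] ?.
  all: by rewrite ler_norml; lra.
Qed.

Let q0 : 0 <= q := half_ratio_ge0 mu.
Let q1 : q < 1 := half_ratio_lt1 mu1.

Lemma dyadic_dist n k s : in01 s ->
  `|dyadic_sum A (k + n)%N s - dyadic_sum A n s| <= K / (1 - q) * q ^+ n.
Proof.
move=> s01; have qq : 1 - q != 0 by rewrite subr_eq0 gt_eqF.
suff H : `|dyadic_sum A (k + n)%N s - dyadic_sum A n s|
    <= K / (1 - q) * (q ^+ n - q ^+ (k + n)).
  apply: (le_trans H); rewrite ler_wpM2l//.
    by rewrite divr_ge0// subr_ge0 ltW.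
  by rewrite gerBl exprn_ge0.
elim: k => [|k IH]; first by rewrite add0n !subrr normr0 mulr0.
rewrite addSn -(subrK (dyadic_sum A (k + n) s) (dyadic_sum A _.+1 s)) -addrA.
apply: (le_trans (ler_normD _ _)); apply: (le_trans (lerD (dyadic_step _ s01) IH)).
rewrite le_eqVlt; apply/orP; left; apply/eqP; rewrite exprS; field.
exact: qq.
Qed.

Let geo_cvg (e : R) (C : R) : 0 < e -> 0 <= C -> exists n, C * q ^+ n < e.
Proof.
move=> e0 C0.
have : (fun n => C * q ^+ n) @ \oo --> C * 0.
  by apply: cvgMl_tmp; apply: cvg_expr; rewrite ger0_norm.
rewrite mulr0 => /cvgrPdist_lt /(_ _ e0) [n _ /(_ n)] /= H.
exists n; have := H (leqnn n); rewrite sub0r normrN ger0_norm//.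
by rewrite mulr_ge0 ?exprn_ge0.
Qed.

Lemma dyadic_cvg s : in01 s -> dyadic_sum A n s @[n --> \oo] --> dyadic_lim A s.
Proof.
move=> s01; apply/cauchy_cvgP/cauchy_exP => e e0.
have [|n Hn] := @geo_cvg e (K / (1 - q)) e0.
  by rewrite divr_ge0// subr_ge0 ltW.
exists (dyadic_sum A n s); exists n => // m /= nm.
rewrite /ball/= distrC; apply: le_lt_trans Hn.
by rewrite -(subnK nm) dyadic_dist.
Qed.

Lemma dyadic_lim_dist n s : in01 s ->
  `|dyadic_lim A s - dyadic_sum A n s| <= K / (1 - q) * q ^+ n.
Proof.
move=> s01; apply/ler_addgt0Pr => e e0.
have /cvgrPdist_lt /(_ _ e0) [m _ Hm] := dyadic_cvg s01.
have /= H := Hm (m + n)%N (leq_addr _ _).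
have := dyadic_dist n m s01; move: H; rewrite ltr_norml !ler_norml; lra.
Qed.

(** The dyadic partition of [0, t] is compared with those of [0, s] and [s, t]:
    only the cell that contains [s] is cut, and at most one defect arises. *)
Let split_cell_le s t n i : in01 s -> in01 t -> s <= t ->
  `|A (Num.min (grid n i) t) (Num.min (grid n i.+1) t)
     - A (Num.min (grid n i) s) (Num.min (grid n i.+1) s)
     - A (Num.max s (Num.min (grid n i) t)) (Num.max s (Num.min (grid n i.+1) t))|
   <= K * (2^-1 ^+ n) `^ mu.
Proof.
move=> s01 t01 st.
have x0 := grid_ge0 n i.
have h0 : 0 <= 2^-1 ^+ n :> R by rewrite exprn_ge0 ?invr_ge0.
rewrite gridS; set h := 2^-1 ^+ n in h0 *.
set x := grid n i in x0 *.
have i1 : in01 (Num.min x t) by exact: in01_min.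
have i2 : in01 (Num.min (x + h) t) by rewrite in01_min// addr_ge0.
have sm y : s <= y -> s <= Num.min y t by move=> sy; rewrite le_min sy st.
have ms y : y <= s -> Num.min y s = y /\ Num.min y t = y.
  by move=> ys; split; apply/min_idPl => //; exact: le_trans st.
have dv : `|Num.min (x + h) t - Num.min x t| <= h.
  by move: (leP (x + h) t) (leP x t) => [] ? [] ?; rewrite ler_norml; lra.
have nn : 0 <= K * h `^ mu by rewrite mulr_ge0 ?powR_ge0.
have /orP[xhs|sxh] := le_total (x + h) s.
  have xs : x <= s by lra.
  have [-> ->] := ms _ xs; have [-> ->] := ms _ xhs.
  rewrite (max_idPl xs) (max_idPl xhs) (germ_diag a0 gA s01).
  by rewrite subrr subr0 normr0.
have /orP[xs|sx] := le_total x s.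
  have [-> ->] := ms _ xs; rewrite (max_idPl xs).
  rewrite (max_idPr (sm _ sxh)).
  rewrite (min_idPr sxh); apply: germ_le => //.
  - by rewrite -(ms _ xs).2.
  - by rewrite ler_norml; lra.
  - by move: (leP (x + h) t) => [] ?; rewrite ler_norml; lra.
rewrite (min_idPr sx) (min_idPr sxh) (germ_diag a0 gA s01).
rewrite (max_idPr (sm _ sx)) (max_idPr (sm _ sxh)).
by rewrite subr0 subrr normr0.
Qed.

Let sew_bound_le s t : in01 s -> in01 t -> s <= t ->
  `|A s t - sew A s t| <= split_cst mu * K * (t - s) `^ mu.
Proof.
move=> s01 t01 st; apply/ler_addgt0Pr => e e0.
have C0 : 0 <= K / (1 - q) by rewrite divr_ge0// subr_ge0 ltW.
have [n Hn] := @geo_cvg e (K + K / (1 - q) *+ 2) e0 (addr_ge0 K0 (mulrn_wge0 _ C0)).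
pose u i := Num.max s (Num.min (grid n i) t).
have u01 i : in01 (u i).
  rewrite /u /in01; have := grid_ge0 n i; move: s01 t01; rewrite /in01.
  by case: (leP (grid n i) t) => ?;
    [case: (leP s (grid n i)) | case: (leP s t)] => ?; lra.
have umono : {homo u : i j / (i <= j)%N >-> i <= j}.
  move=> i j /(@grid_mono n) ij; rewrite /u ge_max !le_max lexx/=.
  rewrite le_min !ge_min lexx orbT andbT; apply/orP; right.
  by rewrite ij.
have := partition_sum_bound a0 g0 mu1 gA u01 umono (leq0n (2 ^ n)).
have -> : u 0%N = s.
  rewrite /u grid0; move: s01 t01 => /andP[? _] /andP[? _].
  by rewrite (min_idPl _)// (max_idPl _).
have -> : u (2 ^ n)%N = t.
  rewrite /u grid_end; move: s01 t01 => /andP[? _] /andP[_ ?].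
  by rewrite (min_idPr _)// (max_idPr _).
move=> HT.
have HJ : `|dyadic_sum A n t - dyadic_sum A n s
    - \sum_(0 <= i < 2 ^ n) A (u i) (u i.+1)| <= K * q ^+ n.
  rewrite /dyadic_sum -!sumrB; apply: sum_cells_le => // i.
  exact: split_cell_le.
have Ht := dyadic_lim_dist n t01; have Hs := dyadic_lim_dist n s01.
rewrite -/mu in HT.
move: HT HJ Ht Hs Hn; rewrite /sew -/q.
set S := \sum_(_ <= _ < _) _; set x := K / (1 - q) * _.
rewrite mulrDl mulrnAl -/x; set y := K * _.
set z := split_cst mu * K * _.
set jt := dyadic_sum A n t; set js := dyadic_sum A n s.
rewrite !ler_norml; lra.
Qed.

Definition sew_cst mu : R := split_cst mu + 1.

Lemma sew_cst_ge0 nu : 1 < nu -> 0 <= sew_cst nu.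
Proof. by move=> nu1; rewrite addr_ge0// split_cst_ge0. Qed.

(** For [t < s] the bound follows from the ordered case and from the defect of
    the germ at the points s, t, s, whence the additional 1 in the constant. *)
Lemma sew_bound s t : in01 s -> in01 t ->
  `|A s t - sew A s t| <= sew_cst mu * K * `|t - s| `^ mu.
Proof.
move=> s01 t01; have C0 := split_cst_ge0 mu1.
have [st|ts] := leP s t.
  apply: (le_trans (sew_bound_le s01 t01 st)).
  rewrite ger0_norm ?subr_ge0// ler_wpM2r ?powR_ge0// ler_wpM2r//.
  by rewrite /sew_cst lerDl.
have H := sew_bound_le t01 s01 (ltW ts).
have h := @germ_le s t s `|t - s| s01 t01 s01 (lexx _).
have {}h := h ltac:(by rewrite distrC).
rewrite (germ_diag a0 gA s01) in h.
have E : `|t - s| = s - t by rewrite distrC ger0_norm ?subr_ge0// ltW.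
rewrite E in h *; move: H h; rewrite /sew /sew_cst.
rewrite !mulrDl mul1r.
set x := split_cst mu * K * _; set y := K * _.
rewrite !ler_norml; lra.
Qed.

End Germ.

Lemma sew_additive A : additive01 (sew A).
Proof. by move=> s1 s2 s3 _ _ _; rewrite /sew; ring. Qed.
End Sewing2.

(** * Uniqueness and linearity of the sewing *)

Section SewingProperties.
Variable R : realType.
Implicit Types (a b g K C e mu s t : R) (A B F : R -> R -> R).

Lemma additive_sum F (u : nat -> R) n : additive01 F ->
  (forall i, (i <= n)%N -> in01 (u i)) ->
  F (u 0%N) (u n) = \sum_(0 <= i < n) F (u i) (u i.+1).
Proof.
move=> Fadd; elim: n => [|n IH] u01.
  rewrite big_geq//; have i0 := u01 0%N (leqnn _).
  by have := Fadd _ _ _ i0 i0 i0; lra.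
rewrite big_nat_recr//= -IH; last by move=> i ni; apply: u01; exact: leqW.
by apply: Fadd; apply: u01 => //; exact: leqnSn.
Qed.

Lemma in01_conv s t c : in01 s -> in01 t -> 0 <= c <= 1 ->
  in01 (s + c * (t - s)).
Proof. by rewrite /in01 => ? ? ?; apply/andP; split; nra. Qed.

(** An additive increment is the sum of its values over the cells of a uniform
    partition, hence inherits from small intervals any linear bound. *)
Lemma additive_local_lipschitz F d e : additive01 F -> 0 < d ->
  (forall s t, in01 s -> in01 t -> `|t - s| < d -> `|F s t| <= e * `|t - s|) ->
  forall s t, in01 s -> in01 t -> `|F s t| <= e * `|t - s|.
Proof.
move=> Fadd d0 Floc s t s01 t01.
pose N := (Num.bound d^-1).+1.
have N0 : 0 < N%:R :> R by rewrite ltr0n.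
have Nd : N%:R^-1 < d.
  rewrite -[ltRHS]invrK ltf_pV2 ?posrE ?invr_gt0//.
  apply: lt_trans (_ : (Num.bound d^-1)%:R < _); last by rewrite ltr_nat.
  by apply: archi_boundP; rewrite invr_ge0 ltW.
pose u i := s + i%:R / N%:R * (t - s).
have u01 i : (i <= N)%N -> in01 (u i).
  move=> iN; apply: in01_conv => //.
  by rewrite divr_ge0//= ler_pdivrMr// mul1r ler_nat.
have := additive_sum Fadd u01.
have -> : u 0%N = s by rewrite /u !mul0r addr0.
have -> : u N = t by rewrite /u divff ?gt_eqF// mul1r addrC subrK.
move=> ->; apply: (le_trans (ler_norm_sum _ _ _)).
apply: (@le_trans _ _ (\sum_(0 <= i < N) e * (N%:R^-1 * `|t - s|))).
  apply: ler_sum_nat => i /andP[_ iN].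
  have uE : u i.+1 - u i = N%:R^-1 * (t - s).
    by rewrite /u -natr1; ring.
  have uN : `|u i.+1 - u i| = N%:R^-1 * `|t - s|.
    by rewrite uE normrM ger0_norm// invr_ge0 ltW.
  rewrite -uN; apply: Floc; [exact: u01 (ltnW iN)|exact: u01|].
  rewrite uN; apply: le_lt_trans Nd; rewrite ler_piMr ?invr_ge0 ?(ltW N0)//.
  exact: in01_dist.
rewrite sumr_const_nat subn0 -[_ *+ N]mulr_natr le_eqVlt; apply/orP; left.
by apply/eqP; field; rewrite gt_eqF.
Qed.

Lemma small_powR mu C e : 1 < mu -> 0 <= C -> 0 < e ->
  exists2 d, 0 < d & forall s t, `|t - s| < d ->
    C * `|t - s| `^ mu <= e * `|t - s|.
Proof.
move=> mu1 C0 e0; have m0 : 0 < mu - 1 by rewrite subr_gt0.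
have eC0 : 0 < e / (C + 1) by rewrite divr_gt0// ltr_wpDl.
exists ((e / (C + 1)) `^ (mu - 1)^-1); first by rewrite powR_gt0.
move=> s t std; have -> : mu = 1 + (mu - 1) by rewrite addrC subrK.
rewrite powR_exprD// powRr1// mulrCA [leRHS]mulrC ler_wpM2l//.
apply: (@le_trans _ _ (C * (e / (C + 1)))).
  rewrite ler_wpM2l//.
  have -> : e / (C + 1) = (e / (C + 1)) `^ (mu - 1)^-1 `^ (mu - 1).
    by rewrite -powRrM mulVf ?gt_eqF// powRr1// ltW.
  by apply: powR_mono => //; exact: ltW.
rewrite mulrA ler_pdivrMr ?ltr_wpDl// mulrC.
by rewrite ler_wpM2l ?ltW// ltrDl.
Qed.

(** A power larger than 1 is, on small intervals, below any multiple of the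
    length; for an additive increment this then holds on all intervals. *)
Lemma additive_eq0 F mu C : additive01 F -> 1 < mu ->
  (forall s t, in01 s -> in01 t -> `|F s t| <= C * `|t - s| `^ mu) ->
  forall s t, in01 s -> in01 t -> F s t = 0.
Proof.
move=> Fadd mu1 FC s t s01 t01.
have C0 : 0 <= C.
  have := FC 0 1 (in010 R) (in011 R).
  by rewrite subr0 normr1 powR1 mulr1; exact: le_trans.
apply/eqP; rewrite -normr_le0; apply/ler_addgt0Pr => e e0; rewrite add0r.
have [d d0 Hd] := small_powR mu1 C0 e0.
apply: (@le_trans _ _ (e * `|t - s|)).
  apply: (additive_local_lipschitz Fadd d0) => // s' t' s01' t01' std.
  exact: (le_trans (FC _ _ s01' t01') (Hd _ _ std)).
by rewrite ler_piMr ?in01_dist// ltW.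
Qed.

Lemma powR_dist_le a b s t : 0 < a <= b -> in01 s -> in01 t ->
  `|t - s| `^ b <= `|t - s| `^ a.
Proof.
by move=> ab s01 t01; apply: powR_ler_exp; rewrite ?normr_ge0 ?in01_dist.
Qed.

Lemma additiveB F A : additive01 F -> additive01 A ->
  additive01 (fun s t => F s t - A s t).
Proof.
move=> Fadd Aadd s1 s2 s3 i1 i2 i3.
by rewrite (Fadd _ _ _ i1 i2 i3) (Aadd _ _ _ i1 i2 i3); ring.
Qed.

(** Two sewings of the same germ agree even if they are approximated with
    different exponents. This makes [Lambda1] independent of the exponent found
    for its argument. *)
Lemma additive_unique A B B' mu mu' C C' : additive01 B -> additive01 B' ->
  1 < mu -> 1 < mu' ->
  (forall s t, in01 s -> in01 t -> `|A s t - B s t| <= C * `|t - s| `^ mu) ->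
  (forall s t, in01 s -> in01 t -> `|A s t - B' s t| <= C' * `|t - s| `^ mu') ->
  forall s t, in01 s -> in01 t -> B s t = B' s t.
Proof.
move=> Badd Badd' mu1 mu1' AB AB' s t s01 t01; apply/eqP; rewrite -subr_eq0.
apply/eqP; have m1 : 1 < Num.min mu mu' by rewrite lt_min mu1.
apply: (additive_eq0 (additiveB Badd Badd') m1 (C := `|C| + `|C'|)) => //.
move=> {}s {}t {}s01 {}t01.
have h c (x : R) nu : Num.min mu mu' <= nu -> `|x| <= c * `|t - s| `^ nu ->
    `|x| <= `|c| * `|t - s| `^ Num.min mu mu'.
  move=> mnu xc; apply: (le_trans xc).
  apply: (@le_trans _ _ (`|c| * `|t - s| `^ nu)).
    by rewrite ler_wpM2r ?powR_ge0// ler_norm.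
  by rewrite ler_wpM2l// powR_dist_le// mnu (lt_trans ltr01).
have mm : Num.min mu mu' <= mu by rewrite ge_min lexx.
have mm' : Num.min mu mu' <= mu' by rewrite ge_min lexx orbT.
have := h _ _ _ mm (AB _ _ s01 t01); have := h _ _ _ mm' (AB' _ _ s01 t01).
rewrite mulrDl !ler_norml; lra.
Qed.

Lemma sew_eq A B a g K mu C : 0 < a -> 0 < g -> 1 < a + g -> germ a g K A ->
  additive01 B -> 1 < mu ->
  (forall s t, in01 s -> in01 t -> `|A s t - B s t| <= C * `|t - s| `^ mu) ->
  forall s t, in01 s -> in01 t -> sew A s t = B s t.
Proof.
move=> a0 g0 ag gA Badd mu1 AB.
exact: (additive_unique (sew_additive A) Badd ag mu1 (sew_bound a0 g0 ag gA) AB).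
Qed.

(** The sewing is a limit, so its linearity only asks for convergence. Germs with
    different exponents can thus be added, as can differences of germs. *)
Definition sewable A := forall s, in01 s -> cvgn (dyadic_sum A ^~ s).

Lemma germ_sewable a g K A : 0 < a -> 0 < g -> 1 < a + g -> germ a g K A ->
  sewable A.
Proof.
move=> a0 g0 ag gA s s01; apply/cvg_ex; exists (dyadic_lim A s).
exact: (dyadic_cvg a0 g0 ag gA).
Qed.

Definition eq01 A B := forall s t, in01 s -> in01 t -> A s t = B s t.

Lemma dyadic_sum_eq A B n s : eq01 A B -> in01 s ->
  dyadic_sum A n s = dyadic_sum B n s.
Proof.
move=> AB s01; apply: eq_bigr => i _.
by apply: AB; apply: in01_min => //; exact: grid_ge0.
Qed.

Lemma sew_sub A B F : sewable A -> sewable B ->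
  eq01 F (fun s t => A s t - B s t) ->
  sewable F /\ eq01 (sew F) (fun s t => sew A s t - sew B s t).
Proof.
move=> cA cB FE.
have E s : in01 s ->
    dyadic_sum F ^~ s = dyadic_sum A ^~ s - dyadic_sum B ^~ s.
  move=> s01; apply/funext => n; rewrite (dyadic_sum_eq n FE s01).
  by rewrite [in RHS]/GRing.add/= /GRing.opp/= /dyadic_sum -sumrB.
split=> [s s01|s t s01 t01]; first by rewrite E//; apply: is_cvgB; [exact: cA|exact: cB].
have L u : in01 u -> dyadic_lim F u = dyadic_lim A u - dyadic_lim B u.
  by move=> u01; rewrite /dyadic_lim E// limB//; [exact: cA|exact: cB].
by rewrite /sew !L//; ring.
Qed.

Lemma sew_add A B F : sewable A -> sewable B ->
  eq01 F (fun s t => A s t + B s t) ->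
  sewable F /\ eq01 (sew F) (fun s t => sew A s t + sew B s t).
Proof.
move=> cA cB FE.
have E s : in01 s ->
    dyadic_sum F ^~ s = dyadic_sum A ^~ s + dyadic_sum B ^~ s.
  move=> s01; apply/funext => n; rewrite (dyadic_sum_eq n FE s01).
  by rewrite [in RHS]/GRing.add/= /dyadic_sum -big_split.
split=> [s s01|s t s01 t01]; first by rewrite E//; apply: is_cvgD; [exact: cA|exact: cB].
have L u : in01 u -> dyadic_lim F u = dyadic_lim A u + dyadic_lim B u.
  by move=> u01; rewrite /dyadic_lim E// limD//; [exact: cA|exact: cB].
by rewrite /sew !L//; ring.
Qed.

Lemma partition_sum_dist A B mu C h (u : nat -> R) n : additive01 B ->
  1 < mu -> 0 <= C ->
  (forall s t, in01 s -> in01 t -> `|A s t - B s t| <= C * `|t - s| `^ mu) ->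
  (forall i, (i <= n)%N -> in01 (u i)) ->
  (forall i, (i < n)%N -> 0 <= u i.+1 - u i <= h) ->
  `|\sum_(0 <= i < n) A (u i) (u i.+1) - B (u 0%N) (u n)| <= C * h `^ (mu - 1).
Proof.
move=> Badd mu1 C0 AB u01 uh; rewrite (additive_sum Badd u01) -sumrB.
apply: (le_trans (ler_norm_sum _ _ _)).
apply: (@le_trans _ _ (\sum_(0 <= i < n) C * h `^ (mu - 1) * (u i.+1 - u i))).
  apply: ler_sum_nat => i /andP[_ ni].
  apply: (le_trans (AB _ _ (u01 _ (ltnW ni)) (u01 _ ni))).
  have /andP[d0 dh] := uh _ ni; rewrite ger0_norm//.
  rewrite -mulrA ler_wpM2l//; set d := u i.+1 - u i in d0 dh *.
  rewrite powR_split1//.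
  by rewrite ler_wpM2r// powR_mono// subr_ge0 ltW.
rewrite -mulr_sumr telescope_sumr// ler_piMr ?mulr_ge0 ?powR_ge0//.
have /andP[? ?] := u01 n (leqnn _); have /andP[? ?] := u01 0%N (leq0n _); lra.
Qed.

End SewingProperties.

(** * Continuity of the sewing in its parameters *)

Section Clamp.
Variable R : realType.
Implicit Types (s t : R) (A B : R -> R -> R -> R -> R).

Definition clamp s : R := Num.max 0 (Num.min s 1).

Lemma in01_clamp s : in01 (clamp s).
Proof. by rewrite /in01 /clamp; case: (leP s 1) => ?;
  [case: (leP 0 s)|case: (leP 0 (1 : R))] => ?; lra. Qed.

Lemma clamp_id s : in01 s -> clamp s = s.
Proof. by move=> /andP[s0 s1]; rewrite /clamp (min_idPl s1) (max_idPr s0). Qed.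

Lemma clamp_continuous : continuous clamp.
Proof.
move=> s; apply: (@continuous_max R R (fun=> 0) (fun s => Num.min s 1)).
  exact: cst_continuous.
apply: (@continuous_min R R id (fun=> 1)); first exact: cvg_id.
exact: cst_continuous.
Qed.

Lemma continuous_pair (T U V : topologicalType) (f : T -> U) (g : T -> V) :
  continuous f -> continuous g -> continuous (fun x => (f x, g x)).
Proof. by move=> cf cg x; apply: cvg_pair; [exact: cf|exact: cg]. Qed.

Lemma continuous_sum_nat (T : topologicalType) (F : nat -> T -> R) n :
  (forall i, continuous (F i)) ->
  continuous (fun x => \sum_(0 <= i < n) F i x).
Proof.
move=> cF; elim: n => [|n IH].
  under eq_fun do rewrite big_geq//; exact: cst_continuous.
under eq_fun do rewrite big_nat_recr//=.
by move=> x; apply: continuousD; [exact: IH|exact: cF].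
Qed.

Lemma continuous_unif_approx (T : topologicalType) (f : T -> R) :
  (forall e, 0 < e -> exists2 h : T -> R, continuous h &
     forall x, `|f x - h x| <= e) -> continuous f.
Proof.
move=> H x; apply/cvgrPdist_lt => e e0.
have e40 : 0 < e / 4 by rewrite divr_gt0.
have [h ch fh] := H _ e40.
have /cvgrPdist_lt /(_ _ e40) := ch x.
apply: filterS => y hxy.
move: (fh x) (fh y) hxy; rewrite !ltr_norml !ler_norml; lra.
Qed.

(** Continuity on the cube, expressed on the whole space by precomposition with
    the retraction of the line onto [0, 1]. *)
Definition cont4 A := continuous (fun p : (R * R) * (R * R) =>
  A (clamp p.1.1) (clamp p.1.2) (clamp p.2.1) (clamp p.2.2)).

Lemma cont4_comp A (T : topologicalType) (f1 f2 g1 g2 : T -> R) : cont4 A ->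
  continuous f1 -> continuous f2 -> continuous g1 -> continuous g2 ->
  continuous (fun x =>
    A (clamp (f1 x)) (clamp (f2 x)) (clamp (g1 x)) (clamp (g2 x))).
Proof.
move=> cA c1 c2 d1 d2 x.
have cp : continuous (fun x => ((f1 x, f2 x), (g1 x, g2 x))).
  by apply: continuous_pair; apply: continuous_pair.
exact: (continuous_comp (cp x) (cA ((f1 x, f2 x), (g1 x, g2 x)))).
Qed.

Definition eq4 A B := forall s1 s2 t1 t2, in01 s1 -> in01 s2 ->
  in01 t1 -> in01 t2 -> A s1 s2 t1 t2 = B s1 s2 t1 t2.

Lemma cont4D A B : cont4 A -> cont4 B ->
  cont4 (fun s1 s2 t1 t2 => A s1 s2 t1 t2 + B s1 s2 t1 t2).
Proof. by move=> cA cB p; apply: continuousD; [exact: cA|exact: cB]. Qed.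

Lemma cont4B A B : cont4 A -> cont4 B ->
  cont4 (fun s1 s2 t1 t2 => A s1 s2 t1 t2 - B s1 s2 t1 t2).
Proof. by move=> cA cB p; apply: continuousB; [exact: cA|exact: cB]. Qed.

Lemma cont4M A B : cont4 A -> cont4 B ->
  cont4 (fun s1 s2 t1 t2 => A s1 s2 t1 t2 * B s1 s2 t1 t2).
Proof. by move=> cA cB p; apply: continuousM; [exact: cA|exact: cB]. Qed.

Definition swap A : R -> R -> R -> R -> R := fun t1 t2 s1 s2 => A s1 s2 t1 t2.

Lemma fst_cont (U V : topologicalType) : continuous (@fst U V).
Proof. by move=> p; exact: cvg_fst. Qed.

Lemma snd_cont (U V : topologicalType) : continuous (@snd U V).
Proof. by move=> p; exact: cvg_snd. Qed.

Lemma fst_comp_cont (T U V : topologicalType) (f : T -> U * V) :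
  continuous f -> continuous (fun x => (f x).1).
Proof. by move=> cf x; apply: (continuous_comp (cf x)); exact: fst_cont. Qed.

Lemma snd_comp_cont (T U V : topologicalType) (f : T -> U * V) :
  continuous f -> continuous (fun x => (f x).2).
Proof. by move=> cf x; apply: (continuous_comp (cf x)); exact: snd_cont. Qed.

Lemma cont4_swap A : cont4 A -> cont4 (swap A).
Proof.
move=> cA; apply: (cont4_comp cA);
  by [apply: fst_comp_cont; by [exact: fst_cont|exact: snd_cont]
     |apply: snd_comp_cont; by [exact: fst_cont|exact: snd_cont]].
Qed.

Definition sew2 A : R -> R -> R -> R -> R := fun s1 s2 => sew (A s1 s2).
Definition sew1 A : R -> R -> R -> R -> R := swap (sew2 (swap A)).

(** The dyadic sums are continuous, and they converge at a rate that only depends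
    on the constant and the exponents of the germ. *)
Lemma sew2_continuous a g K A : 0 < a -> 0 < g -> 1 < a + g ->
  (forall s1 s2, in01 s1 -> in01 s2 -> germ a g K (A s1 s2)) ->
  cont4 A -> cont4 (sew2 A).
Proof.
move=> a0 g0 ag gA cA.
pose J (q : (R * R) * R) :=
  dyadic_lim (A (clamp q.1.1) (clamp q.1.2)) (clamp q.2).
suff cJ : continuous J.
  move=> p; apply: (@continuousB _ _ _ (fun p => J (p.1, p.2.2))
    (fun p => J (p.1, p.2.1))).
    apply: (@continuous_comp _ _ _ (fun p : (R * R) * (R * R) => (p.1, p.2.2)) J p).
      apply: continuous_pair; first exact: fst_cont.
      by apply: snd_comp_cont; exact: snd_cont.
    exact: cJ.
  apply: (@continuous_comp _ _ _ (fun p : (R * R) * (R * R) => (p.1, p.2.1)) J p).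
    apply: continuous_pair; first exact: fst_cont.
    by apply: fst_comp_cont; exact: snd_cont.
  exact: cJ.
pose q := half_ratio (a + g).
have q0 : 0 <= q by exact: half_ratio_ge0.
have q1 : q < 1 by exact: half_ratio_lt1.
apply: continuous_unif_approx => e e0.
have : (fun n => K / (1 - q) * q ^+ n) @ \oo --> K / (1 - q) * 0.
  by apply: cvgMl_tmp; apply: cvg_expr; rewrite ger0_norm.
rewrite mulr0 => /cvgrPdist_lt /(_ _ e0) [n _ /(_ n (leqnn n))] /=.
rewrite sub0r normrN => Hn.
exists (fun p => dyadic_sum (A (clamp p.1.1) (clamp p.1.2)) n (clamp p.2)).
  rewrite /dyadic_sum; apply: continuous_sum_nat => i.
  have cg c : continuous (fun p : (R * R) * R => Num.min c (clamp p.2)).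
    move=> p; apply: (@continuous_min R _ (fun=> c) (fun p => clamp p.2)).
      exact: cst_continuous.
    by apply: (continuous_comp (@snd_cont _ _ p)); exact: clamp_continuous.
  have E p : A (clamp p.1.1) (clamp p.1.2)
      (Num.min (grid R n i) (clamp p.2)) (Num.min (grid R n i.+1) (clamp p.2)) =
    A (clamp p.1.1) (clamp p.1.2)
      (clamp (Num.min (grid R n i) (clamp p.2)))
      (clamp (Num.min (grid R n i.+1) (clamp p.2))).
    have c1 j : clamp (Num.min (grid R n j) (clamp p.2))
        = Num.min (grid R n j) (clamp p.2).
      by apply/clamp_id/in01_min; [exact: in01_clamp|exact: grid_ge0].
    by rewrite !c1.
  under eq_fun do rewrite E.
  apply: (cont4_comp cA).
  - by apply: fst_comp_cont; exact: fst_cont.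
  - by apply: snd_comp_cont; exact: fst_cont.
  - exact: cg.
  - exact: cg.
move=> p; rewrite /J.
apply: (le_trans (dyadic_lim_dist a0 g0 ag (gA _ _ _ _) n _)); rewrite ?in01_clamp//.
by apply: ltW; apply: le_lt_trans Hn; exact: ler_norm.
Qed.

End Clamp.

(** * Sewing in the two directions *)

Section Bigerm.
Variable R : realType.
Implicit Types (s t : R) (A B : R -> R -> R -> R -> R).

Lemma norm_le_dist (x y u c : R) :
  `|x| <= u -> `|x - y| <= c * u -> `|y| <= (1 + c) * u.
Proof. by rewrite mulrDl mul1r !ler_norml; lra. Qed.

Definition diff1 A s1 s2 s3 : R -> R -> R := fun t1 t2 =>
  A s1 s3 t1 t2 - A s1 s2 t1 t2 - A s2 s3 t1 t2.

(** The last bound says that [diff1 A s1 s2 s3] is a germ in the second direction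
    with a constant that is itself a germ bound in the first direction. As the
    sewing commutes with [diff1], the sewing of [A] in the second direction is
    then a germ in the first one. *)
Record bigerm (a1 a2 g1 g2 K : R) A : Prop := Bigerm {
  bigerm_bound : forall s1 s2 t1 t2,
    in01 s1 -> in01 s2 -> in01 t1 -> in01 t2 ->
    `|A s1 s2 t1 t2| <= K * (`|s2 - s1| `^ g1 * `|t2 - t1| `^ g2);
  bigerm_diff1 : forall s1 s2 s3 t1 t2,
    in01 s1 -> in01 s2 -> in01 s3 -> in01 t1 -> in01 t2 ->
    `|diff1 A s1 s2 s3 t1 t2| <=
      K * ((`|s2 - s1| `^ a1 * `|s3 - s2| `^ g1) * `|t2 - t1| `^ g2);
  bigerm_diff2 : forall s1 s2 t1 t2 t3,
    in01 s1 -> in01 s2 -> in01 t1 -> in01 t2 -> in01 t3 ->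
    `|diff1 (swap A) t1 t2 t3 s1 s2| <=
      K * (`|s2 - s1| `^ g1 * (`|t2 - t1| `^ a2 * `|t3 - t2| `^ g2));
  bigerm_diff12 : forall s1 s2 s3 t1 t2 t3,
    in01 s1 -> in01 s2 -> in01 s3 -> in01 t1 -> in01 t2 -> in01 t3 ->
    `|diff1 A s1 s2 s3 t1 t3 - diff1 A s1 s2 s3 t1 t2
      - diff1 A s1 s2 s3 t2 t3| <=
      K * ((`|s2 - s1| `^ a1 * `|s3 - s2| `^ g1) *
           (`|t2 - t1| `^ a2 * `|t3 - t2| `^ g2)) }.

Definition add1 A := forall t1 t2, in01 t1 -> in01 t2 ->
  additive01 (fun s1 s2 => A s1 s2 t1 t2).
Definition add2 A := forall s1 s2, in01 s1 -> in01 s2 -> additive01 (A s1 s2).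
Definition biadditive A := add1 A /\ add2 A.

Definition sew12 A : R -> R -> R -> R -> R := sew1 (sew2 A).

Definition sewable1 A := forall t1 t2, in01 t1 -> in01 t2 ->
  sewable (fun s1 s2 => A s1 s2 t1 t2).
Definition sewable2 A := forall s1 s2, in01 s1 -> in01 s2 -> sewable (A s1 s2).

Lemma sew2_sub A B C : sewable2 A -> sewable2 B ->
  eq4 C (fun s1 s2 t1 t2 => A s1 s2 t1 t2 - B s1 s2 t1 t2) ->
  eq4 (sew2 C) (fun s1 s2 t1 t2 => sew2 A s1 s2 t1 t2 - sew2 B s1 s2 t1 t2).
Proof.
move=> sA sB CE s1 s2 t1 t2 i1 i2 j1 j2.
have CE' : eq01 (C s1 s2) (fun t t' => A s1 s2 t t' - B s1 s2 t t').
  by move=> t t' *; exact: CE.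
exact: (sew_sub (sA _ _ i1 i2) (sB _ _ i1 i2) CE').2.
Qed.

Lemma sew1_sub A B C : sewable1 A -> sewable1 B ->
  eq4 C (fun s1 s2 t1 t2 => A s1 s2 t1 t2 - B s1 s2 t1 t2) ->
  eq4 (sew1 C) (fun s1 s2 t1 t2 => sew1 A s1 s2 t1 t2 - sew1 B s1 s2 t1 t2).
Proof.
move=> sA sB CE s1 s2 t1 t2 i1 i2 j1 j2.
have CE' : eq01 (fun s s' => C s s' t1 t2)
    (fun s s' => A s s' t1 t2 - B s s' t1 t2) by move=> s s' *; exact: CE.
exact: (sew_sub (sA _ _ j1 j2) (sB _ _ j1 j2) CE').2.
Qed.

Section Young.
Variables (a1 a2 g1 g2 K : R).
Hypotheses (a10 : 0 < a1) (a20 : 0 < a2) (g10 : 0 < g1) (g20 : 0 < g2).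
Hypotheses (mu1 : 1 < a1 + g1) (mu2 : 1 < a2 + g2).
Variable A : R -> R -> R -> R -> R.
Hypothesis gA : bigerm a1 a2 g1 g2 K A.

Let c1 := sew_cst (a1 + g1).
Let c2 := sew_cst (a2 + g2).
Let c10 : 0 <= c1. Proof. exact: sew_cst_ge0. Qed.
Let c20 : 0 <= c2. Proof. exact: sew_cst_ge0. Qed.

Let c2p : 0 <= 1 + c2. Proof. by rewrite addr_ge0. Qed.

Lemma bigerm_ge0 : 0 <= K.
Proof.
have := bigerm_bound gA (in010 R) (in011 R) (in010 R) (in011 R).
by rewrite !subr0 normr1 !powR1 !mulr1; exact: le_trans.
Qed.
Let K0 := bigerm_ge0.

Lemma bigerm_germ s1 s2 : in01 s1 -> in01 s2 ->
  germ a2 g2 (K * `|s2 - s1| `^ g1) (A s1 s2).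
Proof.
move=> i1 i2 t1 t2 t3 j1 j2 j3.
by rewrite -mulrA; exact: (bigerm_diff2 gA).
Qed.

Lemma bigerm_germ_diff1 s1 s2 s3 : in01 s1 -> in01 s2 -> in01 s3 ->
  germ a2 g2 (K * (`|s2 - s1| `^ a1 * `|s3 - s2| `^ g1)) (diff1 A s1 s2 s3).
Proof.
move=> i1 i2 i3 t1 t2 t3 j1 j2 j3.
by rewrite -mulrA; exact: (bigerm_diff12 gA).
Qed.

Lemma bigerm_unif s1 s2 : in01 s1 -> in01 s2 -> germ a2 g2 K (A s1 s2).
Proof.
move=> i1 i2 t1 t2 t3 j1 j2 j3; apply: (le_trans (bigerm_germ i1 i2 j1 j2 j3)).
rewrite ler_wpM2r ?mulr_ge0 ?powR_ge0// ler_piMr ?K0//.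
by apply: powR_le1; [exact: ltW|rewrite normr_ge0 in01_dist].
Qed.

Lemma bigerm_sewable : sewable2 A.
Proof. by move=> s1 s2 i1 i2; exact: germ_sewable (bigerm_unif i1 i2). Qed.

Lemma sew2_dist s1 s2 t1 t2 : in01 s1 -> in01 s2 -> in01 t1 -> in01 t2 ->
  `|A s1 s2 t1 t2 - sew2 A s1 s2 t1 t2| <=
    c2 * K * (`|s2 - s1| `^ g1 * `|t2 - t1| `^ (a2 + g2)).
Proof.
move=> i1 i2 j1 j2.
apply: (le_trans (sew_bound a20 g20 mu2 (bigerm_germ i1 i2) j1 j2)).
by rewrite !mulrA.
Qed.

Lemma sew2_diff1 s1 s2 s3 t1 t2 :
  in01 s1 -> in01 s2 -> in01 s3 -> in01 t1 -> in01 t2 ->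
  diff1 (sew2 A) s1 s2 s3 t1 t2 = sew (diff1 A s1 s2 s3) t1 t2.
Proof.
move=> i1 i2 i3 j1 j2; rewrite /diff1.
have S := bigerm_sewable.
have [S' E] := sew_sub (S _ _ i1 i3) (S _ _ i1 i2) (fun _ _ _ _ => erefl).
have [_ ->//] := sew_sub S' (S _ _ i2 i3) (fun _ _ _ _ => erefl).
by rewrite E.
Qed.

Lemma expD_le a g s t : 0 < a -> 0 < g -> in01 s -> in01 t ->
  `|t - s| `^ (a + g) <= `|t - s| `^ g.
Proof.
by move=> a0 g0 s01 t01; apply: powR_dist_le => //; rewrite g0 lerDr ltW.
Qed.

Lemma sew2_bound s1 s2 t1 t2 : in01 s1 -> in01 s2 -> in01 t1 -> in01 t2 ->
  `|sew2 A s1 s2 t1 t2| <=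
    (1 + c2) * K * (`|s2 - s1| `^ g1 * `|t2 - t1| `^ g2).
Proof.
move=> i1 i2 j1 j2.
have h1 := bigerm_bound gA i1 i2 j1 j2.
have h2 : `|A s1 s2 t1 t2 - sew2 A s1 s2 t1 t2| <=
    c2 * K * (`|s2 - s1| `^ g1 * `|t2 - t1| `^ g2).
  apply: (le_trans (sew2_dist i1 i2 j1 j2)).
  by rewrite ler_wpM2l ?mulr_ge0// ler_wpM2l ?powR_ge0// expD_le.
by rewrite -mulrA; apply: norm_le_dist h1 _; rewrite mulrA.
Qed.

(** The defect in the first direction of the sewing in the second one is the
    sewing of the defect. *)
Lemma sew2_germ t1 t2 : in01 t1 -> in01 t2 ->
  germ a1 g1 ((1 + c2) * K * `|t2 - t1| `^ g2) (fun s1 s2 => sew2 A s1 s2 t1 t2).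
Proof.
move=> j1 j2 s1 s2 s3 i1 i2 i3.
rewrite -/(diff1 (sew2 A) s1 s2 s3 t1 t2) sew2_diff1//.
have h1 := bigerm_diff1 gA i1 i2 i3 j1 j2.
have h2 := sew_bound a20 g20 mu2 (bigerm_germ_diff1 i1 i2 i3) j1 j2.
set p := _ * _ `^ g1 in h1 h2 *.
have p0 : 0 <= p by rewrite mulr_ge0 ?powR_ge0.
have {}h2 : `|diff1 A s1 s2 s3 t1 t2 - sew (diff1 A s1 s2 s3) t1 t2| <=
    c2 * K * (p * `|t2 - t1| `^ g2).
  apply: (le_trans h2); rewrite -/c2 [c2 * (K * p)]mulrA -[leLHS]mulrA.
  by rewrite ler_wpM2l ?mulr_ge0// ler_wpM2l// expD_le.
rewrite -!mulrA [_ `^ g2 * p]mulrC.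
by apply: norm_le_dist h1 _; rewrite mulrA.
Qed.

Lemma sew2_germ_unif t1 t2 : in01 t1 -> in01 t2 ->
  germ a1 g1 ((1 + c2) * K) (fun s1 s2 => sew2 A s1 s2 t1 t2).
Proof.
move=> j1 j2 s1 s2 s3 i1 i2 i3; apply: (le_trans (sew2_germ j1 j2 i1 i2 i3)).
rewrite ler_wpM2r ?mulr_ge0 ?powR_ge0// ler_piMr ?mulr_ge0//.
by apply: powR_le1; [exact: ltW|rewrite normr_ge0 in01_dist].
Qed.

Lemma sew2_sewable : sewable1 (sew2 A).
Proof. by move=> t1 t2 j1 j2; exact: germ_sewable (sew2_germ_unif j1 j2). Qed.

Lemma sew12_dist s1 s2 t1 t2 : in01 s1 -> in01 s2 -> in01 t1 -> in01 t2 ->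
  `|sew2 A s1 s2 t1 t2 - sew12 A s1 s2 t1 t2| <=
    c1 * ((1 + c2) * K) * (`|s2 - s1| `^ (a1 + g1) * `|t2 - t1| `^ g2).
Proof.
move=> i1 i2 j1 j2.
apply: (le_trans (sew_bound a10 g10 mu1 (sew2_germ j1 j2) i1 i2)).
by apply: eq_imp_le; rewrite -/c1; ring.
Qed.

Lemma sew12_bound s1 s2 t1 t2 : in01 s1 -> in01 s2 -> in01 t1 -> in01 t2 ->
  `|sew12 A s1 s2 t1 t2| <=
    (1 + c1) * (1 + c2) * K * (`|s2 - s1| `^ g1 * `|t2 - t1| `^ g2).
Proof.
move=> i1 i2 j1 j2.
have h1 := sew2_bound i1 i2 j1 j2.
have h2 : `|sew2 A s1 s2 t1 t2 - sew12 A s1 s2 t1 t2| <=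
    c1 * ((1 + c2) * K) * (`|s2 - s1| `^ g1 * `|t2 - t1| `^ g2).
  apply: (le_trans (sew12_dist i1 i2 j1 j2)).
  by rewrite ler_wpM2l ?mulr_ge0// ler_wpM2r ?powR_ge0// expD_le.
rewrite -[_ * _ * K]mulrA -[leRHS]mulrA.
by apply: norm_le_dist h1 _; rewrite mulrA.
Qed.

(** Additivity in the second direction survives the first sewing, which is
    linear. *)
Lemma sew12_biadditive : biadditive (sew12 A).
Proof.
split=> [t1 t2 j1 j2|s1 s2 i1 i2 t1 t2 t3 j1 j2 j3]; first exact: sew_additive.
have E : eq01 (fun s1 s2 => sew2 A s1 s2 t1 t3)
    (fun s1 s2 => sew2 A s1 s2 t1 t2 + sew2 A s1 s2 t2 t3).
  by move=> s s' _ _; exact: sew_additive.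
exact: (sew_add (sew2_sewable j1 j2) (sew2_sewable j2 j3) E).2.
Qed.

Lemma sew2_cont : cont4 A -> cont4 (sew2 A).
Proof. exact: (sew2_continuous a20 g20 mu2 bigerm_unif). Qed.

Lemma sew12_cont : cont4 A -> cont4 (sew12 A).
Proof.
move=> cA; apply: cont4_swap.
apply: (sew2_continuous a10 g10 mu1 (K := (1 + c2) * K)).
  by move=> t1 t2 j1 j2; exact: sew2_germ_unif.
by apply/cont4_swap/sew2_cont.
Qed.

Definition grid_sum A (u v : nat -> R) n m : R :=
  \sum_(0 <= i < n) \sum_(0 <= j < m) A (u i) (u i.+1) (v j) (v j.+1).

(** The sum is first replaced by its limit in the second direction. The error
    made is itself a germ in the first direction, with a constant that tends
    to 0, and the sums of a germ over all partitions are bounded by its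
    constant. *)
Lemma grid_sum_dist (u v : nat -> R) n m h1 h2 : 0 <= h1 <= 1 ->
  (forall i, (i <= n)%N -> in01 (u i)) -> (forall j, (j <= m)%N -> in01 (v j)) ->
  (forall i, (i < n)%N -> 0 <= u i.+1 - u i <= h1) ->
  (forall j, (j < m)%N -> 0 <= v j.+1 - v j <= h2) ->
  `|grid_sum A u v n m - sew12 A (u 0%N) (u n) (v 0%N) (v m)| <=
    (1 + c1 *+ 2) * (c2 * K) * h2 `^ (a2 + g2 - 1)
    + c1 * ((1 + c2) * K) * h1 `^ (a1 + g1 - 1).
Proof.
move=> /andP[h10 h11] u01 v01 uh vh.
pose B s1 s2 := \sum_(0 <= j < m) A s1 s2 (v j) (v j.+1)
  - sew2 A s1 s2 (v 0%N) (v m).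
set e2 := h2 `^ (a2 + g2 - 1); set e1 := h1 `^ (a1 + g1 - 1).
have e20 : 0 <= e2 by exact: powR_ge0.
have e10 : e1 <= 1 by apply: powR_le1; rewrite ?h10// subr_ge0 ltW.
have Bb s1 s2 : in01 s1 -> in01 s2 -> `|B s1 s2| <= c2 * K * e2 * `|s2 - s1| `^ g1.
  move=> i1 i2; apply: le_trans (partition_sum_dist _ mu2 (C := c2 * (K * `|s2 - s1| `^ g1)) _ _ v01 vh) _.
  - exact: sew_additive.
  - by rewrite !mulr_ge0 ?powR_ge0.
  - by move=> t t' j j'; exact: (sew_bound a20 g20 mu2 (bigerm_germ i1 i2)).
  - by apply: eq_imp_le; rewrite -/e2; ring.
have gB : germ a1 g1 (c2 * K * e2) B.
  move=> s1 s2 s3 i1 i2 i3.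
  have -> : B s1 s3 - B s1 s2 - B s2 s3 =
      \sum_(0 <= j < m) diff1 A s1 s2 s3 (v j) (v j.+1)
      - sew (diff1 A s1 s2 s3) (v 0%N) (v m).
    rewrite -sew2_diff1 ?v01// /diff1 /B !sumrB; ring.
  apply: le_trans (partition_sum_dist _ mu2 (C := c2 * (K * (`|s2 - s1| `^ a1 * `|s3 - s2| `^ g1))) _ _ v01 vh) _.
  - exact: sew_additive.
  - by rewrite !mulr_ge0 ?powR_ge0.
  - by move=> t t' j j'; exact: (sew_bound a20 g20 mu2 (bigerm_germ_diff1 i1 i2 i3)).
  - by apply: eq_imp_le; rewrite -/e2; ring.
have k0 : 0 <= c2 * K * e2 by rewrite !mulr_ge0.
have H1 := partition_sum_dist (@sew_additive _ B) mu1 (mulr_ge0 c10 k0)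
  (sew_bound a10 g10 mu1 gB) u01 uh.
have H2 := sew_bound a10 g10 mu1 gB (u01 0%N (leq0n _)) (u01 n (leqnn _)).
have H3 := Bb _ _ (u01 0%N (leq0n _)) (u01 n (leqnn _)).
have jm : in01 (v 0%N) /\ in01 (v m) by split; apply: v01.
have H4 := partition_sum_dist (@sew_additive _ _) mu1
  (mulr_ge0 c10 (mulr_ge0 (addr_ge0 ler01 c20) K0))
  (sew_bound a10 g10 mu1 (sew2_germ_unif jm.1 jm.2)) u01 uh.
have E : grid_sum A u v n m = \sum_(0 <= i < n) B (u i) (u i.+1)
    + \sum_(0 <= i < n) sew2 A (u i) (u i.+1) (v 0%N) (v m).
  by rewrite /grid_sum -big_split/=; apply: eq_bigr => i _; rewrite subrK.
have le1 s t a : in01 s -> in01 t -> 0 < a -> `|t - s| `^ a <= 1.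
  move=> s01 t01 a0; apply: powR_le1; first exact: ltW.
  by rewrite normr_ge0 in01_dist.
have D (a x y : R) : 0 <= y -> a <= 1 -> x <= y * a -> x <= y.
  by move=> y0 aa xy; apply: (le_trans xy); rewrite ler_piMr.
have un := (u01 0%N (leq0n _), u01 n (leqnn _)).
have {}H1 := D _ _ _ (mulr_ge0 c10 k0) e10 H1.
have {}H2 := D _ _ _ (mulr_ge0 c10 k0) (le1 _ _ _ un.1 un.2 (addr_gt0 a10 g10)) H2.
have {}H3 := D _ _ _ k0 (le1 _ _ _ un.1 un.2 g10) H3.
have {}H4 : `|\sum_(0 <= i < n) sew2 A (u i) (u i.+1) (v 0%N) (v m)
    - sew12 A (u 0%N) (u n) (v 0%N) (v m)| <= c1 * ((1 + c2) * K) * e1 := H4.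
rewrite E; move: H1 H2 H3 H4; rewrite -/c1 -/c2 -/e1.
have -> : (1 + c1 *+ 2) * (c2 * K) * e2
    = c2 * K * e2 + c1 * (c2 * K * e2) + c1 * (c2 * K * e2).
  by clearbody c1 c2; ring.
set x := c1 * (c2 * K * e2); set y := c2 * K * e2; set z := _ * e1.
rewrite !ler_norml; lra.
Qed.

End Young.
End Bigerm.

(** * Products of a path and a germ *)

Section Products.
Variable R : realType.
Implicit Types (s t a b g K C mu : R) (y : R -> R -> R)
  (A B G : R -> R -> R -> R -> R).

Lemma norm_mul_le (x z c d : R) : `|x| <= c -> `|z| <= d -> `|x * z| <= c * d.
Proof. by move=> xc zd; rewrite normrM ler_pM. Qed.

(** Differences of order larger than 1 are not seen by the sewing. *)
Lemma sew_close (A B : R -> R -> R) a b a' b' K K' mu C :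
  0 < a -> 0 < b -> 1 < a + b -> 0 < a' -> 0 < b' -> 1 < a' + b' ->
  germ a b K A -> germ a' b' K' B -> 1 < mu ->
  (forall s t, in01 s -> in01 t -> `|A s t - B s t| <= C * `|t - s| `^ mu) ->
  eq01 (sew A) (sew B).
Proof.
move=> a0 b0 ab a0' b0' ab' gA gB mu1 AB.
pose nu := Num.min mu (a' + b').
have nu1 : 1 < nu by rewrite lt_min mu1.
have nu0 : 0 < nu by rewrite (lt_trans ltr01).
have K0 := germ_ge0 gB.
have c0 : 0 <= sew_cst (a' + b') by exact: sew_cst_ge0.
have C0 : 0 <= C.
  have := AB 0 1 (in010 R) (in011 R).
  by rewrite subr0 normr1 powR1 mulr1; exact: le_trans.
apply: (sew_eq a0 b0 ab gA (sew_additive B) nu1 (C := C + sew_cst (a' + b') * K')).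
move=> s t s01 t01.
have := sew_bound a0' b0' ab' gB s01 t01.
have := AB _ _ s01 t01.
have : `|t - s| `^ mu <= `|t - s| `^ nu.
  by rewrite powR_dist_le// nu0 ge_min lexx.
have : `|t - s| `^ (a' + b') <= `|t - s| `^ nu.
  by rewrite powR_dist_le// nu0 ge_min lexx orbT.
move=> /(ler_wpM2l (mulr_ge0 c0 K0)) h1 /(ler_wpM2l C0) h2.
move=> h3 h4; rewrite [leRHS]mulrDl.
rewrite -[A s t - _](subrKA (B s t)).
apply: (le_trans (ler_normD _ _)); apply: lerD; first exact: le_trans h3 h2.
exact: le_trans h4 h1.
Qed.

(** The defect of a product f m with m additive is - (f s2 - f s1) (m s2 s3):
    Young's condition is that the two exponents exceed 1 together. *)
Lemma germ_mul (f : R -> R) (m : R -> R -> R) a g K C :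
  additive01 m -> (forall s t, in01 s -> in01 t -> `|m s t| <= C * `|t - s| `^ g) ->
  (forall s t, in01 s -> in01 t -> `|f t - f s| <= K * `|t - s| `^ a) ->
  germ a g (K * C) (fun s t => f s * m s t).
Proof.
move=> madd mC fK s1 s2 s3 i1 i2 i3.
have -> : f s1 * m s1 s3 - f s1 * m s1 s2 - f s2 * m s2 s3
    = - ((f s2 - f s1) * m s2 s3) by rewrite (madd _ _ _ i1 i2 i3); ring.
rewrite normrN mulrACA; apply: norm_mul_le; [exact: fK|exact: mC].
Qed.

Definition rect4 y : R -> R -> R -> R -> R := fun s1 s2 t1 t2 =>
  y s2 t2 - y s1 t2 - y s2 t1 + y s1 t1.

Record hol2 (a1 a2 K : R) y : Prop := Hol2 {
  hol2_sup : forall s t, in01 s -> in01 t -> `|y s t| <= K;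
  hol2_1 : forall s1 s2 t, in01 s1 -> in01 s2 -> in01 t ->
    `|y s2 t - y s1 t| <= K * `|s2 - s1| `^ a1;
  hol2_2 : forall s t1 t2, in01 s -> in01 t1 -> in01 t2 ->
    `|y s t2 - y s t1| <= K * `|t2 - t1| `^ a2;
  hol2_12 : forall s1 s2 t1 t2, in01 s1 -> in01 s2 -> in01 t1 -> in01 t2 ->
    `|rect4 y s1 s2 t1 t2| <= K * (`|s2 - s1| `^ a1 * `|t2 - t1| `^ a2) }.

Lemma hol2_ge0 a1 a2 K y : hol2 a1 a2 K y -> 0 <= K.
Proof. by move=> /hol2_sup /(_ _ _ (in010 R) (in010 R)); exact: le_trans. Qed.

Lemma hol2_le a1 a2 K K' y : K <= K' -> hol2 a1 a2 K y -> hol2 a1 a2 K' y.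
Proof.
move=> KK' hy; split.
- by move=> s t i j; apply: le_trans KK'; exact: (hol2_sup hy).
- move=> s1 s2 t i1 i2 j; apply: (le_trans (hol2_1 hy i1 i2 j)).
  by rewrite ler_wpM2r ?powR_ge0.
- move=> s t1 t2 i j1 j2; apply: (le_trans (hol2_2 hy i j1 j2)).
  by rewrite ler_wpM2r ?powR_ge0.
- move=> s1 s2 t1 t2 i1 i2 j1 j2; apply: (le_trans (hol2_12 hy i1 i2 j1 j2)).
  by rewrite ler_wpM2r// mulr_ge0 ?powR_ge0.
Qed.

Lemma hol2_exp a1 a2 b1 b2 K y : 0 < b1 <= a1 -> 0 < b2 <= a2 ->
  hol2 a1 a2 K y -> hol2 b1 b2 K y.
Proof.
move=> h1 h2 hy; have K0 := hol2_ge0 hy; split.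
- exact: (hol2_sup hy).
- move=> s1 s2 t i1 i2 j; apply: (le_trans (hol2_1 hy i1 i2 j)).
  by rewrite ler_wpM2l// powR_dist_le.
- move=> s t1 t2 i j1 j2; apply: (le_trans (hol2_2 hy i j1 j2)).
  by rewrite ler_wpM2l// powR_dist_le.
- move=> s1 s2 t1 t2 i1 i2 j1 j2; apply: (le_trans (hol2_12 hy i1 i2 j1 j2)).
  by rewrite ler_wpM2l// ler_pM ?powR_ge0// powR_dist_le.
Qed.

(** The gluing product of a path with an increment of two variables in each
    direction. *)
Definition mulp y A : R -> R -> R -> R -> R := fun s1 s2 t1 t2 =>
  y s1 t1 * A s1 s2 t1 t2.

(** Leibniz rule for the defects. The defect in both directions has four terms,
    one of which involves the rectangular increment of [y], hence the last bound
    asked for in [hol2]. *)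
Lemma bigerm_mulp a1 a2 g1 g2 K C y A : hol2 a1 a2 K y ->
  bigerm a1 a2 g1 g2 C A -> bigerm a1 a2 g1 g2 (4 * (K * C)) (mulp y A).
Proof.
move=> hy gA; have K0 := hol2_ge0 hy; have C0 := bigerm_ge0 gA.
have KC0 : 0 <= K * C by exact: mulr_ge0.
have pp (p q : R) : 0 <= p -> 0 <= q -> 0 <= p * q by exact: mulr_ge0.
split.
- move=> s1 s2 t1 t2 i1 i2 j1 j2; rewrite /mulp.
  have h := norm_mul_le (hol2_sup hy i1 j1) (bigerm_bound gA i1 i2 j1 j2).
  apply: (le_trans h); rewrite mulrA ler_wpM2r ?pp ?powR_ge0//; lra.
- move=> s1 s2 s3 t1 t2 i1 i2 i3 j1 j2.
  have -> : diff1 (mulp y A) s1 s2 s3 t1 t2 = y s1 t1 * diff1 A s1 s2 s3 t1 t2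
      - (y s2 t1 - y s1 t1) * A s2 s3 t1 t2 by rewrite /diff1 /mulp; ring.
  have h1 := norm_mul_le (hol2_sup hy i1 j1) (bigerm_diff1 gA i1 i2 i3 j1 j2).
  have h2 := norm_mul_le (hol2_1 hy i1 i2 j1) (bigerm_bound gA i2 i3 j1 j2).
  apply: (le_trans (ler_normB _ _)); apply: (le_trans (lerD h1 h2)).
  move: (powR_ge0 `|s2 - s1| a1) (powR_ge0 `|s3 - s2| g1) (powR_ge0 `|t2 - t1| g2).
  set p := _ `^ a1; set q := _ `^ g1; set r := _ `^ g2 => p0 q0 r0.
  have : 0 <= K * C * (p * q * r) by rewrite !pp.
  lra.
- move=> s1 s2 t1 t2 t3 i1 i2 j1 j2 j3.
  have -> : diff1 (swap (mulp y A)) t1 t2 t3 s1 s2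
      = y s1 t1 * diff1 (swap A) t1 t2 t3 s1 s2
      - (y s1 t2 - y s1 t1) * A s1 s2 t2 t3 by rewrite /diff1 /mulp /swap; ring.
  have h1 := norm_mul_le (hol2_sup hy i1 j1) (bigerm_diff2 gA i1 i2 j1 j2 j3).
  have h2 := norm_mul_le (hol2_2 hy i1 j1 j2) (bigerm_bound gA i1 i2 j2 j3).
  apply: (le_trans (ler_normB _ _)); apply: (le_trans (lerD h1 h2)).
  move: (powR_ge0 `|t2 - t1| a2) (powR_ge0 `|t3 - t2| g2) (powR_ge0 `|s2 - s1| g1).
  set p := _ `^ a2; set q := _ `^ g2; set r := _ `^ g1 => p0 q0 r0.
  have : 0 <= K * C * (p * q * r) by rewrite !pp.
  lra.
- move=> s1 s2 s3 t1 t2 t3 i1 i2 i3 j1 j2 j3.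
  have -> : diff1 (mulp y A) s1 s2 s3 t1 t3 - diff1 (mulp y A) s1 s2 s3 t1 t2
      - diff1 (mulp y A) s1 s2 s3 t2 t3
      = y s1 t1 * (diff1 A s1 s2 s3 t1 t3 - diff1 A s1 s2 s3 t1 t2
          - diff1 A s1 s2 s3 t2 t3)
        - (y s1 t2 - y s1 t1) * diff1 A s1 s2 s3 t2 t3
        - (y s2 t1 - y s1 t1) * diff1 (swap A) t1 t2 t3 s2 s3
        + rect4 y s1 s2 t1 t2 * A s2 s3 t2 t3.
    rewrite /diff1 /mulp /swap /rect4; ring.
  have h1 := norm_mul_le (hol2_sup hy i1 j1) (bigerm_diff12 gA i1 i2 i3 j1 j2 j3).
  have h2 := norm_mul_le (hol2_2 hy i1 j1 j2) (bigerm_diff1 gA i1 i2 i3 j2 j3).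
  have h3 := norm_mul_le (hol2_1 hy i1 i2 j1) (bigerm_diff2 gA i2 i3 j1 j2 j3).
  have h4 := norm_mul_le (hol2_12 hy i1 i2 j1 j2) (bigerm_bound gA i2 i3 j2 j3).
  apply: (le_trans (ler_normD _ _)); apply: le_trans (lerD _ h4) _.
    apply: (le_trans (ler_normB _ _)); apply: lerD h3.
    apply: (le_trans (ler_normB _ _)); exact: lerD h1 h2.
  apply: eq_imp_le; ring.
Qed.

Lemma biadditive_bigerm a1 a2 g1 g2 K A : biadditive A ->
  (forall s1 s2 t1 t2, in01 s1 -> in01 s2 -> in01 t1 -> in01 t2 ->
    `|A s1 s2 t1 t2| <= K * (`|s2 - s1| `^ g1 * `|t2 - t1| `^ g2)) ->
  bigerm a1 a2 g1 g2 K A.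
Proof.
move=> [A1 A2] AK.
have K0 : 0 <= K.
  have := AK _ _ _ _ (in010 R) (in011 R) (in010 R) (in011 R).
  by rewrite !subr0 normr1 !powR1 !mulr1; exact: le_trans.
have D1 s1 s2 s3 t1 t2 : in01 s1 -> in01 s2 -> in01 s3 -> in01 t1 -> in01 t2 ->
    diff1 A s1 s2 s3 t1 t2 = 0.
  by move=> i1 i2 i3 j1 j2; rewrite /diff1 (A1 _ _ j1 j2 _ _ _ i1 i2 i3); ring.
split=> //.
- move=> s1 s2 s3 t1 t2 i1 i2 i3 j1 j2.
  by rewrite D1// normr0 !mulr_ge0 ?powR_ge0.
- move=> s1 s2 t1 t2 t3 i1 i2 j1 j2 j3.
  have -> : diff1 (swap A) t1 t2 t3 s1 s2 = 0.
    by rewrite /diff1 /swap (A2 _ _ i1 i2 _ _ _ j1 j2 j3); ring.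
  by rewrite normr0 !mulr_ge0 ?powR_ge0.
- move=> s1 s2 s3 t1 t2 t3 i1 i2 i3 j1 j2 j3.
  by rewrite !D1// !subr0 normr0 !mulr_ge0 ?powR_ge0.
Qed.

(** Linearity of the Young integral. *)
Lemma sew12_sub a1 a2 g1 g2 K C A B D :
  0 < a1 -> 0 < a2 -> 0 < g1 -> 0 < g2 -> 1 < a1 + g1 -> 1 < a2 + g2 ->
  bigerm a1 a2 g1 g2 K A -> bigerm a1 a2 g1 g2 C B ->
  eq4 D (fun s1 s2 t1 t2 => A s1 s2 t1 t2 - B s1 s2 t1 t2) ->
  eq4 (sew12 D) (fun s1 s2 t1 t2 => sew12 A s1 s2 t1 t2 - sew12 B s1 s2 t1 t2).
Proof.
move=> a10 a20 g10 g20 m1 m2 gA gB DE; apply: sew1_sub.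
- exact: (sew2_sewable _ _ _ _ _ _ gA).
- exact: (sew2_sewable _ _ _ _ _ _ gB).
- apply: sew2_sub DE; first exact: (bigerm_sewable a20 g10 g20 m2 gA).
  exact: (bigerm_sewable a20 g10 g20 m2 gB).
Qed.

End Products.

(** * Young integrals against Young integrals *)

Section Associativity.
Variable R : realType.
Variables (a1 a2 g1 g2 K C : R) (y : R -> R -> R) (G : R -> R -> R -> R -> R).
Hypotheses (a10 : 0 < a1) (a20 : 0 < a2) (g10 : 0 < g1) (g20 : 0 < g2).
Hypotheses (mu1 : 1 < a1 + g1) (mu2 : 1 < a2 + g2).
Hypotheses (hy : hol2 a1 a2 K y) (gG : bigerm a1 a2 g1 g2 C G).

Let c1 := sew_cst (a1 + g1).
Let c2 := sew_cst (a2 + g2).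
Let c10 : 0 <= c1. Proof. exact: sew_cst_ge0. Qed.
Let c20 : 0 <= c2. Proof. exact: sew_cst_ge0. Qed.
Let c2p : 0 <= 1 + c2. Proof. by rewrite addr_ge0. Qed.
Let K0 : 0 <= K := hol2_ge0 hy.
Let C0 : 0 <= C := bigerm_ge0 gG.

Lemma bigerm_sew12 :
  bigerm a1 a2 g1 g2 ((1 + c1) * (1 + c2) * C) (sew12 G).
Proof.
apply: biadditive_bigerm; first exact: sew12_biadditive gG.
by move=> *; exact: (sew12_bound a10 a20 g10 g20 mu1 mu2 gG).
Qed.

Lemma bigerm_mulp_sew12 :
  bigerm a1 a2 g1 g2 (4 * (K * ((1 + c1) * (1 + c2) * C))) (mulp y (sew12 G)).
Proof. exact: bigerm_mulp hy bigerm_sew12. Qed.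

Let germ_mulp_sew2 s1 s2 : in01 s1 -> in01 s2 ->
  germ a2 g2 (K * ((1 + c2) * C * `|s2 - s1| `^ g1)) (mulp y (sew2 G) s1 s2).
Proof.
move=> i1 i2; apply: germ_mul; first exact: sew_additive.
- move=> t1 t2 j1 j2; rewrite -mulrA.
  exact: (sew2_bound a20 g20 mu2 gG i1 i2 j1 j2).
- by move=> t1 t2 j1 j2; exact: (hol2_2 hy).
Qed.

Lemma sew2_mulp_sew2 : eq4 (sew2 (mulp y G)) (sew2 (mulp y (sew2 G))).
Proof.
move=> s1 s2 t1 t2 i1 i2 j1 j2.
have gyG := bigerm_germ (bigerm_mulp hy gG) i1 i2.
apply: (sew_close a20 g20 mu2 a20 g20 mu2 gyG (germ_mulp_sew2 i1 i2) mu2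
  (C := K * (c2 * C * `|s2 - s1| `^ g1))) => // s t s01 t01.
rewrite /mulp -mulrBr -mulrA.
apply: norm_mul_le; first exact: (hol2_sup hy).
by rewrite -mulrA; exact: (sew2_dist a20 g20 mu2 gG).
Qed.

(** The integral of a multiple of a germ only depends on the integral of the
    germ: in each direction, the germ may be replaced by its sewing, the
    difference being of order more than 1 and thus killed by that sewing. *)
Lemma sew12_mulp_sew12 : eq4 (sew12 (mulp y G)) (sew12 (mulp y (sew12 G))).
Proof.
pose E s1 s2 t1 t2 := sew2 G s1 s2 t1 t2 - sew12 G s1 s2 t1 t2.
pose e (s1 s2 : R) : R := c1 * ((1 + c2) * C) * `|s2 - s1| `^ (a1 + g1).
have Eb s1 s2 t1 t2 : in01 s1 -> in01 s2 -> in01 t1 -> in01 t2 ->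
    `|E s1 s2 t1 t2| <= e s1 s2 * `|t2 - t1| `^ g2.
  move=> i1 i2 j1 j2; rewrite /e -mulrA.
  exact: (sew12_dist a10 a20 g10 g20 mu1 mu2 gG).
have e0 s1 s2 : 0 <= e s1 s2.
  by rewrite !mulr_ge0 ?powR_ge0.
have Eadd s1 s2 : in01 s1 -> in01 s2 -> additive01 (E s1 s2).
  move=> i1 i2; apply: additiveB; first exact: sew_additive.
  exact: (sew12_biadditive a10 a20 g10 g20 mu1 mu2 gG).2.
have gE s1 s2 : in01 s1 -> in01 s2 -> germ a2 g2 (K * e s1 s2) (mulp y E s1 s2).
  move=> i1 i2; apply: germ_mul; first exact: Eadd.
  - by move=> t1 t2 j1 j2; exact: Eb.
  - by move=> t1 t2 j1 j2; exact: (hol2_2 hy).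
have p1 (x t1 t2 a : R) : 0 < a -> 0 <= x -> in01 t1 -> in01 t2 ->
    x * `|t2 - t1| `^ a <= x.
  move=> a0 x0 j1 j2; rewrite ler_piMr//.
  by apply: powR_le1; [exact: ltW|rewrite normr_ge0 in01_dist].
have sE s1 s2 t1 t2 : in01 s1 -> in01 s2 -> in01 t1 -> in01 t2 ->
    `|sew2 (mulp y E) s1 s2 t1 t2| <= (1 + c2) * (K * e s1 s2).
  move=> i1 i2 j1 j2; apply: (norm_le_dist (x := mulp y E s1 s2 t1 t2)).
    apply: norm_mul_le; first exact: (hol2_sup hy).
    by apply: (le_trans (Eb _ _ _ _ i1 i2 j1 j2)); exact: p1.
  apply: (le_trans (sew_bound a20 g20 mu2 (gE _ _ i1 i2) j1 j2)).
  by apply: p1; rewrite ?addr_gt0// !mulr_ge0.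
have gyG := bigerm_mulp hy gG.
have gyL := bigerm_mulp_sew12.
have sub : eq4 (sew2 (mulp y E)) (fun s1 s2 t1 t2 =>
    sew2 (mulp y (sew2 G)) s1 s2 t1 t2 - sew2 (mulp y (sew12 G)) s1 s2 t1 t2).
  apply: sew2_sub.
  - by move=> s1 s2 i1 i2; exact: germ_sewable (germ_mulp_sew2 i1 i2).
  - exact: (bigerm_sewable a20 g10 g20 mu2 gyL).
  - by move=> s1 s2 t1 t2 _ _ _ _; rewrite /mulp /E; ring.
move=> s1 s2 t1 t2 i1 i2 j1 j2.
apply: (sew_close a10 g10 mu1 a10 g10 mu1
  (sew2_germ a20 g10 g20 mu2 gyG j1 j2) (sew2_germ a20 g10 g20 mu2 gyL j1 j2)
  mu1 (C := (1 + c2) * (K * (c1 * ((1 + c2) * C))))) => // s t s01 t01.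
rewrite sew2_mulp_sew2// -sub//.
by apply: (le_trans (sE _ _ _ _ s01 t01 j1 j2)); rewrite /e !mulrA.
Qed.

End Associativity.

(** * Taylor estimates *)

Section ChangeOfVariables.
Variable R : realType.
Implicit Types (f : R -> R) (s t : R).

Lemma ratio01 (p q : R) : 0 <= p <= q -> 0 < q -> 0 <= p / q <= 1.
Proof.
move=> /andP[p0 pq] q0; rewrite ler_pdivrMr// mul1r pq andbT.
by rewrite divr_ge0// ltW.
Qed.

(** The intermediate point is written as a convex combination so that no order
    of [a] and [b] has to be assumed. *)
Lemma MVT_conv_in f (df : R -> R) (m M a b : R) :
  (forall u : R, m < u < M -> is_derive u (1 : R) f (df u)) ->
  m < a < M -> m < b < M ->
  exists2 c : R, 0 <= c <= 1 & f b - f a = df (a + c * (b - a)) * (b - a).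
Proof.
move=> fd /andP[ma aM] /andP[mb bM].
have key u v : m < u -> v < M -> u < v ->
    exists2 w, u < w < v & f v - f u = df w * (v - u).
  move=> mu vM uv.
  have fd' z : z \in `]u, v[ -> is_derive z (1 : R) f (df z).
    by rewrite in_itv/= => /andP[uz zv]; apply: fd; lra.
  have cf : {within `[u, v], continuous f}.
    apply: derivable_within_continuous => z.
    rewrite in_itv/= => /andP[uz zv].
    by have zD : is_derive z (1 : R) f (df z) by [apply: fd; lra|exact: ex_derive].
  have [w wuv E] := MVT uv fd' cf.
  by exists w => //; move: wuv; rewrite in_itv.
have [ab|ba|->] := ltgtP a b.
- have [w /andP[aw wb] ->] := key _ _ ma bM ab; exists ((w - a) / (b - a)).
    by apply: ratio01; lra.
  by rewrite divfK ?subr_eq0 ?gt_eqF// [a + _]addrC subrK.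
- have [w /andP[bw wa] E] := key _ _ mb aM ba; exists ((w - a) / (b - a)).
    have -> : (w - a) / (b - a) = (a - w) / (a - b).
      by rewrite -(opprB a w) -(opprB a b) invrN mulrNN.
    by apply: ratio01; lra.
  rewrite divfK ?subr_eq0 ?lt_eqF// [a + _]addrC subrK.
  by rewrite -opprB E -mulrN opprB.
- by exists 0; rewrite ?lexx ?ler01// !subrr mulr0.
Qed.

Lemma MVT_conv f (df : R -> R) (a b : R) :
  (forall u : R, is_derive u (1 : R) f (df u)) ->
  exists2 c : R, 0 <= c <= 1 & f b - f a = df (a + c * (b - a)) * (b - a).
Proof.
move=> fd; pose M := `|a| + `|b| + 1.
apply: (@MVT_conv_in f df (- M) M a b (fun u _ => fd u)).
  by have := normr_ge0 b; have := lexx `|a|; rewrite /M {1}ler_norml; lra.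
by have := normr_ge0 a; have := lexx `|b|; rewrite /M {1}ler_norml; lra.
Qed.

Lemma conv_bound (M u v c : R) : `|u| <= M -> `|v| <= M -> 0 <= c <= 1 ->
  `|u + c * (v - u)| <= M.
Proof. by rewrite !ler_norml => ? ? ?; apply/andP; split; nra. Qed.

Lemma taylor1 f f1 f2 (M B u v : R) :
  (forall u : R, is_derive u (1 : R) f (f1 u)) ->
  (forall u : R, is_derive u (1 : R) f1 (f2 u)) ->
  (forall u, `|u| <= M -> `|f2 u| <= B) -> `|u| <= M -> `|v| <= M ->
  `|f v - f u - f1 u * (v - u)| <= B * `|v - u| ^+ 2.
Proof.
move=> d0 d1 f2B uM vM.
have [c c01 ->] := MVT_conv u v d0.
rewrite -mulrBl; have [d d01 ->] := MVT_conv u (u + c * (v - u)) d1.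
have wM := conv_bound uM vM c01; rewrite -mulrA.
apply: norm_mul_le; first by apply: f2B; exact: conv_bound.
have -> : u + c * (v - u) - u = c * (v - u) by ring.
rewrite -mulrA normrM ger0_norm; last by case/andP: c01.
by rewrite normrM -expr2 ler_piMl ?exprn_ge0//; case/andP: c01.
Qed.

End ChangeOfVariables.

(** * The change of variables formula *)

Section ChangeOfVariables2.
Variable R : realType.
Implicit Types (f x : R -> R -> R) (s t : R).

Lemma is_derive_line (f : R -> R) (df : R -> R) (a b c : R) :
  (forall u : R, is_derive u (1 : R) f (df u)) ->
  is_derive c (1 : R) (fun c => f (a + c * b)) (df (a + c * b) * b).
Proof.
move=> fd.
have l : is_derive c (1 : R) (fun c => a + c * b) b.
  by apply: is_derive_eq; rewrite /GRing.scale/=; ring.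
by have := @is_derive1_comp R f (fun c => a + c * b) c _ _ (fd _) l.
Qed.

(** The remainder f1 v - f1 u - f2 u (v - u) is differentiated along the segment
    from (u, v) to (u', v'). Its derivative pairs the displacement of the base
    point with a remainder of order 2 and the variation of the step with an
    increment of [f2], of order 1. *)
Lemma taylor1_diff (f1 f2 f3 f4 : R -> R) (M B h u v u' v' : R) :
  (forall u : R, is_derive u (1 : R) f1 (f2 u)) ->
  (forall u : R, is_derive u (1 : R) f2 (f3 u)) ->
  (forall u : R, is_derive u (1 : R) f3 (f4 u)) ->
  (forall u, `|u| <= M -> `|f3 u| <= B) ->
  (forall u, `|u| <= M -> `|f4 u| <= B) ->
  `|u| <= M -> `|v| <= M -> `|u'| <= M -> `|v'| <= M ->
  `|v - u| <= h -> `|v' - u'| <= h ->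
  `|(f1 v' - f1 u' - f2 u' * (v' - u')) - (f1 v - f1 u - f2 u * (v - u))|
    <= B * h ^+ 2 * `|u' - u| + B * h * `|(v' - u') - (v - u)|.
Proof.
move=> d1 d2 d3 B3 B4 uM vM uM' vM' vu vu'.
pose U c := u + c * (u' - u); pose V c := v + c * (v' - v).
pose g c := f1 (V c) - f1 (U c) - f2 (U c) * (V c - U c).
pose dg c := (f2 (V c) - f2 (U c) - f3 (U c) * (V c - U c)) * (u' - u)
  + (f2 (V c) - f2 (U c)) * ((v' - u') - (v - u)).
have gd c : is_derive c (1 : R) g (dg c).
  have := is_derive_line v (v' - v) c d1.
  have := is_derive_line u (u' - u) c d1.
  have := is_derive_line u (u' - u) c d2.
  rewrite -/(U c) -/(V c) => H1 H2 H3.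
  rewrite /g /U /V; apply: is_derive_eq.
  rewrite -/(U c) -/(V c) /dg.
  rewrite /GRing.scale/=; ring.
have [c c01] := MVT_conv 0 1 gd.
have U0 : U 0 = u by rewrite /U mul0r addr0.
have V0 : V 0 = v by rewrite /V mul0r addr0.
have U1 : U 1 = u' by rewrite /U mul1r addrC subrK.
have V1 : V 1 = v' by rewrite /V mul1r addrC subrK.
rewrite subr0 !mulr1 add0r {1 2}/g U0 V0 U1 V1 => ->.
have UM := conv_bound uM uM' c01; have VM := conv_bound vM vM' c01.
have VU : `|V c - U c| <= h.
  have -> : V c - U c = (v - u) + c * ((v' - u') - (v - u)).
    by rewrite /V /U; ring.
  exact: conv_bound.
rewrite /dg; apply: (le_trans (ler_normD _ _)); apply: lerD.
  rewrite normrM ler_wpM2r//.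
  have B0 : 0 <= B by apply: le_trans (B4 _ uM).
  apply: (le_trans (taylor1 d2 d3 B4 UM VM)); rewrite ler_wpM2l//.
  by rewrite lerXn2r// nnegrE (le_trans _ vu).
rewrite normrM ler_wpM2r//.
have [e e01 ->] := MVT_conv (U c) (V c) d2.
by apply: norm_mul_le => //; apply: B3; exact: conv_bound.
Qed.

(** Germ of the integral of the product of the two partial differentials. *)
Definition xgerm x : R -> R -> R -> R -> R := fun s1 s2 t1 t2 =>
  (x s2 t1 - x s1 t1) * (x s2 t2 - x s2 t1).

Lemma rect4_biadditive x : biadditive (rect4 x).
Proof. by split=> ? ? ? ? ? ? ? ? ? ?; rewrite /rect4; ring. Qed.

Lemma rect4_bigerm a1 a2 g1 g2 K x : hol2 g1 g2 K x ->
  bigerm a1 a2 g1 g2 K (rect4 x).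
Proof.
move=> hx; apply: biadditive_bigerm; first exact: rect4_biadditive.
exact: (hol2_12 hx).
Qed.

Lemma xgerm_bigerm a1 a2 K x : hol2 a1 a2 K x ->
  bigerm a1 a2 a1 a2 (K * K) (xgerm x).
Proof.
move=> hx; split.
- move=> s1 s2 t1 t2 i1 i2 j1 j2; rewrite mulrACA.
  by apply: norm_mul_le; [exact: (hol2_1 hx)|exact: (hol2_2 hx)].
- move=> s1 s2 s3 t1 t2 i1 i2 i3 j1 j2.
  have -> : diff1 (xgerm x) s1 s2 s3 t1 t2 =
      (x s2 t1 - x s1 t1) * rect4 x s2 s3 t1 t2.
    by rewrite /diff1 /xgerm /rect4; ring.
  rewrite -[_ `^ _ * _ * _]mulrA mulrACA.
  by apply: norm_mul_le; [exact: (hol2_1 hx)|exact: (hol2_12 hx)].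
- move=> s1 s2 t1 t2 t3 i1 i2 j1 j2 j3.
  have -> : diff1 (swap (xgerm x)) t1 t2 t3 s1 s2 =
      - (rect4 x s1 s2 t1 t2 * (x s2 t3 - x s2 t2)).
    by rewrite /diff1 /xgerm /rect4 /swap; ring.
  rewrite normrN [_ `^ a1 * _]mulrA mulrACA.
  by apply: norm_mul_le; [exact: (hol2_12 hx)|exact: (hol2_2 hx)].
- move=> s1 s2 s3 t1 t2 t3 i1 i2 i3 j1 j2 j3.
  have -> : diff1 (xgerm x) s1 s2 s3 t1 t3 - diff1 (xgerm x) s1 s2 s3 t1 t2
      - diff1 (xgerm x) s1 s2 s3 t2 t3
      = - (rect4 x s1 s2 t1 t2 * rect4 x s2 s3 t2 t3).
    by rewrite /diff1 /xgerm /rect4; ring.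
  rewrite normrN [(_ `^ a1 * _) * (_ * _)]mulrACA [leRHS]mulrACA.
  by apply: norm_mul_le; exact: (hol2_12 hx).
Qed.

Section Formula.
Variables (g1 g2 M B K1 K2 : R) (x : R -> R -> R) (f f1 f2 f3 f4 : R -> R).
Hypotheses (g1h : 1 < g1 + g1) (g2h : 1 < g2 + g2).
Hypothesis (hx : hol2 g1 g2 M x).
Hypothesis (d0 : forall u : R, is_derive u (1 : R) f (f1 u)).
Hypothesis (d1 : forall u : R, is_derive u (1 : R) f1 (f2 u)).
Hypothesis (d2 : forall u : R, is_derive u (1 : R) f2 (f3 u)).
Hypothesis (d3 : forall u : R, is_derive u (1 : R) f3 (f4 u)).
Hypothesis (B2 : forall u, `|u| <= M -> `|f2 u| <= B).
Hypothesis (B3 : forall u, `|u| <= M -> `|f3 u| <= B).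
Hypothesis (B4 : forall u, `|u| <= M -> `|f4 u| <= B).

Let y1 s t := f1 (x s t).
Let y2 s t := f2 (x s t).
Hypotheses (h1 : hol2 g1 g2 K1 y1) (h2 : hol2 g1 g2 K2 y2).

Let g10 : 0 < g1. Proof. move: g1h; lra. Qed.
Let g20 : 0 < g2. Proof. move: g2h; lra. Qed.
Let M0 : 0 <= M := hol2_ge0 hx.
Let B0 : 0 <= B. Proof. by apply: le_trans (B2 (_ : `|0| <= M)) => //; rewrite normr0. Qed.
Let xM s t : in01 s -> in01 t -> `|x s t| <= M := @hol2_sup _ _ _ _ _ hx s t.

(** On the segment of abscissa [s], the germ of the integral of f1(x) dx in the
    second direction. *)
Let vertical s t1 t2 := y1 s t1 * (x s t2 - x s t1).

Let germ_vertical s : in01 s -> germ g2 g2 (K1 * M) (vertical s).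
Proof.
move=> i; apply: germ_mul.
- by move=> ? ? ? _ _ _; ring.
- by move=> t1 t2 j1 j2; exact: (hol2_2 hx).
- by move=> t1 t2 j1 j2; exact: (hol2_2 h1).
Qed.

Let sqr_powR (a : R) s t : 0 < a -> (`|t - s| `^ a) ^+ 2 = `|t - s| `^ (a + a).
Proof. by move=> a0; rewrite powR_exprD. Qed.

(** The one-dimensional change of variables: by Taylor's formula the increment of
    f(x) is the germ up to an error of order g2 + g2 > 1, and it is additive. *)
Let sew_vertical s : in01 s ->
  eq01 (sew (vertical s)) (fun t1 t2 => f (x s t2) - f (x s t1)).
Proof.
move=> i; apply: (sew_eq g20 g20 g2h (germ_vertical i) _ g2h (C := B * M ^+ 2)).
  by move=> ? ? ? _ _ _; ring.
move=> t1 t2 j1 j2; rewrite distrC.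
apply: (le_trans (taylor1 d0 d1 B2 (xM i j1) (xM i j2))).
rewrite -mulrA ler_wpM2l// -sqr_powR// -exprMn lerXn2r// ?nnegrE//.
  by rewrite mulr_ge0// powR_ge0.
exact: (hol2_2 hx).
Qed.

Let gX : bigerm g1 g2 g1 g2 (4 * (K1 * M)) (mulp y1 (rect4 x)) :=
  bigerm_mulp h1 (rect4_bigerm g1 g2 hx).
Let gG : bigerm g1 g2 g1 g2 (4 * (K2 * (M * M))) (mulp y2 (xgerm x)) :=
  bigerm_mulp h2 (xgerm_bigerm hx).

(** The increment in the first direction of the germ [vertical] is
    [mulp y1 (rect4 x)] plus this germ. *)
Let H s1 s2 t1 t2 := (y1 s2 t1 - y1 s1 t1) * (x s2 t2 - x s2 t1).

Let H_sewable : sewable2 H /\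
  eq4 (sew2 H) (fun s1 s2 t1 t2 =>
    rect4 (fun s t => f (x s t)) s1 s2 t1 t2
    - sew2 (mulp y1 (rect4 x)) s1 s2 t1 t2).
Proof.
have sv s : in01 s -> sewable (vertical s).
  by move=> i; exact: germ_sewable (germ_vertical i).
have sX := bigerm_sewable g20 g10 g20 g2h gX.
suff E s1 s2 : in01 s1 -> in01 s2 -> sewable (H s1 s2) /\
    eq01 (sew (H s1 s2)) (fun t1 t2 => rect4 (fun s t => f (x s t)) s1 s2 t1 t2
      - sew2 (mulp y1 (rect4 x)) s1 s2 t1 t2).
  by split=> [s1 s2 i1 i2|s1 s2 t1 t2 i1 i2]; [exact: (E _ _ i1 i2).1|exact: (E _ _ i1 i2).2].
move=> i1 i2.
have [sD ED] := sew_sub (sv _ i2) (sv _ i1) (fun _ _ _ _ => erefl).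
have [|sH EH] := sew_sub (F := H s1 s2) sD (sX _ _ i1 i2).
  by move=> t1 t2 _ _; rewrite /H /vertical /mulp /rect4; ring.
split=> // t1 t2 j1 j2; rewrite EH// ED// !sew_vertical// /rect4 /sew2; ring.
Qed.

Let H_cst := B * M ^+ 3 + sew_cst (g2 + g2) * ((B * M ^+ 3 + B * M ^+ 2) * M).

(** Replacing the increment of [f1 x] by its first-order expansion costs an
    error of order 2 in the first direction. For its sewing in the second
    direction to be of the same order, the variation of this error in [t] is
    needed as well, hence the fourth derivative of [f]. *)
Let H_dist s1 s2 t1 t2 : in01 s1 -> in01 s2 -> in01 t1 -> in01 t2 ->
  `|sew2 (mulp y2 (xgerm x)) s1 s2 t1 t2 - sew2 H s1 s2 t1 t2| <=
    H_cst * `|s2 - s1| `^ (g1 + g1).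
Proof.
move=> i1 i2 j1 j2.
set E := `|s2 - s1| `^ (g1 + g1).
have E0 : 0 <= E by exact: powR_ge0.
have Esq : E = (`|s2 - s1| `^ g1) ^+ 2 by rewrite sqr_powR.
pose r t := y2 s1 t * (x s2 t - x s1 t) - (y1 s2 t - y1 s1 t).
have rE t : r t = - (y1 s2 t - y1 s1 t - y2 s1 t * (x s2 t - x s1 t)).
  by rewrite /r; ring.
have h0 : 0 <= M * `|s2 - s1| `^ g1 by rewrite mulr_ge0 ?powR_ge0.
have r_sup t : in01 t -> `|r t| <= B * M ^+ 2 * E.
  move=> j; rewrite rE normrN.
  apply: (le_trans (taylor1 d1 d2 B3 (xM i1 j) (xM i2 j))).
  rewrite -mulrA ler_wpM2l// Esq -exprMn lerXn2r// ?nnegrE//.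
  exact: (hol2_1 hx).
have r_var t t' : in01 t -> in01 t' ->
    `|r t' - r t| <= (B * M ^+ 3 + B * M ^+ 2) * E * `|t' - t| `^ g2.
  move=> j j'; rewrite !rE -opprD normrN.
  apply: (le_trans (taylor1_diff d1 d2 d3 B3 B4 (xM i1 j) (xM i2 j)
    (xM i1 j') (xM i2 j') (hol2_1 hx i1 i2 j) (hol2_1 hx i1 i2 j'))).
  have v1 := hol2_2 hx i1 j j'.
  have v2 : `|x s2 t' - x s1 t' - (x s2 t - x s1 t)| <=
      M * (`|s2 - s1| `^ g1 * `|t' - t| `^ g2).
    have -> : x s2 t' - x s1 t' - (x s2 t - x s1 t) = rect4 x s1 s2 t t'.
      by rewrite /rect4; ring.
    exact: (hol2_12 hx).
  have := lerD
    (ler_wpM2l (mulr_ge0 B0 (exprn_ge0 2 h0)) v1) (ler_wpM2l (mulr_ge0 B0 h0) v2).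
  by move=> /le_trans; apply; apply: eq_imp_le; rewrite Esq; ring.
pose D t t' := r t * (x s2 t' - x s2 t).
have gD : germ g2 g2 ((B * M ^+ 3 + B * M ^+ 2) * E * M) D.
  apply: germ_mul => //.
  - by move=> ? ? ? _ _ _; ring.
  - by move=> t t' j j'; exact: (hol2_2 hx).
have DE : eq01 D (fun t t' => mulp y2 (xgerm x) s1 s2 t t' - H s1 s2 t t').
  by move=> t t' _ _; rewrite /D /r /mulp /xgerm /H; ring.
have sG := bigerm_sewable g20 g10 g20 g2h gG.
have [_ <-] := sew_sub (sG _ _ i1 i2) (H_sewable.1 _ _ i1 i2) DE; rewrite ?j1//.
have p1 a : 0 < a -> `|t2 - t1| `^ a <= 1.
  move=> a0; apply: powR_le1; first exact: ltW.
  by rewrite normr_ge0 in01_dist.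
have DM : `|D t1 t2| <= B * M ^+ 3 * E.
  have := norm_mul_le (r_sup _ j1) (hol2_2 hx i2 j1 j2).
  move=> /le_trans; apply; rewrite mulrA.
  have -> : B * M ^+ 3 * E = B * M ^+ 2 * E * M by ring.
  by rewrite ler_piMr ?p1// !mulr_ge0 ?exprn_ge0.
have := sew_bound g20 g20 g2h gD j1 j2.
have c0 : 0 <= sew_cst (g2 + g2) by exact: sew_cst_ge0.
have k0 : 0 <= sew_cst (g2 + g2) * ((B * M ^+ 3 + B * M ^+ 2) * E * M).
  by rewrite !mulr_ge0// addr_ge0// mulr_ge0// exprn_ge0.
have /(ler_wpM2l k0) : `|t2 - t1| `^ (g2 + g2) <= 1 by rewrite p1 ?addr_gt0.
rewrite mulr1 => le1 /le_trans /(_ le1) sb.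
rewrite -[sew D t1 t2](subKr (D t1 t2)).
apply: (le_trans (ler_normB _ _)); apply: (le_trans (lerD DM sb)).
by apply: eq_imp_le; rewrite /H_cst; ring.
Qed.

(** The sewings of [H] and of [mulp y2 (xgerm x)] in the second direction are
    close by [H_dist], and the sewing of [H] is an additive increment in the
    first direction up to a sewing error. Uniqueness of the sewing in the first
    direction concludes. *)
Lemma change_of_variables : eq4 (rect4 (fun s t => f (x s t)))
  (fun s1 s2 t1 t2 => sew12 (mulp y1 (rect4 x)) s1 s2 t1 t2
     + sew12 (mulp y2 (xgerm x)) s1 s2 t1 t2).
Proof.
move=> s1 s2 t1 t2 i1 i2 j1 j2; apply/eqP; rewrite addrC -subr_eq; apply/eqP.
pose Bd s s' := rect4 (fun s t => f (x s t)) s s' t1 t2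
  - sew12 (mulp y1 (rect4 x)) s s' t1 t2.
pose C := H_cst + sew_cst (g1 + g1) * ((1 + sew_cst (g2 + g2)) * (4 * (K1 * M))).
have gA := sew2_germ_unif g20 g10 g20 g2h gG j1 j2.
apply/esym/(sew_eq (B := Bd) g10 g10 g1h gA _ g1h (C := C)) => //.
  apply: additiveB; first by move=> ? ? ? _ _ _; rewrite /rect4; ring.
  exact: (sew12_biadditive g10 g20 g10 g20 g1h g2h gX).1.
move=> s s' i i'; rewrite -(subrKA (sew2 H s s' t1 t2)) mulrDl.
apply: (le_trans (ler_normD _ _)); apply: lerD; first exact: H_dist.
rewrite H_sewable.2//.
have -> : rect4 (fun s t => f (x s t)) s s' t1 t2
    - sew2 (mulp y1 (rect4 x)) s s' t1 t2 - Bd s s'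
    = - (sew2 (mulp y1 (rect4 x)) s s' t1 t2
         - sew12 (mulp y1 (rect4 x)) s s' t1 t2) by rewrite /Bd; ring.
rewrite normrN.
apply: (le_trans (sew12_dist g10 g20 g10 g20 g1h g2h gX i i' j1 j2)).
rewrite ler_wpM2l//.
  have c0 := sew_cst_ge0 g1h; have c0' := sew_cst_ge0 g2h.
  have K0 := hol2_ge0 h1.
  by apply: mulr_ge0 => //; apply: mulr_ge0; [exact: addr_ge0|rewrite !mulr_ge0].
rewrite ler_piMr ?powR_ge0//; apply: powR_le1; first exact: ltW.
by rewrite normr_ge0 in01_dist.
Qed.

End Formula.
End ChangeOfVariables2.

(** * Uniform continuity on compact sets *)

Section Compactness.
Variable R : realType.
Implicit Types (s t N e : R) (F : R * R -> R).

Lemma square_compact N : compact (`[- N, N] `*` `[- N, N] : set (R * R)).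
Proof. by apply: compact_setX; exact: segment_compact. Qed.

(** Heine's theorem. *)
Lemma square_unif_continuous F N : continuous F ->
  forall e, 0 < e -> exists2 d, 0 < d & forall s t s' t', `|s| <= N ->
    `|t| <= N -> `|s' - s| < d -> `|t' - t| < d ->
    `|F (s', t') - F (s, t)| < e.
Proof.
move=> cF e e0.
have /compact_near_coveringP cov := @square_compact N.
pose P d (p : R * R) := forall q, ball p d q -> `|F q - F p| < e.
have H : forall p, (`[- N, N] `*` `[- N, N])%classic p -> \forall p' \near p & d \near 0^'+, P d p'.
  move=> p _; have e20 : 0 < e / 2 by rewrite divr_gt0.
  have /cvgrPdist_lt /(_ _ e20) /nbhs_ballP [r r0 Hr] := cF p.
  have r20 : 0 < r / 2 by rewrite divr_gt0.
  exists (ball p (r / 2), [set d | d < r / 2]).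
    by split => /=; [exact: nbhsx_ballx|exact: nbhs_right_lt].
  move=> [p' d] /= [pp' dr] q p'q.
  have q1 := Hr q; have p1 := Hr p'.
  have {}p1 : `|F p - F p'| < e / 2.
    by apply: p1; apply: le_ball pp'; rewrite ler_pdivrMr// ler_pMr// ler1n.
  have {}q1 : `|F p - F q| < e / 2.
    apply: q1; have -> : r = r / 2 + r / 2 by rewrite -splitr.
    apply: ball_triangle pp' _; exact: le_ball (ltW dr) _ p'q.
  by move: p1 q1; rewrite !ltr_norml; lra.
have nK := cov R (0^'+) P _ H.
have [d [/= d0 Hd]] := filter_ex (filterI (nbhs_right_gt 0) (nK _)).
exists d => // s t s' t' sN tN ss tt.
apply: (Hd (s, t)); last by split; rewrite /= /ball/= distrC.
by split; rewrite /= in_itv/= -ler_norml.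
Qed.

Lemma square_bounded F N : continuous F ->
  exists B, forall s t, `|s| <= N -> `|t| <= N -> `|F (s, t)| <= B.
Proof.
move=> cF.
have cFN := @continuous_compact _ _ F _ (continuous_subspaceT cF) (@square_compact N).
have [B [_ HB]] := compact_bounded cFN; exists (B + 1) => s t sN tN.
apply: HB; first by rewrite ltrDl.
by exists (s, t) => //; split; rewrite /= in_itv/= -ler_norml.
Qed.

Lemma segment_unif_continuous (f : R -> R) N : continuous f ->
  forall e, 0 < e -> exists2 d, 0 < d & forall u v, `|u| <= N ->
    `|v - u| < d -> `|f v - f u| < e.
Proof.
move=> cf e e0.
have cF : continuous (fun p : R * R => f p.1).
  by move=> p; apply: (continuous_comp (@fst_cont _ _ p)); exact: cf.
have [d d0 H] := square_unif_continuous N cF e0.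
exists d => // u v uN uv; apply: (H u u v u) => //.
by rewrite subrr normr0.
Qed.

Lemma segment_bounded (f : R -> R) N : continuous f ->
  exists B, forall u, `|u| <= N -> `|f u| <= B.
Proof.
move=> cf; have cF : continuous (fun p : R * R => f p.1).
  by move=> p; apply: (continuous_comp (@fst_cont _ _ p)); exact: cf.
have [B H] := square_bounded N cF.
by exists B => u uN; exact: (H u u).
Qed.

End Compactness.

(** * Increments of a composition *)

Section Composition.
Variable R : realType.
Implicit Types (M B K N r w : R) (x : R -> R -> R).

(** Mean value theorem for the difference of the two increments, with the two
    segments [a, b] and [a', b'] run through simultaneously. *)
Lemma increment_dist (f f1 : R -> R) N B r w (a b a' b' : R) :
  (forall u : R, is_derive u (1 : R) f (f1 u)) ->
  (forall u, `|u| <= N -> `|f1 u| <= B) ->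
  (forall u v, `|u| <= N -> `|v| <= N -> `|v - u| <= r -> `|f1 v - f1 u| <= w) ->
  `|a| <= N -> `|b| <= N -> `|a'| <= N -> `|b'| <= N ->
  `|a' - a| <= r -> `|b' - b| <= r ->
  `|(f b' - f a') - (f b - f a)|
    <= w * `|b' - a'| + B * `|(b' - a') - (b - a)|.
Proof.
move=> fd fB fw aN bN aN' bN' aa bb.
pose g c := f (a' + c * (b' - a')) - f (a + c * (b - a)).
pose dg c := f1 (a' + c * (b' - a')) * (b' - a') - f1 (a + c * (b - a)) * (b - a).
have gd c : is_derive c (1 : R) g (dg c).
  have := is_derive_line a (b - a) c fd.
  by have := is_derive_line a' (b' - a') c fd => H1 H2; exact: is_deriveB.
have [c c01] := MVT_conv 0 1 gd.
have g1 : g 1 = f b' - f b by rewrite /g !mul1r ![_ + (_ - _)]addrC !subrK.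
have g0 : g 0 = f a' - f a by rewrite /g !mul0r !addr0.
rewrite g1 g0 subr0 !mulr1 add0r => E.
have -> : f b' - f a' - (f b - f a) = dg c by rewrite -E; ring.
rewrite /dg; set u := a + c * (b - a); set u' := a' + c * (b' - a').
have uN : `|u| <= N by exact: conv_bound.
have uN' : `|u'| <= N by exact: conv_bound.
have uu : `|u' - u| <= r.
  have -> : u' - u = (a' - a) + c * ((b' - b) - (a' - a)).
    by rewrite /u /u'; ring.
  exact: conv_bound.
have -> : f1 u' * (b' - a') - f1 u * (b - a) =
  (f1 u' - f1 u) * (b' - a') + f1 u * ((b' - a') - (b - a)) by ring.
apply: (le_trans (ler_normD _ _)); apply: lerD; apply: norm_mul_le => //.
  exact: fw.
exact: fB.
Qed.

(** The same argument in one of the two increments reduces the second difference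
    of [f] to a first difference of [f1]. *)
Lemma second_increment_dist (f f1 f2 : R -> R) N B r w (u a b u' a' b' : R) :
  (forall u : R, is_derive u (1 : R) f (f1 u)) ->
  (forall u : R, is_derive u (1 : R) f1 (f2 u)) ->
  (forall u, `|u| <= N -> `|f2 u| <= B) ->
  (forall u v, `|u| <= N -> `|v| <= N -> `|v - u| <= r -> `|f2 v - f2 u| <= w) ->
  `|u| <= N -> `|u + a| <= N -> `|u + b| <= N -> `|u + a + b| <= N ->
  `|u'| <= N -> `|u' + a'| <= N -> `|u' + b'| <= N -> `|u' + a' + b'| <= N ->
  `|u' - u| <= r -> `|u' + a' - (u + a)| <= r ->
  `|u' + b' - (u + b)| <= r -> `|u' + a' + b' - (u + a + b)| <= r ->
  `|(f (u' + a' + b') - f (u' + a') - f (u' + b') + f u')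
    - (f (u + a + b) - f (u + a) - f (u + b) + f u)|
  <= (w * `|b'| + B * `|b' - b|) * `|a'| + B * `|b| * `|a' - a|.
Proof.
move=> d1 d2 fB fw n1 n2 n3 n4 m1 m2 m3 m4 r1 r2 r3 r4.
pose g c := (f ((u' + b') + c * a') - f (u' + c * a'))
  - (f ((u + b) + c * a) - f (u + c * a)).
pose dg c := (f1 ((u' + b') + c * a') - f1 (u' + c * a')) * a'
  - (f1 ((u + b) + c * a) - f1 (u + c * a)) * a.
have gd c : is_derive c (1 : R) g (dg c).
  have h1 := is_derive_line (u' + b') a' c d1.
  have h2 := is_derive_line u' a' c d1.
  have h3 := is_derive_line (u + b) a c d1.
  have h4 := is_derive_line u a c d1.
  rewrite /g /dg !mulrBl; apply: is_deriveB.
have [c c01] := MVT_conv 0 1 gd.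
have g1 : g 1 = (f (u' + a' + b') - f (u' + a')) - (f (u + a + b) - f (u + a)).
  by rewrite /g !mul1r ![_ + _ + b]addrAC ![_ + _ + b']addrAC.
have g0 : g 0 = (f (u' + b') - f u') - (f (u + b) - f u).
  by rewrite /g !mul0r !addr0.
rewrite g1 g0 subr0 !mulr1 add0r => E.
set lhs := (X in `|X| <= _); have -> : lhs = dg c by rewrite -E /lhs; ring.
have lineE (p q : R) : p + c * q = p + c * ((p + q) - p) by ring.
have p1 : `|u + c * a| <= N by rewrite lineE; exact: conv_bound.
have p2 : `|u' + c * a'| <= N by rewrite lineE; exact: conv_bound.
have p3 : `|u + b + c * a| <= N.
  by rewrite lineE; apply: conv_bound => //; rewrite addrAC.
have p4 : `|u' + b' + c * a'| <= N.
  by rewrite lineE; apply: conv_bound => //; rewrite addrAC.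
have q1 : `|u' + c * a' - (u + c * a)| <= r.
  have -> : u' + c * a' - (u + c * a)
      = (u' - u) + c * ((u' + a' - (u + a)) - (u' - u)) by ring.
  exact: conv_bound.
have q2 : `|u' + b' + c * a' - (u + b + c * a)| <= r.
  have -> : u' + b' + c * a' - (u + b + c * a)
      = (u' + b' - (u + b))
        + c * ((u' + a' + b' - (u + a + b)) - (u' + b' - (u + b))) by ring.
  exact: conv_bound.
rewrite /dg; set D' := f1 _ - f1 (u' + c * a'); set D := f1 _ - f1 (u + c * a).
have -> : D' * a' - D * a = (D' - D) * a' + D * (a' - a) by ring.
apply: (le_trans (ler_normD _ _)); apply: lerD; apply: norm_mul_le => //.
  have := increment_dist d2 fB fw p1 p3 p2 p4 q1 q2; rewrite -/D -/D'.
  have -> : u' + b' + c * a' - (u' + c * a') = b' by ring.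
  by have -> : u + b + c * a - (u + c * a) = b by ring.
have [e e01 DE] := MVT_conv (u + c * a) (u + b + c * a) d2.
rewrite /D DE; apply: norm_mul_le; first by apply: fB; exact: conv_bound.
have -> : u + b + c * a - (u + c * a) = b by ring.
exact: lexx.
Qed.

(** The rectangular increment of f(x) is the second difference of [f] along the
    two increments of [x], up to the rectangular increment of [x] itself. Only
    moduli of continuity [w] of [f1] and [f2] enter, so that class C2 is
    enough. *)
Lemma hol2_comp_sub a1 a2 M h B w x x' (f f1 f2 : R -> R) :
  (forall u : R, is_derive u (1 : R) f (f1 u)) ->
  (forall u : R, is_derive u (1 : R) f1 (f2 u)) ->
  (forall u, `|u| <= 3 * M -> `|f1 u| <= B) ->
  (forall u, `|u| <= 3 * M -> `|f2 u| <= B) ->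
  (forall u v, `|u| <= 3 * M -> `|v| <= 3 * M -> `|v - u| <= 3 * h ->
     `|f1 v - f1 u| <= w) ->
  (forall u v, `|u| <= 3 * M -> `|v| <= 3 * M -> `|v - u| <= 3 * h ->
     `|f2 v - f2 u| <= w) ->
  hol2 a1 a2 M x -> hol2 a1 a2 M x' -> hol2 a1 a2 h (fun s t => x' s t - x s t) ->
  hol2 a1 a2 (w * (M + M ^+ 2) + B * h * (1 + 2 * M))
    (fun s t => f (x' s t) - f (x s t)).
Proof.
move=> d1 d2 B1 B2 w1 w2 hx hx' hd.
have M0 := hol2_ge0 hx; have h0 := hol2_ge0 hd.
have n0 : `|0 : R| <= 3 * M by rewrite normr0; lra.
have B0 : 0 <= B by apply: le_trans (B1 0 n0).
have w0 : 0 <= w.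
  by apply: le_trans (w1 0 0 n0 n0 _); rewrite ?subrr ?normr0//; lra.
have xM s t : in01 s -> in01 t -> `|x s t| <= M := @hol2_sup _ _ _ _ _ hx s t.
have xM' s t : in01 s -> in01 t -> `|x' s t| <= M := @hol2_sup _ _ _ _ _ hx' s t.
have dM s t : in01 s -> in01 t -> `|x' s t - x s t| <= h := @hol2_sup _ _ _ _ _ hd s t.
have le3 (u : R) : `|u| <= M -> `|u| <= 3 * M by move=> ?; lra.
have le3h (u : R) : `|u| <= h -> `|u| <= 3 * h by move=> ?; lra.
have w20 : 0 <= w * M ^+ 2 by rewrite mulr_ge0 ?exprn_ge0.
have wM0 : 0 <= w * M by rewrite mulr_ge0.
have Bh0 : 0 <= B * h by rewrite mulr_ge0.
have BhM0 : 0 <= B * h * M by rewrite mulr_ge0.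
split.
- move=> s t i j; have [c c01 ->] := MVT_conv (x s t) (x' s t) d1.
  have := norm_mul_le (B1 _ (conv_bound (le3 _ (xM _ _ i j)) (le3 _ (xM' _ _ i j)) c01)) (dM _ _ i j).
  by move=> /le_trans; apply; lra.
- move=> s1 s2 t i1 i2 j.
  have := increment_dist d1 B1 w1 (le3 _ (xM _ _ i1 j)) (le3 _ (xM _ _ i2 j))
    (le3 _ (xM' _ _ i1 j)) (le3 _ (xM' _ _ i2 j)) (le3h _ (dM _ _ i1 j)) (le3h _ (dM _ _ i2 j)).
  have -> : f (x' s2 t) - f (x' s1 t) - (f (x s2 t) - f (x s1 t)) =
    f (x' s2 t) - f (x s2 t) - (f (x' s1 t) - f (x s1 t)) by ring.
  have -> : x' s2 t - x' s1 t - (x s2 t - x s1 t) =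
    x' s2 t - x s2 t - (x' s1 t - x s1 t) by ring.
  move=> /le_trans; apply.
  have := ler_wpM2l w0 (hol2_1 hx' i1 i2 j).
  have := ler_wpM2l B0 (hol2_1 hd i1 i2 j).
  have := powR_ge0 `|s2 - s1| a1; set p := _ `^ a1 => p0.
  have := mulr_ge0 w20 p0; have := mulr_ge0 BhM0 p0; lra.
- move=> s t1 t2 i j1 j2.
  have := increment_dist d1 B1 w1 (le3 _ (xM _ _ i j1)) (le3 _ (xM _ _ i j2))
    (le3 _ (xM' _ _ i j1)) (le3 _ (xM' _ _ i j2)) (le3h _ (dM _ _ i j1)) (le3h _ (dM _ _ i j2)).
  have -> : f (x' s t2) - f (x' s t1) - (f (x s t2) - f (x s t1)) =
    f (x' s t2) - f (x s t2) - (f (x' s t1) - f (x s t1)) by ring.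
  have -> : x' s t2 - x' s t1 - (x s t2 - x s t1) =
    x' s t2 - x s t2 - (x' s t1 - x s t1) by ring.
  move=> /le_trans; apply.
  have := ler_wpM2l w0 (hol2_2 hx' i j1 j2).
  have := ler_wpM2l B0 (hol2_2 hd i j1 j2).
  have := powR_ge0 `|t2 - t1| a2; set p := _ `^ a2 => p0.
  have := mulr_ge0 w20 p0; have := mulr_ge0 BhM0 p0; lra.
- move=> s1 s2 t1 t2 i1 i2 j1 j2.
  pose u := x s1 t1; pose a := x s2 t1 - u; pose b := x s1 t2 - u.
  pose u' := x' s1 t1; pose a' := x' s2 t1 - u'; pose b' := x' s1 t2 - u'.
  have ua : u + a = x s2 t1 by rewrite /a addrC subrK.
  have ub : u + b = x s1 t2 by rewrite /b addrC subrK.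
  have ua' : u' + a' = x' s2 t1 by rewrite /a' addrC subrK.
  have ub' : u' + b' = x' s1 t2 by rewrite /b' addrC subrK.
  have := (xM _ _ i1 j1, xM _ _ i2 j1, xM _ _ i1 j2, xM _ _ i2 j2) => -[[[m1 m2] m3] m4].
  have := (xM' _ _ i1 j1, xM' _ _ i2 j1, xM' _ _ i1 j2, xM' _ _ i2 j2) => -[[[m1' m2'] m3'] m4'].
  have := (dM _ _ i1 j1, dM _ _ i2 j1, dM _ _ i1 j2, dM _ _ i2 j2) => -[[[e1 e2] e3] e4].
  have m5 : `|u + a + b| <= 3 * M.
    by move: m1 m2 m3; rewrite /a /b /u !ler_norml; lra.
  have m5' : `|u' + a' + b'| <= 3 * M.
    by move: m1' m2' m3'; rewrite /a' /b' /u' !ler_norml; lra.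
  have e5 : `|u' + a' + b' - (u + a + b)| <= 3 * h.
    by move: e1 e2 e3; rewrite /a /b /u /a' /b' /u' !ler_norml; lra.
  have Q : `|(f (u' + a' + b') - f (u' + a') - f (u' + b') + f u')
    - (f (u + a + b) - f (u + a) - f (u + b) + f u)|
    <= (w * `|b'| + B * `|b' - b|) * `|a'| + B * `|b| * `|a' - a|.
    by apply: (second_increment_dist d1 d2 B2 w2);
      first [exact: m5 | exact: m5' | exact: e5 | rewrite ?ua ?ub ?ua' ?ub';
        first [exact: le3 | exact: le3h]].
  have P := increment_dist d1 B1 w1 m5 (le3 _ m4) m5' (le3 _ m4') e5 (le3h _ e4).
  have -> : rect4 (fun s t => f (x' s t) - f (x s t)) s1 s2 t1 t2 =
    (f (x' s2 t2) - f (u' + a' + b') - (f (x s2 t2) - f (u + a + b)))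
    + ((f (u' + a' + b') - f (u' + a') - f (u' + b') + f u')
       - (f (u + a + b) - f (u + a) - f (u + b) + f u)).
    by rewrite ua ub ua' ub' /rect4 -/u -/u'; ring.
  apply: (le_trans (ler_normD _ _)); apply: (le_trans (lerD P Q)).
  set p := `|s2 - s1| `^ a1; set q := `|t2 - t1| `^ a2.
  have p0 : 0 <= p by exact: powR_ge0.
  have q0 : 0 <= q by exact: powR_ge0.
  have c1 : `|x' s2 t2 - (u' + a' + b')| <= M * (p * q).
    have -> : x' s2 t2 - (u' + a' + b') = rect4 x' s1 s2 t1 t2.
      by rewrite /rect4 /a' /b' /u'; ring.
    exact: (hol2_12 hx').
  have c2 : `|x' s2 t2 - (u' + a' + b') - (x s2 t2 - (u + a + b))| <= h * (p * q).
    have -> : x' s2 t2 - (u' + a' + b') - (x s2 t2 - (u + a + b))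
      = rect4 (fun s t => x' s t - x s t) s1 s2 t1 t2.
      by rewrite /rect4 /a' /b' /u' /a /b /u; ring.
    exact: (hol2_12 hd).
  have ca' : `|a'| <= M * p by exact: (hol2_1 hx').
  have cb' : `|b'| <= M * q by exact: (hol2_2 hx').
  have cb : `|b| <= M * q by exact: (hol2_2 hx).
  have cda : `|a' - a| <= h * p.
    have -> : a' - a = x' s2 t1 - x s2 t1 - (x' s1 t1 - x s1 t1).
      by rewrite /a' /a /u' /u; ring.
    exact: (hol2_1 hd).
  have cdb : `|b' - b| <= h * q.
    have -> : b' - b = x' s1 t2 - x s1 t2 - (x' s1 t1 - x s1 t1).
      by rewrite /b' /b /u' /u; ring.
    exact: (hol2_2 hd).
  have f1l := lerD (ler_wpM2l w0 c1) (ler_wpM2l B0 c2).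
  have f2l : (w * `|b'| + B * `|b' - b|) * `|a'| <=
      (w * (M * q) + B * (h * q)) * (M * p).
    apply: ler_pM => //; first by rewrite addr_ge0// mulr_ge0.
    by rewrite lerD// ler_wpM2l.
  have f3l : B * `|b| * `|a' - a| <= B * (M * q) * (h * p).
    by apply: ler_pM => //; [rewrite mulr_ge0|rewrite ler_wpM2l].
  apply: (le_trans (lerD f1l (lerD f2l f3l))).
  by apply: eq_imp_le; ring.
Qed.

End Composition.

(** * Composition with a function of class C2, and continuity of germs *)

Section Composition2.
Variable R : realType.
Implicit Types (M B K N r w : R) (x y : R -> R -> R).

Lemma hol2_cst0 a1 a2 M : 0 <= M -> hol2 a1 a2 M (fun _ _ => 0 : R).
Proof.
move=> M0; split; rewrite /rect4 => *; rewrite ?subrr ?addr0 normr0//.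
- by rewrite mulr_ge0 ?powR_ge0.
- by rewrite mulr_ge0 ?powR_ge0.
- by rewrite !mulr_ge0 ?powR_ge0.
Qed.

Lemma hol2_eq a1 a2 K x y : (forall s t, in01 s -> in01 t -> x s t = y s t) ->
  hol2 a1 a2 K x -> hol2 a1 a2 K y.
Proof.
move=> xy hx; split.
- by move=> s t i j; rewrite -xy//; exact: (hol2_sup hx).
- by move=> s1 s2 t i1 i2 j; rewrite -!xy//; exact: (hol2_1 hx).
- by move=> s t1 t2 i j1 j2; rewrite -!xy//; exact: (hol2_2 hx).
- move=> s1 s2 t1 t2 i1 i2 j1 j2; rewrite /rect4 -!xy//.
  exact: (hol2_12 hx).
Qed.

Lemma hol2_add_cst a1 a2 K (c : R) x : hol2 a1 a2 K x ->
  hol2 a1 a2 (K + `|c|) (fun s t => x s t + c).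
Proof.
move=> hx; have hx' : hol2 a1 a2 (K + `|c|) x by apply: hol2_le hx; rewrite lerDl.
split.
- move=> s t i j; apply: (le_trans (ler_normD _ _)); apply: lerD => //.
  exact: (hol2_sup hx).
- move=> s1 s2 t i1 i2 j.
  have -> : x s2 t + c - (x s1 t + c) = x s2 t - x s1 t by ring.
  exact: (hol2_1 hx').
- move=> s t1 t2 i j1 j2.
  have -> : x s t2 + c - (x s t1 + c) = x s t2 - x s t1 by ring.
  exact: (hol2_2 hx').
- move=> s1 s2 t1 t2 i1 i2 j1 j2.
  have -> : rect4 (fun s t => x s t + c) s1 s2 t1 t2 = rect4 x s1 s2 t1 t2.
    by rewrite /rect4; ring.
  exact: (hol2_12 hx').
Qed.

Section C2.
Variables (f f1 f2 : R -> R).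
Hypothesis (d1 : forall u : R, is_derive u (1 : R) f (f1 u)).
Hypothesis (d2 : forall u : R, is_derive u (1 : R) f1 (f2 u)).
Hypotheses (c1 : continuous f1) (c2 : continuous f2).

Lemma C2_bound N : exists B, (forall u, `|u| <= N -> `|f1 u| <= B) /\
  (forall u, `|u| <= N -> `|f2 u| <= B).
Proof.
have [B HB] := segment_bounded N c1; have [B' HB'] := segment_bounded N c2.
exists (Num.max B B'); split=> u uN; rewrite le_max.
  by rewrite HB.
by rewrite HB' ?orbT.
Qed.

(** Comparison of [x] with the constant path 0. *)
Lemma hol2_comp a1 a2 M x : hol2 a1 a2 M x ->
  exists K, hol2 a1 a2 K (fun s t => f (x s t)).
Proof.
move=> hx; have M0 := hol2_ge0 hx; have [B [B1 B2]] := C2_bound (3 * M).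
have w1 (g : R -> R) : (forall u, `|u| <= 3 * M -> `|g u| <= B) ->
    forall u v, `|u| <= 3 * M -> `|v| <= 3 * M -> `|v - u| <= 3 * M ->
    `|g v - g u| <= B + B.
  move=> gB u v uM vM _; apply: (le_trans (ler_normB _ _)).
  by apply: lerD; exact: gB.
have hx0 : hol2 a1 a2 M (fun s t => x s t - 0).
  by apply: hol2_eq hx => s t _ _; rewrite subr0.
have := hol2_comp_sub d1 d2 B1 B2 (w1 _ B1) (w1 _ B2)
  (hol2_cst0 a1 a2 M0) hx hx0.
set K := (X in hol2 _ _ X) => H; exists (K + `|f 0|).
by apply: hol2_eq (hol2_add_cst (f 0) H) => s t _ _; rewrite subrK.
Qed.

Lemma hol2_comp_cvg a1 a2 M e : 0 <= M -> 0 < e -> exists2 h, 0 < h &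
  forall x x', hol2 a1 a2 M x -> hol2 a1 a2 M x' ->
    hol2 a1 a2 h (fun s t => x' s t - x s t) ->
    hol2 a1 a2 e (fun s t => f (x' s t) - f (x s t)).
Proof.
move=> M0 e0; have [B' [B1 B2]] := C2_bound (3 * M).
have n0 : `|0 : R| <= 3 * M by rewrite normr0; lra.
have B'0 : 0 <= B' by apply: le_trans (B1 0 n0).
pose m := M + M ^+ 2; have m0 : 0 <= m by rewrite addr_ge0 ?exprn_ge0.
pose w := e / 2 / (m + 1).
have w0 : 0 < w by rewrite !divr_gt0// ltr_wpDl.
have wm : w * m <= e / 2.
  rewrite /w mulrAC ler_pdivrMr ?ltr_wpDl// ler_wpM2l//; first by rewrite ltW// divr_gt0.
  by rewrite lerDl.
have [r1 r10 H1] := segment_unif_continuous (3 * M) c1 w0.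
have [r2 r20 H2] := segment_unif_continuous (3 * M) c2 w0.
pose k := (B' + 1) * (1 + 2 * M).
have k0 : 0 < k by rewrite mulr_gt0; lra.
pose h := Num.min (Num.min r1 r2 / 4) (e / 2 / k).
have rr : 0 < Num.min r1 r2 by rewrite lt_min r10.
have h0 : 0 < h by rewrite lt_min !divr_gt0.
have h1 : h <= e / 2 / k by rewrite ge_min lexx orbT.
have h2 : 3 * h < Num.min r1 r2.
  have : h <= Num.min r1 r2 / 4 by rewrite ge_min lexx.
  by move: rr; set z := Num.min r1 r2; lra.
have [h3 h4] : 3 * h < r1 /\ 3 * h < r2 by move: h2; rewrite lt_min => /andP[].
exists h => // x x' hx hx' hd.
have wf (g : R -> R) r : 3 * h < r ->
    (forall u v, `|u| <= 3 * M -> `|v - u| < r -> `|g v - g u| < w) ->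
    forall u v, `|u| <= 3 * M -> `|v| <= 3 * M -> `|v - u| <= 3 * h ->
    `|g v - g u| <= w.
  by move=> hr H u v uM vM vu; apply/ltW/H => //; exact: le_lt_trans hr.
have := hol2_comp_sub d1 d2 B1 B2 (wf _ _ h3 H1) (wf _ _ h4 H2) hx hx' hd.
apply: hol2_le; rewrite -/m [leRHS](splitr e); apply: lerD => //.
apply: (@le_trans _ _ (h * k)); last by rewrite -ler_pdivlMr.
rewrite /k mulrA [h * _]mulrC ler_wpM2r//; first lra.
by rewrite ler_wpM2r// ?(ltW h0)// lerDl.
Qed.

End C2.

(** x(s, t) is the rectangular increment over [0, s] x [0, t] plus the values of
    [x] on the axes. *)
Lemma hol2_of_axes a1 a2 K x : 0 <= a1 -> 0 <= a2 ->
  (forall s1 s2 t1 t2, in01 s1 -> in01 s2 -> in01 t1 -> in01 t2 ->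
    `|rect4 x s1 s2 t1 t2| <= K * (`|s2 - s1| `^ a1 * `|t2 - t1| `^ a2)) ->
  (forall s1 s2, in01 s1 -> in01 s2 ->
    `|x s2 0 - x s1 0| <= K * `|s2 - s1| `^ a1) ->
  (forall t1 t2, in01 t1 -> in01 t2 ->
    `|x 0 t2 - x 0 t1| <= K * `|t2 - t1| `^ a2) ->
  `|x 0 0| <= K -> hol2 a1 a2 (4 * K) x.
Proof.
move=> a10 a20 h12 h1 h2 h0; have K0 : 0 <= K by apply: le_trans h0.
have o := in010 R.
have p1 a (s t : R) : 0 <= a -> in01 s -> in01 t -> `|t - s| `^ a <= 1.
  by move=> a0 i j; apply: powR_le1 => //; rewrite normr_ge0 in01_dist.
have A1 s1 s2 t : in01 s1 -> in01 s2 -> in01 t ->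
    `|x s2 t - x s1 t| <= 2 * K * `|s2 - s1| `^ a1.
  move=> i1 i2 j; have -> : x s2 t - x s1 t =
    rect4 x s1 s2 0 t + (x s2 0 - x s1 0) by rewrite /rect4; ring.
  apply: (le_trans (ler_normD _ _)); apply: (le_trans (lerD (h12 _ _ _ _ i1 i2 o j) (h1 _ _ i1 i2))).
  rewrite mulrA; set z := K * _ `^ a1.
  have z0 : 0 <= z by rewrite mulr_ge0 ?powR_ge0.
  by have := ler_wpM2l z0 (p1 _ _ _ a20 o j); rewrite mulr1 -mulrA -/z; lra.
have A2 s t1 t2 : in01 s -> in01 t1 -> in01 t2 ->
    `|x s t2 - x s t1| <= 2 * K * `|t2 - t1| `^ a2.
  move=> i j1 j2; have -> : x s t2 - x s t1 =
    rect4 x 0 s t1 t2 + (x 0 t2 - x 0 t1) by rewrite /rect4; ring.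
  apply: (le_trans (ler_normD _ _)); apply: (le_trans (lerD (h12 _ _ _ _ o i j1 j2) (h2 _ _ j1 j2))).
  rewrite mulrCA mulrC; set z := K * _ `^ a2.
  have z0 : 0 <= z by rewrite mulr_ge0 ?powR_ge0.
  by have := ler_wpM2l z0 (p1 _ _ _ a10 o i); rewrite mulr1 -mulrA -/z; lra.
split.
- move=> s t i j.
  have := A1 _ _ _ o i j; have := h2 _ _ o j.
  have := ler_wpM2l K0 (p1 _ _ _ a10 o i); have := ler_wpM2l K0 (p1 _ _ _ a20 o j).
  rewrite -[2 * K * _]mulrA.
  set u := K * _; set v := K * _; move: h0; rewrite !ler_norml; lra.
- move=> s1 s2 t i1 i2 j; apply: (le_trans (A1 _ _ _ i1 i2 j)).
  by rewrite ler_wpM2r ?powR_ge0//; lra.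
- move=> s t1 t2 i j1 j2; apply: (le_trans (A2 _ _ _ i j1 j2)).
  by rewrite ler_wpM2r ?powR_ge0//; lra.
- move=> s1 s2 t1 t2 i1 i2 j1 j2; apply: (le_trans (h12 _ _ _ _ i1 i2 j1 j2)).
  by rewrite ler_wpM2r ?mulr_ge0 ?powR_ge0//; lra.
Qed.

Definition cont2 y := continuous (fun p : R * R => y (clamp p.1) (clamp p.2)).

Lemma hol2_cont a1 a2 K x : 0 < a1 -> 0 < a2 -> hol2 a1 a2 K x -> cont2 x.
Proof.
move=> a10 a20 hx; have K0 := hol2_ge0 hx; move=> p.
apply/cvgrPdist_lt => e e0.
have e20 : 0 < e / 2 by rewrite divr_gt0.
have [d1 d10 H1] := small_powR0 a10 K0 e20.
have [d2 d20 H2] := small_powR0 a20 K0 e20.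
have /cvgrPdist_lt /(_ _ d10) N1 := continuous_comp (@fst_cont _ _ p) (@clamp_continuous R p.1).
have /cvgrPdist_lt /(_ _ d20) N2 := continuous_comp (@snd_cont _ _ p) (@clamp_continuous R p.2).
apply: filterS2 N1 N2 => q /= q1 q2.
have {}q1 := H1 _ (introT andP (conj (normr_ge0 _) q1)).
have {}q2 := H2 _ (introT andP (conj (normr_ge0 _) q2)).
have := hol2_1 hx (in01_clamp q.1) (in01_clamp p.1) (in01_clamp p.2).
have := hol2_2 hx (in01_clamp q.1) (in01_clamp q.2) (in01_clamp p.2).
move: q1 q2; set u := K * _; set v := K * _; rewrite ltr_norml !ler_norml; lra.
Qed.

Lemma cont2_pick (T : topologicalType) (y : R -> R -> R) (g h : T -> R) :
  cont2 y -> continuous g -> continuous h ->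
  continuous (fun p => y (clamp (g p)) (clamp (h p))).
Proof.
move=> cy cg ch p; apply: (@continuous_comp _ _ _ (fun p => (g p, h p))
  (fun q : R * R => y (clamp q.1) (clamp q.2)) p); last exact: cy.
exact: continuous_pair.
Qed.

Lemma cont4_corners y : cont2 y ->
  [/\ cont4 (fun s1 s2 t1 t2 => y s1 t1), cont4 (fun s1 s2 t1 t2 => y s2 t1),
      cont4 (fun s1 s2 t1 t2 => y s1 t2) & cont4 (fun s1 s2 t1 t2 => y s2 t2)].
Proof.
move=> cy; split; apply: (cont2_pick cy);
  by [apply: fst_comp_cont; by [exact: fst_cont|exact: snd_cont]
     |apply: snd_comp_cont; by [exact: fst_cont|exact: snd_cont]].
Qed.

Lemma cont4_rect4 x : cont2 x -> cont4 (rect4 x).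
Proof.
by move=> /cont4_corners[c11 c21 c12 c22]; rewrite /rect4;
  apply: cont4D => //; apply: cont4B => //; exact: cont4B.
Qed.

Lemma cont4_xgerm x : cont2 x -> cont4 (xgerm x).
Proof.
by move=> /cont4_corners[c11 c21 c12 c22]; apply: cont4M; exact: cont4B.
Qed.

Lemma cont4_mulp y A : cont2 y -> cont4 A -> cont4 (mulp y A).
Proof. by move=> /cont4_corners[c11 _ _ _] cA; exact: cont4M. Qed.

End Composition2.

(** * Additive increments with a density *)

Section Density.
Variable R : realType.
Implicit Types (A F G : R -> R -> R -> R -> R) (x y rho : R -> R -> R).

(** Mixed derivative of an increment, uniformly on the square. *)
Definition has_density F rho := forall e : R, 0 < e -> exists2 d, 0 < d &
  forall s1 s2 t1 t2, in01 s1 -> in01 s2 -> in01 t1 -> in01 t2 ->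
    `|s2 - s1| < d -> `|t2 - t1| < d ->
    `|F s1 s2 t1 t2 - rho s1 t1 * ((s2 - s1) * (t2 - t1))|
      <= e * (`|s2 - s1| * `|t2 - t1|).

(** The difference of the increments is, on small rectangles, below any multiple
    of the area; additivity in one direction and then in the other extends this
    to all rectangles. *)
Lemma density_unique F G rho : biadditive F -> biadditive G ->
  has_density F rho -> has_density G rho -> eq4 F G.
Proof.
move=> [F1 F2] [G1 G2] dF dG s1 s2 t1 t2 i1 i2 j1 j2.
apply/eqP; rewrite -subr_eq0 -normr_le0; apply/ler_addgt0Pr => e e0.
rewrite add0r; have e20 : 0 < e / 2 by rewrite divr_gt0.
have [d d0 H] := dF _ e20; have [d' d0' H'] := dG _ e20.
pose D s s' t t' := F s s' t t' - G s s' t t'.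
pose m := Num.min d d'; have m0 : 0 < m by rewrite lt_min d0.
have loc s s' t t' : in01 s -> in01 s' -> in01 t -> in01 t' ->
    `|s' - s| < m -> `|t' - t| < m -> `|D s s' t t'| <= e * (`|s' - s| * `|t' - t|).
  move=> i i' j j'; rewrite !lt_min => /andP[h1 h2] /andP[k1 k2].
  have := H _ _ _ _ i i' j j' h1 k1; have := H' _ _ _ _ i i' j j' h2 k2.
  rewrite /D; set u := rho _ _ * _; set v := _ * `|t' - t|.
  by rewrite !ler_norml; lra.
have locs s s' t t' : in01 s -> in01 s' -> in01 t -> in01 t' ->
    `|t' - t| < m -> `|D s s' t t'| <= e * `|t' - t| * `|s' - s|.
  move=> i i' j j' tm.
  apply: (@additive_local_lipschitz _ (fun s s' => D s s' t t') m _ _ m0) => //.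
    exact: (additiveB (F1 _ _ j j') (G1 _ _ j j')).
  by move=> u v iu iv uv; rewrite -mulrA [`|t' - t| * _]mulrC; exact: loc.
have all : `|D s1 s2 t1 t2| <= e * `|s2 - s1| * `|t2 - t1|.
  apply: (@additive_local_lipschitz _ (D s1 s2) m _ _ m0) => //.
    exact: (additiveB (F2 _ _ i1 i2) (G2 _ _ i1 i2)).
  by move=> u v iu iv uv; rewrite mulrAC; exact: locs.
apply: (le_trans all); rewrite -mulrA; apply: ler_piMr; first exact: ltW.
by apply: mulr_ile1 => //; exact: in01_dist.
Qed.

Lemma density_mulp F rho y (B : R) :
  (forall s t, in01 s -> in01 t -> `|y s t| <= B) -> has_density F rho ->
  has_density (mulp y F) (fun s t => y s t * rho s t).
Proof.
move=> yB dF e e0.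
have B0 : 0 <= B by apply: le_trans (yB 0 0 _ _) => //; exact: in010.
have eB : 0 < e / (B + 1) by rewrite divr_gt0// ltr_wpDl.
have [d d0 H] := dF _ eB; exists d => // s1 s2 t1 t2 i1 i2 j1 j2 h k.
rewrite /mulp -mulrA -mulrBr.
have := norm_mul_le (yB _ _ i1 j1) (H _ _ _ _ i1 i2 j1 j2 h k).
move=> /le_trans; apply; rewrite mulrA ler_wpM2r ?mulr_ge0//.
by rewrite mulrCA ler_piMr ?(ltW e0)// ler_pdivrMr ?ltr_wpDl// mul1r lerDl.
Qed.

(** With exponents equal to 1 the error of each sewing is quadratic in one side of
    the rectangle and linear in the other. *)
Lemma sew12_close_lip (K : R) A : bigerm 1 1 1 1 K A ->
  exists2 C : R, 0 <= C & forall s1 s2 t1 t2,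
    in01 s1 -> in01 s2 -> in01 t1 -> in01 t2 ->
    `|A s1 s2 t1 t2 - sew12 A s1 s2 t1 t2| <=
      C * (`|s2 - s1| + `|t2 - t1|) * (`|s2 - s1| * `|t2 - t1|).
Proof.
move=> gA; have K0 := bigerm_ge0 gA; have o : 0 < 1 :> R by exact: ltr01.
have t11 : 1 < 1 + 1 :> R by lra.
have c0 : 0 <= sew_cst (1 + 1 : R) by exact: sew_cst_ge0.
exists (sew_cst (1 + 1) * ((1 + sew_cst (1 + 1)) * K)).
  by rewrite !mulr_ge0// addr_ge0.
move=> s1 s2 t1 t2 i1 i2 j1 j2.
rewrite -(subrKA (sew2 A s1 s2 t1 t2)).
apply: (le_trans (ler_normD _ _)).
have h1 := sew2_dist o o t11 gA i1 i2 j1 j2.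
have h2 := sew12_dist o o o o t11 t11 gA i1 i2 j1 j2.
apply: (le_trans (lerD h1 h2)); move: c0; set c := sew_cst _ => c0.
have sq (z : R) : `|z| `^ (1 + 1) = `|z| * `|z| by rewrite powR_exprD// powRr1.
rewrite !sq !powRr1//; move: (normr_ge0 (s2 - s1)) (normr_ge0 (t2 - t1)).
set p : R := `|s2 - s1|; set q : R := `|t2 - t1| => p0 q0; clearbody c p q.
have : 0 <= c * c * K * (p * (q * q)) by rewrite !mulr_ge0.
rewrite mulrDl mul1r; lra.
Qed.

Lemma sew12_density (K : R) A rho : bigerm 1 1 1 1 K A -> has_density A rho ->
  has_density (sew12 A) rho.
Proof.
move=> /sew12_close_lip[C C0 HC] dA e e0.
have e20 : 0 < e / 2 by rewrite divr_gt0.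
have [d d0 H] := dA _ e20.
pose r := e / 4 / (C + 1); have C1 : 0 < C + 1 by lra.
have r0 : 0 < r by rewrite !divr_gt0.
exists (Num.min d r); first by rewrite lt_min d0.
move=> s1 s2 t1 t2 i1 i2 j1 j2; rewrite !lt_min => /andP[h1 h2] /andP[k1 k2].
have := H _ _ _ _ i1 i2 j1 j2 h1 k1; have := HC _ _ _ _ i1 i2 j1 j2.
move: (normr_ge0 (s2 - s1)) (normr_ge0 (t2 - t1)) h2 k2.
set p : R := `|s2 - s1|; set q : R := `|t2 - t1| => p0 q0 h2 k2.
have pq0 : 0 <= p * q by exact: mulr_ge0.
have : C * (p + q) <= e / 2.
  have : C * (p + q) <= (C + 1) * (r + r).
    by rewrite ler_pM ?addr_ge0//; [lra|apply: lerD; exact: ltW].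
  move=> /le_trans; apply; rewrite /r; apply: eq_imp_le; field.
  by rewrite gt_eqF.
move=> /(ler_wpM2r pq0).
set u := rho _ _ * _; set v := _ * (p + q) * _.
by rewrite !ler_norml; lra.
Qed.

Lemma is_derive_partials (X : R -> R -> R) w s t : smooth X ->
  is_derive s (1 : R) (partials w X ^~ t) (partial1 (partials w X) s t) /\
  is_derive t (1 : R) (partials w X s) (partial2 (partials w X) s t).
Proof.
move=> /(_ w)[_ /(_ s t)[d1 d2]].
by split; rewrite /partial1 /partial2 derive1E; exact: derivableP.
Qed.

Section Smooth.
Variable X : R -> R -> R.
Hypothesis sX : smooth X.

Let d1 s t := (is_derive_partials [::] s t sX).1.
Let d2 s t := (is_derive_partials [::] s t sX).2.
Let d12 s t := (is_derive_partials [:: true] s t sX).1.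
Let X1 := partial1 X.
Let X2 := partial2 X.
Let X12 := partial1 (partial2 X).
Let c0 : continuous (fun p : R * R => X p.1 p.2) := (sX [::]).1.
Let c1 : continuous (fun p : R * R => X1 p.1 p.2) := (sX [:: false]).1.
Let c2 : continuous (fun p : R * R => X2 p.1 p.2) := (sX [:: true]).1.
Let c12 : continuous (fun p : R * R => X12 p.1 p.2) := (sX [:: false; true]).1.

Lemma smooth_MVT1 s1 s2 t : exists2 c : R, 0 <= c <= 1 &
  X s2 t - X s1 t = X1 (s1 + c * (s2 - s1)) t * (s2 - s1).
Proof. exact: (MVT_conv s1 s2 (d1 ^~ t)). Qed.

Lemma smooth_MVT2 s t1 t2 : exists2 c : R, 0 <= c <= 1 &
  X s t2 - X s t1 = X2 s (t1 + c * (t2 - t1)) * (t2 - t1).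
Proof. exact: (MVT_conv t1 t2 (d2 s)). Qed.

Lemma smooth_MVT12 s1 s2 t1 t2 : exists c d : R,
  [/\ 0 <= c <= 1, 0 <= d <= 1 & rect4 X s1 s2 t1 t2 =
   X12 (s1 + c * (s2 - s1)) (t1 + d * (t2 - t1)) * ((s2 - s1) * (t2 - t1))].
Proof.
have dd t : is_derive t (1 : R) (fun t => X s2 t - X s1 t) (X2 s2 t - X2 s1 t).
  by apply: is_deriveB; exact: d2.
have [d d01 E] := MVT_conv t1 t2 dd.
have [c c01 E'] := MVT_conv s1 s2 (d12 ^~ (t1 + d * (t2 - t1))).
exists c, d; split => //; rewrite /rect4.
have -> : X s2 t2 - X s1 t2 - X s2 t1 + X s1 t1 =
  X s2 t2 - X s1 t2 - (X s2 t1 - X s1 t1) by ring.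
by rewrite E {}E' mulrA.
Qed.

Let in01_norm (s : R) : in01 s -> `|s| <= 1.
Proof. by move=> /andP[? ?]; rewrite ler_norml; lra. Qed.

Let conv_norm (s t c : R) : in01 s -> in01 t -> 0 <= c <= 1 -> `|s + c * (t - s)| <= 1.
Proof. by move=> i j c01; apply/in01_norm/in01_conv. Qed.

Let near_norm (s t c : R) : 0 <= c <= 1 -> `|s + c * (t - s) - s| <= `|t - s|.
Proof.
move=> /andP[c00 c11]; rewrite [s + _]addrC addrK normrM ger0_norm//.
by rewrite ler_piMl.
Qed.

Lemma smooth_bounded : exists B : R, forall s t, `|s| <= 1 -> `|t| <= 1 ->
  [/\ `|X s t| <= B, `|X1 s t| <= B, `|X2 s t| <= B & `|X12 s t| <= B].
Proof.
have [B0 H0] := square_bounded 1 c0; have [B1 H1] := square_bounded 1 c1.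
have [B2 H2] := square_bounded 1 c2; have [B12 H12] := square_bounded 1 c12.
exists (`|B0| + `|B1| + `|B2| + `|B12|) => s t s1 t1.
have := (ler_norm B0, ler_norm B1, ler_norm B2, ler_norm B12) => -[[[? ?] ?] ?].
have := (normr_ge0 B0, normr_ge0 B1, normr_ge0 B2, normr_ge0 B12) => -[[[? ?] ?] ?].
by have := H0 _ _ s1 t1; have := H1 _ _ s1 t1; have := H2 _ _ s1 t1;
   have := H12 _ _ s1 t1; split; lra.
Qed.

Lemma smooth_hol2 : exists K : R, hol2 1 1 K X.
Proof.
have [B HB] := smooth_bounded; exists B; split.
- by move=> s t i j; have [] := HB s t (in01_norm i) (in01_norm j).
- move=> s1 s2 t i1 i2 j; have [c c01 ->] := smooth_MVT1 s1 s2 t.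
  rewrite powRr1// normrM ler_wpM2r//.
  by have [] := HB _ t (conv_norm i1 i2 c01) (in01_norm j).
- move=> s t1 t2 i j1 j2; have [c c01 ->] := smooth_MVT2 s t1 t2.
  rewrite powRr1// normrM ler_wpM2r//.
  by have [] := HB s _ (in01_norm i) (conv_norm j1 j2 c01).
- move=> s1 s2 t1 t2 i1 i2 j1 j2.
  have [c [d [c01 d01 ->]]] := smooth_MVT12 s1 s2 t1 t2.
  rewrite !powRr1// -[`|s2 - s1| * _]normrM [leLHS]normrM ler_wpM2r//.
  by have [] := HB _ _ (conv_norm i1 i2 c01) (conv_norm j1 j2 d01).
Qed.

Lemma rect4_density : has_density (rect4 X) X12.
Proof.
move=> e e0; have [d d0 H] := square_unif_continuous 1 c12 e0.
exists d => // s1 s2 t1 t2 i1 i2 j1 j2 sd td.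
have [c [c' [c01 c01' ->]]] := smooth_MVT12 s1 s2 t1 t2.
rewrite -mulrBl -[`|s2 - s1| * _]normrM [leLHS]normrM ler_wpM2r// ltW//.
apply: H; rewrite ?in01_norm//.
- exact: le_lt_trans (near_norm _ _ c01) sd.
- exact: le_lt_trans (near_norm _ _ c01') td.
Qed.

Lemma xgerm_density : has_density (xgerm X) (fun s t => X1 s t * X2 s t).
Proof.
move=> e e0; have [B HB] := smooth_bounded.
have B0 : 0 <= B.
  by have [+ _ _ _] := HB 0 0 (in01_norm (in010 R)) (in01_norm (in010 R)); exact: le_trans.
have eB : 0 < e / 2 / (B + 1) by rewrite !divr_gt0// ltr_wpDl.
have [d d0 H] := square_unif_continuous 1 c1 eB.
have [d' d0' H'] := square_unif_continuous 1 c2 eB.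
exists (Num.min d d'); first by rewrite lt_min d0.
move=> s1 s2 t1 t2 i1 i2 j1 j2; rewrite !lt_min => /andP[h1 h2] /andP[k1 k2].
rewrite /xgerm; have [c c01 ->] := smooth_MVT1 s1 s2 t1.
have [c' c01' ->] := smooth_MVT2 s2 t1 t2.
set a := X1 _ _; set b := X2 _ _; set a' := X1 s1 t1; set b' := X2 s1 t1.
have -> : a * (s2 - s1) * (b * (t2 - t1)) - a' * b' * ((s2 - s1) * (t2 - t1))
  = ((a - a') * b + a' * (b - b')) * ((s2 - s1) * (t2 - t1)) by ring.
rewrite -[`|s2 - s1| * _]normrM [leLHS]normrM ler_wpM2r//; apply: (le_trans (ler_normD _ _)).
have n := in01_norm.
have ea : `|a - a'| <= e / 2 / (B + 1).
  apply/ltW/H; rewrite ?n//; first exact: le_lt_trans (near_norm _ _ c01) h1.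
  by rewrite subrr normr0.
have eb : `|b - b'| <= e / 2 / (B + 1).
  apply/ltW/H'; rewrite ?n//; exact: le_lt_trans (near_norm _ _ c01') k2.
have [_ _ bB _] := HB _ _ (n _ i2) (conv_norm j1 j2 c01').
have [_ aB _ _] := HB _ _ (n _ i1) (n _ j1).
have := lerD (norm_mul_le ea bB) (norm_mul_le aB eb); move=> /le_trans; apply.
set k := e / 2 / (B + 1) in eB *.
have kE : k * (B + 1) = e / 2 by rewrite /k divfK// gt_eqF// ltr_wpDl.
clearbody k; lra.
Qed.

End Smooth.
End Density.

(** * Iterated integrals *)

Section Integrals.
Variable R : realType.
Implicit Types (f g G : R -> R).

(** An open interval around [0, 1] suffices and avoids one-sided
    derivatives. *)
Definition antiderivative G g := forall u : R, -1 < u < 2 ->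
  is_derive u (1 : R) G (g u).

Lemma continuous_antiderivative g : continuous g -> exists G, antiderivative G g.
Proof.
move=> cg; pose G x := \int[lebesgue_measure]_(t in `[(-1 : R), x]) g t.
have ig : (@lebesgue_measure R).-integrable `[(-1 : R), 2] (EFin \o g).
  apply: continuous_compact_integrable; first exact: segment_compact.
  exact: continuous_subspaceT.
exists G => u /andP[u1 u2].
have [dG GE] := continuous_FTC1_closed u2 ig u1 (cg u).
by rewrite -GE derive1E; exact: derivableP.
Qed.

Lemma oriented_int_antiderivative G g a b : continuous g ->
  antiderivative G g -> in01 a -> in01 b -> oriented_int a b g = G b - G a.
Proof.
move=> cg GD.
have key u v : in01 u -> in01 v -> u <= v ->
    \int[lebesgue_measure]_(x in `[u, v]) g x = G v - G u.
  move=> /andP[u0 u1] /andP[v0 v1]; rewrite le_eqVlt => /predU1P[->|uv].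
    by rewrite set_itv1 Rintegral_set1 subrr.
  have dG z : -1 < z < 2 -> derivable G z 1.
    by move=> /GD H; exact: ex_derive.
  have cG z : -1 < z < 2 -> {for z, continuous G}.
    move=> /dG /derivable1_diffP; exact: differentiable_continuous.
  rewrite /Rintegral (@continuous_FTC2 _ g G)//.
  - exact: continuous_subspaceT.
  - split.
    + by move=> z; rewrite in_itv/= => /andP[uz zv]; apply: dG; lra.
    + by apply: cvg_at_right_filter; apply: cG; lra.
    + by apply: cvg_at_left_filter; apply: cG; lra.
  - move=> z; rewrite in_itv/= => /andP[uz zv].
    have zz : -1 < z < 2 by lra.
    by have zD := GD z zz; rewrite derive1E derive_val.
move=> a01 b01; rewrite /oriented_int; case: ifP => [ab|/negbT].
  exact: key.
by rewrite -ltNge => ba; rewrite key ?ltW// opprB.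
Qed.

Lemma oriented_int_eq f g a b : in01 a -> in01 b ->
  (forall u, in01 u -> f u = g u) -> oriented_int a b f = oriented_int a b g.
Proof.
move=> /andP[a0 a1] /andP[b0 b1] fg; rewrite /oriented_int.
case: ifP => _; [|congr (- _)]; apply: eq_Rintegral => z;
  by rewrite inE/= in_itv/= => /andP[z0 z1]; apply: fg; rewrite /in01; lra.
Qed.

Lemma oriented_int_MVT g a b : continuous g -> in01 a -> in01 b ->
  exists2 c : R, 0 <= c <= 1 &
    oriented_int a b g = g (a + c * (b - a)) * (b - a).
Proof.
move=> cg a01 b01; have [G GD] := continuous_antiderivative cg.
rewrite (oriented_int_antiderivative cg GD a01 b01).
by apply: MVT_conv_in GD _ _; move: a01 b01; rewrite /in01; lra.
Qed.

Lemma oriented_int_additive g : continuous g ->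
  additive01 (fun a b => oriented_int a b g).
Proof.
move=> cg a b c ia ib ic; have [G GD] := continuous_antiderivative cg.
by rewrite !(oriented_int_antiderivative cg GD)//; ring.
Qed.

Lemma oriented_intD f g a b : continuous f -> continuous g ->
  in01 a -> in01 b ->
  oriented_int a b (fun u => f u + g u) = oriented_int a b f + oriented_int a b g.
Proof.
move=> cf cg ia ib; have [F FD] := continuous_antiderivative cf.
have [G GD] := continuous_antiderivative cg.
rewrite (oriented_int_antiderivative cf FD)// (oriented_int_antiderivative cg GD)//.
have cfg : continuous (fun u => f u + g u).
  by move=> u; apply: continuousD; [exact: cf|exact: cg].
have FGD : antiderivative (fun u => F u + G u) (fun u => f u + g u).
  by move=> u u01; have := FD u u01; have := GD u u01 => H1 H2; exact: is_deriveD.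
by rewrite (oriented_int_antiderivative cfg FGD)//; ring.
Qed.

Lemma oriented_intB f g a b : continuous f -> continuous g ->
  in01 a -> in01 b ->
  oriented_int a b (fun u => f u - g u) = oriented_int a b f - oriented_int a b g.
Proof.
move=> cf cg ia ib.
have cfg : continuous (fun u => f u - g u).
  by move=> u; apply: continuousB; [exact: cf|exact: cg].
apply/eqP; rewrite eq_sym subr_eq -oriented_intD//; apply/eqP.
by apply: oriented_int_eq => // u _; rewrite subrK.
Qed.

Definition dint (f : R -> R -> R) (s1 s2 t1 t2 : R) : R :=
  oriented_int s1 s2 (fun u => oriented_int t1 t2 (f u)).

Section Dint.
Variable f : R -> R -> R.
Hypothesis cf : cont2 f.

Let h u v := f (clamp u) (clamp v).

Let ch u : continuous (h u).
Proof.
move=> v; apply: (@continuous_comp _ _ _ (fun v => (u, v))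
  (fun q : R * R => f (clamp q.1) (clamp q.2)) v); last exact: cf.
apply: (@continuous_pair _ _ _ (fun=> u) id); first exact: cst_continuous.
by move=> ?; exact: cvg_id.
Qed.

Let conv_norm (s t c : R) : in01 s -> in01 t -> 0 <= c <= 1 -> `|s + c * (t - s)| <= 1.
Proof.
move=> i j c01; have /andP[? ?] := in01_conv i j c01.
by rewrite ler_norml; lra.
Qed.

Let inner_cont t1 t2 : in01 t1 -> in01 t2 ->
  continuous (fun u => oriented_int t1 t2 (h u)).
Proof.
move=> j1 j2 u; apply/cvgrPdist_lt => e e0.
have [d d0 H] := square_unif_continuous (`|u| + 1) cf e0.
apply/nbhs_ballP; exists d => //= u' uu'.
rewrite -oriented_intB//.
have cD : continuous (fun v => h u v - h u' v).
  by move=> v; apply: continuousB; exact: ch.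
have [c c01 ->] := oriented_int_MVT cD j1 j2.
set v := t1 + _; rewrite normrM.
have hv : `|h u v - h u' v| < e.
  rewrite distrC; apply: (H u v u' v).
  - by rewrite lerDl.
  - by apply: (le_trans (conv_norm j1 j2 c01)); rewrite lerDr.
  - by rewrite distrC.
  - by rewrite subrr normr0.
by apply: le_lt_trans hv; rewrite ler_piMr// in01_dist.
Qed.

Let dintE s1 s2 t1 t2 : in01 s1 -> in01 s2 -> in01 t1 -> in01 t2 ->
  dint f s1 s2 t1 t2 = dint h s1 s2 t1 t2.
Proof.
move=> i1 i2 j1 j2; apply: oriented_int_eq => // u iu.
by apply: oriented_int_eq => // v iv; rewrite /h !clamp_id.
Qed.

Lemma dint_biadditive : biadditive (dint f).
Proof.
split=> [t1 t2 j1 j2 s1 s2 s3 i1 i2 i3|s1 s2 i1 i2 t1 t2 t3 j1 j2 j3].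
  by rewrite !dintE//; exact: (oriented_int_additive (inner_cont j1 j2)).
rewrite !dintE// /dint -oriented_intD//; [|exact: inner_cont|exact: inner_cont].
apply: oriented_int_eq => // u _.
exact: (oriented_int_additive (@ch u)).
Qed.

(** Mean value theorem for the inner and then for the outer integral. *)
Lemma dint_density : has_density (dint f) f.
Proof.
move=> e e0; have [d d0 H] := square_unif_continuous 1 cf e0.
exists d => // s1 s2 t1 t2 i1 i2 j1 j2 sd td; rewrite dintE// /dint.
have [c c01 ->] := oriented_int_MVT (inner_cont j1 j2) i1 i2.
have [c' c01' ->] := oriented_int_MVT (@ch (s1 + c * (s2 - s1))) j1 j2.
set u := s1 + _; set v := t1 + _.
rewrite -[f s1 t1]/(f s1 t1) -mulrA [(t2 - t1) * _]mulrC -mulrBl.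
rewrite -[`|s2 - s1| * _]normrM [leLHS]normrM ler_wpM2r//.
have -> : f s1 t1 = h s1 t1 by rewrite /h !clamp_id.
have n1 (z : R) : in01 z -> `|z| <= 1.
  by move=> /andP[? ?]; rewrite ler_norml; lra.
have near (s t k : R) : 0 <= k <= 1 -> `|s + k * (t - s) - s| <= `|t - s|.
  move=> /andP[k0 k1]; rewrite [s + _]addrC addrK normrM ger0_norm//.
  by rewrite ler_piMl.
apply/ltW/(H s1 t1 u v); rewrite ?n1//.
- exact: le_lt_trans (near _ _ _ c01) sd.
- exact: le_lt_trans (near _ _ _ c01') td.
Qed.

End Dint.
End Integrals.

(** * Increments on the cube and the sewing maps *)

Section Bridge.
Variable R : realType.
Implicit Types (A : R -> R -> R -> R -> R) (x : R -> R -> R).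

Definition mat A : incr R 2 2 := fun s t =>
  A (s ord0 0) (s ord0 1) (t ord0 0) (t ord0 1).

Lemma pair_rvE (a b : R) :
  (pair_rv a b ord0 0 = a) * (pair_rv a b ord0 1 = b).
Proof. by rewrite !mxE. Qed.

Lemma pair_rv_eta (s : 'rV[R]_2) : s = pair_rv (s ord0 0) (s ord0 1).
Proof.
apply/rowP => -[[|[|//]] lt_i]; rewrite !mxE/=; congr (s _ _); exact: val_inj.
Qed.

Lemma cube_pair (a b : R) : in01 a -> in01 b -> cube (pair_rv a b).
Proof. by move=> ia ib [[|[|//]] lt_i]; rewrite !mxE. Qed.

Lemma cube2 (s : 'rV[R]_2) : cube s -> in01 (s ord0 0) /\ in01 (s ord0 1).
Proof. by move=> cs; split; exact: cs. Qed.

Lemma eq_cube_pair (f : incr R 2 2) A :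
  (forall s1 s2 t1 t2, in01 s1 -> in01 s2 -> in01 t1 -> in01 t2 ->
     f (pair_rv s1 s2) (pair_rv t1 t2) = A s1 s2 t1 t2) <-> eq_cube f (mat A).
Proof.
split=> [H s t /cube2[i1 i2] /cube2[j1 j2]|H s1 s2 t1 t2 i1 i2 j1 j2].
  by rewrite [in LHS](pair_rv_eta s) [in LHS](pair_rv_eta t) H.
by rewrite H ?/mat ?pair_rvE//; exact: cube_pair.
Qed.

Lemma eq_cube_trans k l (f g h : incr R k l) :
  eq_cube f g -> eq_cube g h -> eq_cube f h.
Proof. by move=> fg gh s t cs ct; rewrite fg// gh. Qed.

Definition triple_rv (a b c : R) : 'rV[R]_3 := \row_(i < 3) [:: a; b; c]`_i.

Lemma cube_triple (a b c : R) : in01 a -> in01 b -> in01 c ->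
  cube (triple_rv a b c).
Proof. by move=> ia ib ic [[|[|[|//]]] lt_i]; rewrite !mxE. Qed.

Lemma delta1_pair l (g : incr R 2 l) s t : delta1 g s t =
  g (pair_rv (s ord0 0) (s ord0 (inord 2))) t
  - g (pair_rv (s ord0 0) (s ord0 1)) t
  - g (pair_rv (s ord0 1) (s ord0 (inord 2))) t.
Proof.
rewrite /delta1 !big_ord_recl big_ord0 addr0 /= /bump/=.
rewrite !(exprS, expr0, mulr1, mulN1r, mulrN, mul1r, opprK, mulNr).
have -> : col' ord0 s = pair_rv (s ord0 1) (s ord0 (inord 2)).
  apply/rowP => -[[|[|//]] lt_i]; rewrite !mxE/=; congr (s _ _);
    by apply: val_inj; rewrite /= ?inordK.
have -> : col' (lift ord0 ord0) s = pair_rv (s ord0 0) (s ord0 (inord 2)).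
  apply/rowP => -[[|[|//]] lt_i]; rewrite !mxE/=; congr (s _ _);
    by apply: val_inj; rewrite /= ?inordK.
have -> : col' (lift ord0 (lift ord0 ord0)) s = pair_rv (s ord0 0) (s ord0 1).
  apply/rowP => -[[|[|//]] lt_i]; rewrite !mxE/=; congr (s _ _);
    by apply: val_inj; rewrite /= ?inordK.
by ring.
Qed.

Lemma triple_rvE (a b c : R) : [/\ triple_rv a b c ord0 0 = a,
  triple_rv a b c ord0 1 = b & triple_rv a b c ord0 (inord 2) = c].
Proof. by rewrite !mxE/= inordK. Qed.

Lemma delta1_triple l (g : incr R 2 l) a b c t : delta1 g (triple_rv a b c) t =
  g (pair_rv a c) t - g (pair_rv a b) t - g (pair_rv b c) t.
Proof. by rewrite delta1_pair; have [-> -> ->] := triple_rvE a b c. Qed.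

(** The difference of two solutions is additive, and each of them is bounded by a
    power larger than 1. *)
Lemma sewing_unique l (h : incr R 3 l) (g g' : incr R 2 l) :
  is_sewing1 h g -> is_sewing1 h g' -> eq_cube g g'.
Proof.
move=> [mu mu1 [_ _ [C gC] gh]] [mu' mu1' [_ _ [C' gC'] gh']] s t cs ct.
have [i1 i2] := cube2 cs; rewrite (pair_rv_eta s).
set a := s ord0 0; set b := s ord0 1.
pose F u v := g (pair_rv u v) t - g' (pair_rv u v) t.
have Fadd : additive01 F.
  move=> u v w iu iv iw; have cuvw := cube_triple iu iv iw.
  have := gh _ _ cuvw ct; rewrite -(gh' _ _ cuvw ct) !delta1_triple /F.
  by move=> E; move: E; lra.
have zadd : additive01 (fun _ _ : R => 0 : R) by move=> *; rewrite addr0.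
apply/eqP; rewrite -subr_eq0 -/(F a b); apply/eqP.
(* g is at distance |g'| of F and at distance |g| of 0, both additive. *)
apply: (additive_unique (A := fun u v => g (pair_rv u v) t) Fadd zadd mu1' mu1
  (C := C') (C' := C)) => // u v iu iv.
  have -> : g (pair_rv u v) t - F u v = g' (pair_rv u v) t by rewrite /F; ring.
  by have := gC' _ _ (cube_pair iu iv) ct; rewrite !pair_rvE.
by rewrite subr0; have := gC _ _ (cube_pair iu iv) ct; rewrite !pair_rvE.
Qed.

Lemma sewing_defined l (h : incr R 3 l) (g : incr R 2 l) : is_sewing1 h g ->
  sewing1_defined h /\ eq_cube (Lambda1 h) g.
Proof.
move=> hg.
have hL : is_sewing1 h (Lambda1 h).
  by have := @xgetPex _ (fun _ _ => 0 : R) (is_sewing1 h) (ex_intro _ g hg).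
by split; [split=> // g' hg'; exact: sewing_unique hg' hL|exact: sewing_unique hL hg].
Qed.

Lemma repeated2 (s : 'rV[R]_2) : repeated s -> s ord0 0 = s ord0 1.
Proof.
move=> [i [j [ij]]].
have -> : i = 0.
  by apply: val_inj; case: i ij => -[|[|//]] //= _ jE; have := ltn_ord j; rewrite jE.
have -> : j = 1.
  by apply: val_inj; case: i ij => -[|[|//]] //= _ jE; have := ltn_ord j; rewrite jE.
by [].
Qed.

Definition null_diag A := forall s1 s2 t1 t2,
  in01 s1 -> in01 s2 -> in01 t1 -> in01 t2 -> s1 = s2 \/ t1 = t2 ->
  A s1 s2 t1 t2 = 0.

(** On the cube the increment coincides with a function that is continuous on the
    whole space, the one obtained by clamping the variables. *)
Lemma Pspace_mat (f : incr R 2 2) A : cont4 A -> null_diag A ->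
  eq_cube f (mat A) -> Pspace f.
Proof.
move=> cA A0 fA; split; last first.
  move=> s t cs ct rst; rewrite fA//.
  have [i1 i2] := cube2 cs; have [j1 j2] := cube2 ct.
  by apply: A0 => //; case: rst => /repeated2; [left|right].
pose F (p : 'rV[R]_2 * 'rV[R]_2) := A (clamp (p.1 ord0 0)) (clamp (p.1 ord0 1))
  (clamp (p.2 ord0 0)) (clamp (p.2 ord0 1)).
have cF : continuous F.
  have c1 i : continuous (fun p : 'rV[R]_2 * 'rV[R]_2 => p.1 ord0 i).
    move=> p; apply: (@continuous_comp _ _ _ fst (fun M : 'rV[R]_2 => M ord0 i)).
      exact: fst_cont.
    exact: coord_continuous.
  have c2 i : continuous (fun p : 'rV[R]_2 * 'rV[R]_2 => p.2 ord0 i).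
    move=> p; apply: (@continuous_comp _ _ _ snd (fun M : 'rV[R]_2 => M ord0 i)).
      exact: snd_cont.
    exact: coord_continuous.
  exact: (cont4_comp cA).
apply: (@subspace_eq_continuous _ _ _ F); last exact: continuous_subspaceT.
move=> [s t]; rewrite inE => -[/= cs ct].
have [i1 i2] := cube2 cs; have [j1 j2] := cube2 ct.
by change (F (s, t) = f s t); rewrite fA// /F /mat/= !clamp_id.
Qed.

(** The increment A - sew1 A solves the equation defining Lambda1, and it is the
    only solution, so that Id - Lambda1 delta1 is the sewing. The second
    direction is obtained by exchanging the variables. *)
Lemma sewing_mat a g K A (B : incr R 2 2) : 0 < a -> 0 < g -> 1 < a + g ->
  (forall t1 t2, in01 t1 -> in01 t2 -> germ a g K (fun s1 s2 => A s1 s2 t1 t2)) ->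
  (forall s1 s2 t, in01 s1 -> in01 s2 -> in01 t -> A s1 s2 t t = 0) ->
  cont4 A -> eq_cube B (mat A) ->
  sewing1_defined (delta1 B) /\
  eq_cube (Id_Lambda_delta1 B) (mat (sew1 A)).
Proof.
move=> a0 g0 ag gA A0 cA BA.
have bd t1 t2 s1 s2 : in01 t1 -> in01 t2 -> in01 s1 -> in01 s2 ->
    `|A s1 s2 t1 t2 - sew1 A s1 s2 t1 t2| <=
      sew_cst (a + g) * K * `|s2 - s1| `^ (a + g).
  by move=> j1 j2 i1 i2; exact: (sew_bound a0 g0 ag (gA _ _ j1 j2) i1 i2).
have dB s t : cube s -> cube t -> delta1 B s t =
    A (s ord0 0) (s ord0 (inord 2)) (t ord0 0) (t ord0 1)
    - A (s ord0 0) (s ord0 1) (t ord0 0) (t ord0 1)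
    - A (s ord0 1) (s ord0 (inord 2)) (t ord0 0) (t ord0 1).
  move=> cs ct; rewrite delta1_pair !BA//; last first.
  - by apply: cube_pair; exact: cs.
  - by apply: cube_pair; exact: cs.
  - by apply: cube_pair; exact: cs.
  by rewrite /mat !pair_rvE.
have sew : is_sewing1 (delta1 B)
    (mat (fun s1 s2 t1 t2 => A s1 s2 t1 t2 - sew1 A s1 s2 t1 t2)).
  exists (a + g) => //; split.
  - exists K, 1%N, (fun=> a); split.
      by move=> _; rewrite a0 ltrDl.
    move=> s t cs ct; have [j1 j2] := cube2 ct; rewrite big_ord1 [a + g]addrC addrK dB//.
    have -> : (2 : 'I_3) = inord 2 by apply: val_inj; rewrite /= inordK.
    by apply: (gA _ _ j1 j2); exact: cs.
  - apply: (Pspace_mat (A := fun s1 s2 t1 t2 => A s1 s2 t1 t2 - sew1 A s1 s2 t1 t2)) => //.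
      apply: cont4B => //; apply: cont4_swap; apply: (sew2_continuous a0 g0 ag (K := K)).
        by move=> t1 t2 j1 j2; exact: gA.
      exact: cont4_swap.
    move=> s1 s2 t1 t2 i1 i2 j1 j2 [E|E]; rewrite E in i1 j1 *.
      rewrite /sew1 /swap /sew2 /sew subrr subr0.
      exact: (germ_diag a0 (gA _ _ j1 j2)).
    have g0' : germ a g 0 (fun s s' => A s s' t2 t2).
      by move=> u v w iu iv iw; rewrite !A0// !subrr normr0 mul0r.
    apply/eqP; rewrite -normr_le0.
    by have := sew_bound a0 g0 ag g0' i1 i2; rewrite mulr0 mul0r.
  - exists (sew_cst (a + g) * K) => s t cs ct.
    by have [i1 i2] := cube2 cs; have [j1 j2] := cube2 ct; exact: bd.
  - move=> s t cs ct; rewrite dB// delta1_pair /mat !pair_rvE.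
    by rewrite /sew1 /swap /sew2 /sew; ring.
have [sd LE] := sewing_defined sew; split=> // s t cs ct.
rewrite /Id_Lambda_delta1 /incr_sub BA// LE// /mat; ring.
Qed.

Lemma bigerm_null a1 a2 g1 g2 K A : 0 < g1 -> 0 < g2 ->
  bigerm a1 a2 g1 g2 K A -> null_diag A.
Proof.
move=> g10 g20 gA s1 s2 t1 t2 i1 i2 j1 j2 st.
have := bigerm_bound gA i1 i2 j1 j2.
case: st => ->; rewrite subrr normr0 powR0 ?gt_eqF//.
  by rewrite mul0r mulr0 normr_le0 => /eqP.
by rewrite !mulr0 normr_le0 => /eqP.
Qed.

Section Young.
Variables (a1 a2 g1 g2 K : R).
Hypotheses (a10 : 0 < a1) (a20 : 0 < a2) (g10 : 0 < g1) (g20 : 0 < g2).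
Hypotheses (mu1 : 1 < a1 + g1) (mu2 : 1 < a2 + g2).
Variables (A : R -> R -> R -> R -> R) (B : incr R 2 2).
Hypotheses (gA : bigerm a1 a2 g1 g2 K A) (cA : cont4 A) (BA : eq_cube B (mat A)).

Lemma young_mat : young_defined B /\ eq_cube (young B) (mat (sew12 A)).
Proof.
have A0 := bigerm_null g10 g20 gA.
have [sd2 E2] : sewing1_defined (delta1 (flip B)) /\
    eq_cube (Id_Lambda_delta1 (flip B)) (mat (sew1 (swap A))).
  apply: (sewing_mat a20 g20 mu2 (K := K)).
  - by move=> s1 s2 i1 i2; exact: (bigerm_unif g10 gA i1 i2).
  - by move=> t1 t2 s j1 j2 i; apply: A0 => //; left.
  - exact: cont4_swap.
  - by move=> t s ct cs; exact: BA.
have E2' : eq_cube (Id_Lambda_delta2 B) (mat (sew2 A)).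
  by move=> s t cs ct; exact: (E2 t s ct cs).
have [sd1 E1] : sewing1_defined (delta1 (Id_Lambda_delta2 B)) /\
    eq_cube (Id_Lambda_delta1 (Id_Lambda_delta2 B)) (mat (sew1 (sew2 A))).
  apply: (sewing_mat a10 g10 mu1 _ _ _ E2').
  - by move=> t1 t2 j1 j2; exact: (sew2_germ_unif a20 g10 g20 mu2 gA j1 j2).
  - by move=> s1 s2 t _ _ _; rewrite /sew2 /sew subrr.
  - exact: (sew2_cont a20 g10 g20 mu2 gA cA).
split=> //; split=> //; exact: Pspace_mat BA.
Qed.

End Young.

Lemma holder_norm_le a b (f : incr R 2 2) K : 0 <= K ->
  (forall s t, cube s -> cube t -> `|f s t| <=
    K * (`|s ord0 1 - s ord0 0| `^ a * `|t ord0 1 - t ord0 0| `^ b)) ->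
  (holder_norm a b f <= K%:E)%E.
Proof.
move=> K0 fK; apply: ge_ereal_sup => _ [s [t [cs ct ->]]]; rewrite lee_fin.
set p := _ `^ a * _; have p0 : 0 <= p by rewrite mulr_ge0 ?powR_ge0.
have [->|pn0] := eqVneq p 0; first by rewrite invr0 mulr0.
by rewrite ler_pdivrMr ?lt_neqAle ?p0 1?eq_sym ?pn0//; exact: fK.
Qed.

Lemma holder_norm_ge a b (f : incr R 2 2) K : 0 < a -> 0 < b ->
  (forall s t, cube s -> cube t -> repeated s \/ repeated t -> f s t = 0) ->
  (holder_norm a b f <= K%:E)%E ->
  forall s t, cube s -> cube t -> `|f s t| <=
    K * (`|s ord0 1 - s ord0 0| `^ a * `|t ord0 1 - t ord0 0| `^ b).
Proof.
move=> a0 b0 f0 fK s t cs ct.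
have rep (u : 'rV[R]_2) : u ord0 1 = u ord0 0 -> repeated u.
  by move=> uE; exists 0, 1; split.
set p := _ `^ a * _; have p0 : 0 <= p by rewrite mulr_ge0 ?powR_ge0.
have [pE|pn0] := eqVneq p 0.
  rewrite pE mulr0 normr_le0; apply/eqP/f0 => //.
  move: pE => /eqP; rewrite mulf_eq0 !powR_eq0 !normr_eq0 !subr_eq0.
  by move=> /orP[] /andP[/eqP/rep ? _]; [left|right].
rewrite -ler_pdivrMr ?lt_neqAle ?p0 1?eq_sym ?pn0// -lee_fin.
by apply: le_trans fK; apply: ereal_sup_ubound; exists s, t.
Qed.

Lemma Pholder_mat a b A K (f : incr R 2 2) : 0 < a -> 0 < b -> cont4 A ->
  (forall s1 s2 t1 t2, in01 s1 -> in01 s2 -> in01 t1 -> in01 t2 ->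
     `|A s1 s2 t1 t2| <= K * (`|s2 - s1| `^ a * `|t2 - t1| `^ b)) ->
  eq_cube f (mat A) -> Pholder a b f.
Proof.
move=> a0 b0 cA AK fA; split.
  apply: Pspace_mat cA _ fA => s1 s2 t1 t2 i1 i2 j1 j2 st.
  have := AK _ _ _ _ i1 i2 j1 j2.
  case: st => ->; rewrite subrr normr0 powR0 ?gt_eqF//.
    by rewrite mul0r mulr0 normr_le0 => /eqP.
  by rewrite !mulr0 normr_le0 => /eqP.
apply: le_lt_trans (holder_norm_le (K := `|K|) _ _) (ltry _) => // s t cs ct.
have [i1 i2] := cube2 cs; have [j1 j2] := cube2 ct.
rewrite fA//; apply: (le_trans (AK _ _ _ _ i1 i2 j1 j2)).
by rewrite ler_wpM2r ?mulr_ge0 ?powR_ge0// ler_norm.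
Qed.

Lemma Pholder_bound a b A (f : incr R 2 2) : 0 < a -> 0 < b -> Pholder a b f ->
  eq_cube f (mat A) -> exists K,
  (forall s1 s2 t1 t2, in01 s1 -> in01 s2 -> in01 t1 -> in01 t2 ->
     `|A s1 s2 t1 t2| <= K * (`|s2 - s1| `^ a * `|t2 - t1| `^ b)).
Proof.
move=> a0 b0 [[_ f0] fN] fA; exists (fine (holder_norm a b f)).
move=> s1 s2 t1 t2 i1 i2 j1 j2.
have ci := cube_pair i1 i2; have cj := cube_pair j1 j2.
have n0 : (0 <= holder_norm a b f)%E.
  apply: le_trans (ereal_sup_ubound _); last by exists (pair_rv s1 s2), (pair_rv t1 t2).
  by rewrite lee_fin divr_ge0// mulr_ge0 ?powR_ge0.
have := holder_norm_ge a0 b0 f0 (K := fine (holder_norm a b f)) _ ci cj.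
rewrite fineK ?ge0_fin_numE// lexx => /(_ isT).
by rewrite fA// /mat !pair_rvE.
Qed.

End Bridge.

(** * The germs of the two integrals *)

Section Germs.
Variable R : realType.
Implicit Types (A : R -> R -> R -> R -> R) (x y : R -> R -> R).

Lemma delta1_points l (g : incr R 1 l) s t : delta1 g s t =
  g (const_mx (s ord0 1)) t - g (const_mx (s ord0 0)) t.
Proof.
rewrite /delta1 !big_ord_recl big_ord0 addr0 /= /bump/=.
rewrite !(exprS, expr0, mulr1, mulN1r, mulrN, mul1r, opprK, mulNr).
have -> : col' ord0 s = const_mx (s ord0 1).
  by apply/rowP => -[[|//] lt_i]; rewrite !mxE/=; congr (s _ _); apply: val_inj.
have -> // : col' (lift ord0 ord0) s = const_mx (s ord0 0).
by apply/rowP => -[[|//] lt_i]; rewrite !mxE/=; congr (s _ _); apply: val_inj.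
Qed.

Lemma rect_mat x : rect x = mat (rect4 x).
Proof.
apply/funext => s; apply/funext => t.
rewrite /rect delta1_points /delta2 /flip !delta1_points /path_incr /flip.
by rewrite !mxE /mat /rect4; ring.
Qed.

Lemma row_inord2 (s : 'rV[R]_2) : \row_(i < 2) s ord0 (inord i) = s.
Proof. by apply/rowP => i; rewrite mxE inord_val. Qed.

Lemma x12hat_germ_mat x : x12hat_germ x = mat (xgerm x).
Proof.
apply/funext => s; apply/funext => t.
rewrite /x12hat_germ /Defs.glue /delta2 /flip !delta1_points /path_incr /flip.
rewrite !mxE /mat /xgerm.
by congr ((x (s ord0 _) (t ord0 _) - x (s ord0 _) (t ord0 _)) *
  (x (s ord0 _) (t ord0 _) - x (s ord0 _) (t ord0 _)));
  apply: val_inj; rewrite /= inordK.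
Qed.

Lemma glue_mat y (f : incr R 2 2) A : eq_cube f (mat A) ->
  eq_cube (Defs.glue (path_incr y) f : incr R 2 2) (mat (mulp y A)).
Proof.
move=> fA s t cs ct; rewrite /Defs.glue /path_incr !mxE /mat /mulp.
congr (y (s ord0 _) (t ord0 _) * _); try by apply: val_inj; rewrite /= inordK.
have -> : \row_(i < 2) s ord0 (inord (0 + i)) = s := row_inord2 s.
have -> : \row_(i < 2) t ord0 (inord (0 + i)) = t := row_inord2 t.
exact: fA.
Qed.

Lemma young_glue a1 a2 g1 g2 K C y A (f : incr R 2 2) :
  0 < a1 -> 0 < a2 -> 0 < g1 -> 0 < g2 -> 1 < a1 + g1 -> 1 < a2 + g2 ->
  hol2 a1 a2 K y -> bigerm a1 a2 g1 g2 C A -> cont4 A -> eq_cube f (mat A) ->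
  young_defined (Defs.glue (path_incr y) f : incr R 2 2) /\
  eq_cube (young (Defs.glue (path_incr y) f : incr R 2 2)) (mat (sew12 (mulp y A))).
Proof.
move=> a10 a20 g10 g20 m1 m2 hy gA cA fA.
apply: (young_mat a10 a20 g10 g20 m1 m2 (bigerm_mulp hy gA)).
  by apply: cont4_mulp cA; exact: hol2_cont hy.
exact: glue_mat.
Qed.

Section ClassC.
Variables (phi : R -> R) (n : nat).
Hypothesis Cphi : class_C n phi.

Lemma class_C_derive k u : (k < n)%N ->
  is_derive u (1 : R) (derive1n k phi) (derive1n k.+1 phi u).
Proof.
move=> kn; rewrite /= derive1E; apply: derivableP.
exact: (Cphi.1 k u kn).
Qed.

Lemma class_C_continuous k : (k <= n)%N -> continuous (derive1n k phi).
Proof.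
rewrite leq_eqVlt => /predU1P[->|kn]; first exact: Cphi.2.
move=> u; apply: differentiable_continuous.
by apply/derivable1_diffP; exact: (Cphi.1 k u kn).
Qed.

Lemma hol2_comp_path a1 a2 M k x : (k.+2 <= n)%N -> hol2 a1 a2 M x ->
  exists K, hol2 a1 a2 K (comp_path phi k x).
Proof.
move=> kn; apply: (hol2_comp (fun u => class_C_derive u (ltnW kn))
  (fun u => class_C_derive u kn)); apply: class_C_continuous => //.
exact: ltnW.
Qed.

Lemma hol2_comp_path_cvg a1 a2 M k e : (k.+2 <= n)%N -> 0 <= M -> 0 < e ->
  exists2 h, 0 < h & forall x x', hol2 a1 a2 M x -> hol2 a1 a2 M x' ->
    hol2 a1 a2 h (fun s t => x' s t - x s t) ->
    hol2 a1 a2 e (fun s t => comp_path phi k x' s t - comp_path phi k x s t).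
Proof.
move=> kn; apply: (hol2_comp_cvg (fun u => class_C_derive u (ltnW kn))
  (fun u => class_C_derive u kn)); apply: class_C_continuous => //.
exact: ltnW.
Qed.

End ClassC.

Lemma holder_norm_1d_le a (f : R -> R) (K : R) : 0 < a ->
  (holder_norm_1d a f <= K%:E)%E ->
  forall u v, in01 u -> in01 v -> `|f v - f u| <= K * `|v - u| `^ a.
Proof.
move=> a0 fK u v iu iv.
have [->|uv] := eqVneq u v; first by rewrite !subrr normr0 powR0 ?gt_eqF// mulr0.
rewrite -ler_pdivrMr ?powR_gt0 ?normr_gt0 ?subr_eq0 1?eq_sym// -lee_fin.
by apply: le_trans fK; apply: ereal_sup_ubound; exists u, v.
Qed.

Lemma holder_norm_1d_ge0 a (f : R -> R) : (0 <= holder_norm_1d a f)%E.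
Proof.
apply: le_trans (ereal_sup_ubound _); last by exists 0, 0; rewrite lexx ler01.
by rewrite lee_fin divr_ge0// powR_ge0.
Qed.

Lemma holder_norm_ge0 a b (f : incr R 2 2) : (0 <= holder_norm a b f)%E.
Proof.
have c0 := cube_pair (in010 R) (in010 R).
apply: le_trans (ereal_sup_ubound _); last by exists (pair_rv 0 0), (pair_rv 0 0).
by rewrite lee_fin divr_ge0// mulr_ge0 ?powR_ge0.
Qed.

Lemma le_fine_lty (z : \bar R) : (0 <= z)%E -> (z < +oo)%E -> (z <= (fine z)%:E)%E.
Proof. by move=> z0 zoo; rewrite fineK// ge0_fin_numE. Qed.

Lemma hol2_of_hyps (g1 g2 : R) x : 0 < g1 -> 0 < g2 ->
  Pholder g1 g2 (rect x) -> axes_holder g1 g2 x -> exists M, hol2 g1 g2 M x.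
Proof.
move=> g10 g20 hx [h1 h2].
have [K HK] := Pholder_bound g10 g20 hx (fun s t _ _ => congr1 (fun f => f s t) (rect_mat x)).
have H1 := holder_norm_1d_le g10 (le_fine_lty (holder_norm_1d_ge0 _ _) h1).
have H2 := holder_norm_1d_le g20 (le_fine_lty (holder_norm_1d_ge0 _ _) h2).
move: H1 H2; set K1 := fine _; set K2 := fine _ => H1 H2.
pose m := `|K| + `|K1| + `|K2| + `|x 0 0|.
have := (normr_ge0 K, normr_ge0 K1, normr_ge0 K2, normr_ge0 (x 0 0)) => -[[[? ?] ?] ?].
have := (ler_norm K, ler_norm K1, ler_norm K2) => -[[? ?] ?].
exists (4 * m); apply: (hol2_of_axes (ltW g10) (ltW g20)).
- move=> s1 s2 t1 t2 i1 i2 j1 j2; apply: (le_trans (HK _ _ _ _ i1 i2 j1 j2)).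
  by rewrite ler_wpM2r ?mulr_ge0 ?powR_ge0// /m; lra.
- move=> s1 s2 i1 i2; apply: (le_trans (H1 _ _ i1 i2)).
  by rewrite ler_wpM2r ?powR_ge0// /m; lra.
- move=> t1 t2 j1 j2; apply: (le_trans (H2 _ _ j1 j2)).
  by rewrite ler_wpM2r ?powR_ge0// /m; lra.
- by rewrite /m; lra.
Qed.

Lemma smooth_path_hol2 x : smooth_path x -> exists M, hol2 1 1 M x.
Proof.
move=> [X [sX XE]]; have [M hM] := smooth_hol2 sX; exists M.
by apply: hol2_eq hM => s t i j; exact: XE.
Qed.

Lemma bigerm_le a1 a2 g1 g2 K C A : K <= C -> bigerm a1 a2 g1 g2 K A ->
  bigerm a1 a2 g1 g2 C A.
Proof.
move=> KC gA; split=> *.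
- by apply: le_trans (bigerm_bound gA _ _ _ _) _ => //;
    rewrite ler_wpM2r ?mulr_ge0 ?powR_ge0.
- by apply: le_trans (bigerm_diff1 gA _ _ _ _ _) _ => //;
    rewrite ler_wpM2r ?mulr_ge0 ?powR_ge0.
- by apply: le_trans (bigerm_diff2 gA _ _ _ _ _) _ => //;
    rewrite ler_wpM2r ?mulr_ge0 ?powR_ge0.
- by apply: le_trans (bigerm_diff12 gA _ _ _ _ _ _) _ => //;
    rewrite ler_wpM2r ?mulr_ge0 ?powR_ge0.
Qed.

Lemma bigermD a1 a2 g1 g2 K C A B : bigerm a1 a2 g1 g2 K A ->
  bigerm a1 a2 g1 g2 C B ->
  bigerm a1 a2 g1 g2 (K + C) (fun s1 s2 t1 t2 => A s1 s2 t1 t2 + B s1 s2 t1 t2).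
Proof.
move=> gA gB.
have D (u v z p : R) : z = u + v -> `|u| <= K * p -> `|v| <= C * p ->
    `|z| <= (K + C) * p.
  by move=> -> h1 h2; apply: (le_trans (ler_normD _ _)); rewrite mulrDl lerD.
split.
- by move=> s1 s2 t1 t2 i1 i2 j1 j2;
    apply: D (bigerm_bound gA i1 i2 j1 j2) (bigerm_bound gB i1 i2 j1 j2).
- move=> s1 s2 s3 t1 t2 i1 i2 i3 j1 j2.
  apply: D (bigerm_diff1 gA i1 i2 i3 j1 j2) (bigerm_diff1 gB i1 i2 i3 j1 j2).
  by rewrite /diff1; ring.
- move=> s1 s2 t1 t2 t3 i1 i2 j1 j2 j3.
  apply: D (bigerm_diff2 gA i1 i2 j1 j2 j3) (bigerm_diff2 gB i1 i2 j1 j2 j3).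
  by rewrite /diff1 /swap; ring.
- move=> s1 s2 s3 t1 t2 t3 i1 i2 i3 j1 j2 j3.
  apply: D (bigerm_diff12 gA i1 i2 i3 j1 j2 j3) (bigerm_diff12 gB i1 i2 i3 j1 j2 j3).
  by rewrite /diff1; ring.
Qed.

Lemma bigerm_eq a1 a2 g1 g2 K A B : eq4 A B -> bigerm a1 a2 g1 g2 K A ->
  bigerm a1 a2 g1 g2 K B.
Proof.
move=> AB gA; split.
- by move=> s1 s2 t1 t2 *; rewrite -AB//; exact: (bigerm_bound gA).
- by move=> *; rewrite /diff1 -!AB//; exact: (bigerm_diff1 gA).
- by move=> *; rewrite /diff1 /swap -!AB//; exact: (bigerm_diff2 gA).
- by move=> *; rewrite /diff1 -!AB//; exact: (bigerm_diff12 gA).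
Qed.

Lemma hol2D a1 a2 K C x y : hol2 a1 a2 K x -> hol2 a1 a2 C y ->
  hol2 a1 a2 (K + C) (fun s t => x s t + y s t).
Proof.
move=> hx hy.
have D (u v z p : R) : z = u + v -> `|u| <= K * p -> `|v| <= C * p ->
    `|z| <= (K + C) * p.
  by move=> -> h1 h2; apply: (le_trans (ler_normD _ _)); rewrite mulrDl lerD.
split.
- move=> s t i j; apply: (le_trans (ler_normD _ _)).
  by rewrite lerD ?(hol2_sup hx) ?(hol2_sup hy).
- move=> s1 s2 t i1 i2 j; apply: D (hol2_1 hx i1 i2 j) (hol2_1 hy i1 i2 j); ring.
- move=> s t1 t2 i j1 j2; apply: D (hol2_2 hx i j1 j2) (hol2_2 hy i j1 j2); ring.
- move=> s1 s2 t1 t2 i1 i2 j1 j2.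
  by apply: D (hol2_12 hx i1 i2 j1 j2) (hol2_12 hy i1 i2 j1 j2); rewrite /rect4; ring.
Qed.

Definition bounded4 (g1 g2 K : R) A := forall s1 s2 t1 t2,
  in01 s1 -> in01 s2 -> in01 t1 -> in01 t2 ->
  `|A s1 s2 t1 t2| <= K * (`|s2 - s1| `^ g1 * `|t2 - t1| `^ g2).

Lemma biadditive_sub A B : biadditive A -> biadditive B ->
  biadditive (fun s1 s2 t1 t2 => A s1 s2 t1 t2 - B s1 s2 t1 t2).
Proof.
move=> [A1 A2] [B1 B2].
by split=> ? ? ? ?; [exact: additiveB (A1 _ _ _ _) (B1 _ _ _ _)
  |exact: additiveB (A2 _ _ _ _) (B2 _ _ _ _)].
Qed.

(** The difference of the two integrals is the integral of the germ
    (y' - y) A' + y (A' - A), whose constant is small. The constants [K']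
    and [C'] ensure that the integral exists, and [h] does not depend on them. *)
Lemma sew12_mulp_cvg a1 a2 g1 g2 K C y A e :
  0 < a1 -> 0 < a2 -> 0 < g1 -> 0 < g2 -> 1 < a1 + g1 -> 1 < a2 + g2 ->
  hol2 a1 a2 K y -> biadditive A -> bounded4 g1 g2 C A -> 0 < e ->
  exists2 h, 0 < h & forall K' C' y' A', hol2 a1 a2 K' y' -> biadditive A' ->
    bounded4 g1 g2 C' A' -> hol2 a1 a2 h (fun s t => y' s t - y s t) ->
    bounded4 g1 g2 h (fun s1 s2 t1 t2 => A' s1 s2 t1 t2 - A s1 s2 t1 t2) ->
    bounded4 g1 g2 e (fun s1 s2 t1 t2 =>
      sew12 (mulp y' A') s1 s2 t1 t2 - sew12 (mulp y A) s1 s2 t1 t2).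
Proof.
move=> a10 a20 g10 g20 m1 m2 hy bA AC e0.
have gA : bigerm a1 a2 g1 g2 C A by exact: biadditive_bigerm.
have K0 := hol2_ge0 hy; have C0 := bigerm_ge0 gA.
set c1 := sew_cst (a1 + g1); set c2 := sew_cst (a2 + g2).
have c10 : 0 <= c1 by exact: sew_cst_ge0.
have c20 : 0 <= c2 by exact: sew_cst_ge0.
pose k := (1 + c1) * (1 + c2) * (4 * (C + 1) + 4 * K).
have k0 : 0 < k.
  rewrite /k; clearbody c1 c2.
  by rewrite !mulr_gt0//; lra.
pose h := Num.min 1 (e / k).
have h0 : 0 < h by rewrite lt_min ltr01 divr_gt0.
have h1 : h <= 1 by rewrite ge_min lexx.
have hk : h * k <= e by rewrite -ler_pdivlMr// ge_min lexx orbT.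
exists h => // K' C' y' A' hy' bA' AC' hd Ad.
have gA' : bigerm a1 a2 g1 g2 C' A' by exact: biadditive_bigerm.
have gA1 : bigerm a1 a2 g1 g2 (C + 1) A'.
  apply: biadditive_bigerm => // s1 s2 t1 t2 i1 i2 j1 j2.
  rewrite -(subrK (A s1 s2 t1 t2) (A' s1 s2 t1 t2)).
  apply: (le_trans (ler_normD _ _)).
  apply: (le_trans (lerD (Ad _ _ _ _ i1 i2 j1 j2) (AC _ _ _ _ i1 i2 j1 j2))).
  by rewrite -mulrDl addrC ler_wpM2r ?mulr_ge0 ?powR_ge0// lerD2l.
have gAd : bigerm a1 a2 g1 g2 h
    (fun s1 s2 t1 t2 => A' s1 s2 t1 t2 - A s1 s2 t1 t2).
  by apply: biadditive_bigerm => //; exact: biadditive_sub.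
pose D s1 s2 t1 t2 := mulp y' A' s1 s2 t1 t2 - mulp y A s1 s2 t1 t2.
have gD : bigerm a1 a2 g1 g2 (4 * (h * (C + 1)) + 4 * (K * h)) D.
  apply: bigerm_eq (bigermD (bigerm_mulp hd gA1) (bigerm_mulp hy gAd)).
  by move=> s1 s2 t1 t2 _ _ _ _; rewrite /D /mulp; ring.
have DE := sew12_sub a10 a20 g10 g20 m1 m2 (bigerm_mulp hy' gA') (bigerm_mulp hy gA)
  (fun _ _ _ _ _ _ _ _ => erefl).
move=> s1 s2 t1 t2 i1 i2 j1 j2; rewrite -(DE s1 s2 t1 t2)//.
apply: (le_trans (sew12_bound a10 a20 g10 g20 m1 m2 gD i1 i2 j1 j2)).
rewrite ler_wpM2r ?mulr_ge0 ?powR_ge0//; apply: le_trans hk.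
by rewrite -/c1 -/c2 /k; apply: eq_imp_le; clearbody c1 c2; ring.
Qed.

End Germs.

(** * Riemann sums *)

Section Partitions.
Variable R : realType.
Implicit Types (A : R -> R -> R -> R -> R) (x y : R -> R -> R) (p q : seq R).

Section Nodes.
Variables (a b : R) (p : seq R).
Hypotheses (abp : itv_partition a b p) (a0 : 0 <= a) (b1 : b <= 1).

Lemma node0 : node a p 0 = a. Proof. by []. Qed.

Lemma node_size : node a p (size p) = b.
Proof.
case: abp => _ /eqP <-; rewrite /node (last_nth a).
by apply: set_nth_default.
Qed.

Lemma node_lt i : (i < size p)%N -> node a p i < node a p i.+1.
Proof. by case: abp => /(pathP 0) H _; exact: H. Qed.

Lemma node_le i j : (i <= j <= size p)%N -> node a p i <= node a p j.
Proof.
elim: j => [|j IH] /andP[ij js]; first by move: ij; rewrite leqn0 => /eqP->.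
move: ij; rewrite leq_eqVlt => /predU1P[->//|ij].
by apply: le_trans (ltW (node_lt js)); apply: IH; rewrite -ltnS ij ltnW.
Qed.

Lemma node_in01 i : (i <= size p)%N -> in01 (node a p i).
Proof.
move=> ip; have h1 : node a p 0 <= node a p i by apply: node_le.
have h2 : node a p i <= node a p (size p) by apply: node_le; rewrite ip leqnn.
rewrite node_size in h2; rewrite node0 in h1.
by rewrite /in01 (le_trans a0 h1) (le_trans h2 b1).
Qed.

Lemma node_mesh i : (i < size p)%N ->
  0 <= node a p i.+1 - node a p i <= mesh a p.
Proof.
move=> ip; rewrite subr_ge0 ltW ?node_lt//= /mesh.
exact: (@le_bigmax _ _ _ 0 (fun i : 'I_(size p) => node a p i.+1 - node a p i) (Ordinal ip)).
Qed.

Lemma mesh01 : 0 <= mesh a p <= 1.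
Proof.
rewrite /mesh bigmax_ge_id/=; apply: bigmax_le => // i _.
have /andP[? ?] := node_in01 (ltn_ord i).
by have /andP[? ?] := node_in01 (ltnW (ltn_ord i)); lra.
Qed.

End Nodes.

Lemma tagged_sum_nat y (m : incr R 2 2) A (s1 t1 : R) p q xi eta :
  (forall i j, (i < size p)%N -> (j < size q)%N ->
     m (cell s1 p i) (cell t1 q j) =
     A (node s1 p i) (node s1 p i.+1) (node t1 q j) (node t1 q j.+1)) ->
  tagged_sum y m s1 t1 p q xi eta =
  \sum_(0 <= i < size p) \sum_(0 <= j < size q) y (xi i j) (eta i j) *
    A (node s1 p i) (node s1 p i.+1) (node t1 q j) (node t1 q j.+1).
Proof.
move=> mA; rewrite /tagged_sum big_mkord; apply: eq_bigr => i _.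
by rewrite big_mkord; apply: eq_bigr => j _; rewrite mA.
Qed.

Lemma cell_mat (m : incr R 2 2) A (s1 s2 t1 t2 : R) p q :
  eq_cube m (mat A) -> 0 <= s1 -> s2 <= 1 -> 0 <= t1 -> t2 <= 1 ->
  itv_partition s1 s2 p -> itv_partition t1 t2 q ->
  forall i j, (i < size p)%N -> (j < size q)%N ->
     m (cell s1 p i) (cell t1 q j) =
     A (node s1 p i) (node s1 p i.+1) (node t1 q j) (node t1 q j.+1).
Proof.
move=> /eq_cube_pair mA s0 s1' t0 t1' sp tq i j ip jq.
by rewrite /cell mA//; apply: node_in01; eauto => //; rewrite ltnW.
Qed.

(** The sums are sums of the germ [mulp y A] over the cells of a grid. *)
Lemma left_sum_cvg a1 a2 g1 g2 K y A (m : incr R 2 2) (s1 s2 t1 t2 : R)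
    (pi1 pi2 : nat -> seq R) :
  0 < a1 -> 0 < a2 -> 0 < g1 -> 0 < g2 -> 1 < a1 + g1 -> 1 < a2 + g2 ->
  bigerm a1 a2 g1 g2 K (mulp y A) -> eq_cube m (mat A) ->
  0 <= s1 -> s2 <= 1 -> 0 <= t1 -> t2 <= 1 ->
  (forall n, itv_partition s1 s2 (pi1 n)) ->
  (forall n, itv_partition t1 t2 (pi2 n)) ->
  mesh s1 (pi1 n) @[n --> \oo] --> (0 : R) ->
  mesh t1 (pi2 n) @[n --> \oo] --> (0 : R) ->
  left_sum y m s1 t1 (pi1 n) (pi2 n) @[n --> \oo]
    --> sew12 (mulp y A) s1 s2 t1 t2.
Proof.
move=> a10 a20 g10 g20 m1 m2 gA mA s0 s1' t0 t1' P1 P2 M1 M2.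
have K0 := bigerm_ge0 gA.
set c1 := sew_cst (a1 + g1); set c2 := sew_cst (a2 + g2).
have c10 : 0 <= c1 by exact: sew_cst_ge0.
have c20 : 0 <= c2 by exact: sew_cst_ge0.
pose C1 := c1 * ((1 + c2) * K); pose C2 := (1 + c1 *+ 2) * (c2 * K).
have C10 : 0 <= C1.
  by rewrite /C1; clearbody c1 c2; rewrite !mulr_ge0// addr_ge0.
have C20 : 0 <= C2.
  by rewrite /C2; clearbody c1 c2; rewrite !mulr_ge0// addr_ge0// mulrn_wge0.
apply/cvgrPdist_lt => e e0; have e20 : 0 < e / 2 by rewrite divr_gt0.
have n1 : 0 < a1 + g1 - 1 by rewrite subr_gt0.
have n2 : 0 < a2 + g2 - 1 by rewrite subr_gt0.
have [d1 d10 H1] := small_powR0 n1 C10 e20.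
have [d2 d20 H2] := small_powR0 n2 C20 e20.
move/cvgrPdist_lt : M1 => /(_ _ d10) M1; move/cvgrPdist_lt : M2 => /(_ _ d20) M2.
apply: filterS2 M1 M2 => n; rewrite !sub0r !normrN => M1 M2.
have m1n := mesh01 (P1 n) s0 s1'; have m2n := mesh01 (P2 n) t0 t1'.
have G := grid_sum_dist a10 a20 g10 g20 m1 m2 gA m1n
  (node_in01 (P1 n) s0 s1') (node_in01 (P2 n) t0 t1')
  (node_mesh (P1 n)) (node_mesh (P2 n)).
rewrite (node_size (P1 n)) (node_size (P2 n)) !node0 in G.
rewrite /left_sum (tagged_sum_nat _ _ _ (cell_mat mA s0 s1' t0 t1' (P1 n) (P2 n))).
rewrite distrC; apply: (le_lt_trans G).
have /andP[m10 _] := m1n; have /andP[m20 _] := m2n.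
rewrite !ger0_norm// in M1 M2.
rewrite [ltRHS](splitr e); apply: ltrD.
  by apply: H2; rewrite m20.
by apply: H1; rewrite m10.
Qed.

Lemma grid_total A u v n m : biadditive A ->
  (forall i, (i <= n)%N -> in01 (u i)) -> (forall j, (j <= m)%N -> in01 (v j)) ->
  A (u 0%N) (u n) (v 0%N) (v m) = grid_sum A u v n m.
Proof.
move=> [A1 A2] u01 v01.
rewrite (additive_sum (A1 _ _ (v01 0%N (leq0n _)) (v01 m (leqnn _))) u01).
apply: eq_big_nat => i /andP[_ ni].
by rewrite (additive_sum (A2 _ _ (u01 _ (ltnW ni)) (u01 _ ni)) v01).
Qed.

(** With Lipschitz regularity in both directions the error of the Young integral
    on a cell is small with respect to its area, and so is the error made by
    moving the tag to the lower left corner. *)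
Lemma RS_integral K y A (m : incr R 2 2) (s1 s2 t1 t2 : R) :
  cont2 y -> bigerm 1 1 1 1 K A -> bigerm 1 1 1 1 K (mulp y A) ->
  eq_cube m (mat A) ->
  0 <= s1 -> s1 <= s2 -> s2 <= 1 -> 0 <= t1 -> t1 <= t2 -> t2 <= 1 ->
  is_RS_integral y m s1 s2 t1 t2 (sew12 (mulp y A) s1 s2 t1 t2).
Proof.
move=> cy gA gyA mA s0 ss s1' t0 tt t1' e e0.
have K0 := bigerm_ge0 gA.
have k0 : 0 < e / 4 / (K + 1) by rewrite !divr_gt0// ltr_wpDl.
have [d d0 H] := square_unif_continuous 1 cy k0.
have [C C0 HC] := sew12_close_lip gyA.
pose r := e / 8 / (C + 1); have C1 : 0 < C + 1 by rewrite ltr_wpDl.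
have r0 : 0 < r by rewrite !divr_gt0.
exists (Num.min d r); first by rewrite lt_min d0.
move=> p q xi eta sp tq; rewrite !lt_min => /andP[md mr] /andP[nd nr] tags.
have u01 := node_in01 sp s0 s1'; have v01 := node_in01 tq t0 t1'.
have bZ : biadditive (sew12 (mulp y A)).
  have o : 0 < 1 :> R by []. have t11 : 1 < 1 + 1 :> R by lra.
  exact: (sew12_biadditive o o o o t11 t11 gyA).
rewrite (tagged_sum_nat _ _ _ (cell_mat mA s0 s1' t0 t1' sp tq)).
have := grid_total bZ u01 v01; rewrite (node_size sp) (node_size tq) !node0 => ->.
have bP : biadditive (fun s s' t t' : R => e / 2 * ((s' - s) * (t' - t))).
  by split=> ? ? ? ? ? ? ? ? ? ?; ring.
rewrite /grid_sum -sumrB.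
apply: (@le_lt_trans _ _ (e / 2 * ((s2 - s1) * (t2 - t1)))); last first.
  have : (s2 - s1) * (t2 - t1) <= 1.
    by apply: mulr_ile1; lra.
  by move=> /(ler_wpM2l (ltW (divr_gt0 e0 (ltr0n _ 2)))); rewrite mulr1; lra.
have := grid_total bP u01 v01; rewrite (node_size sp) (node_size tq) !node0 => ->.
apply: (le_trans (ler_norm_sum _ _ _)); apply: ler_sum_nat => i /andP[_ ip].
rewrite -sumrB; apply: (le_trans (ler_norm_sum _ _ _)).
apply: ler_sum_nat => j /andP[_ jq].
have [/andP[x1 x2] /andP[y1 y2]] := tags i j ip jq.
have i1 := u01 _ (ltnW ip); have i2 := u01 _ ip.
have j1 := v01 _ (ltnW jq); have j2 := v01 _ jq.
have /andP[p0 pm] := node_mesh sp ip; have /andP[q0 qm] := node_mesh tq jq.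
move: x1 x2 y1 y2 i1 i2 j1 j2 p0 pm q0 qm.
set u := node s1 p i; set u' := node s1 p i.+1.
set v := node t1 q j; set v' := node t1 q j.+1.
set x := xi i j; set z := eta i j => x1 x2 y1 y2 i1 i2 j1 j2 p0 pm q0 qm.
have ix : in01 x by move: i1 i2; rewrite /in01; lra.
have iz : in01 z by move: j1 j2; rewrite /in01; lra.
have yd : `|y x z - y u v| <= e / 4 / (K + 1).
  have n1 (w : R) : in01 w -> `|w| <= 1.
    by move=> /andP[? ?]; rewrite ler_norml; lra.
  have := H u v x z (n1 _ i1) (n1 _ j1).
  rewrite /= !clamp_id// => h; apply/ltW/h.
    by rewrite ger0_norm; lra.
  by rewrite ger0_norm; lra.
have h1 := norm_mul_le yd (bigerm_bound gA i1 i2 j1 j2).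
have h2 := HC _ _ _ _ i1 i2 j1 j2.
rewrite !powRr1// (ger0_norm p0) (ger0_norm q0) in h1 h2.
have P0 : 0 <= (u' - u) * (v' - v) by exact: mulr_ge0.
have E1 : e / 4 / (K + 1) * (K * ((u' - u) * (v' - v))) <= e / 4 * ((u' - u) * (v' - v)).
  rewrite mulrA ler_wpM2r//.
  set k := e / 4 / (K + 1) in k0 *.
  have kE : k * (K + 1) = e / 4 by rewrite /k divfK// gt_eqF// ltr_wpDl.
  by clearbody k; lra.
have E2 : C * ((u' - u) + (v' - v)) * ((u' - u) * (v' - v)) <= e / 4 * ((u' - u) * (v' - v)).
  rewrite ler_wpM2r//.
  have : C * ((u' - u) + (v' - v)) <= (C + 1) * (r + r).
    by apply: ler_pM => //; [exact: addr_ge0|lra|lra].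
  move=> /le_trans; apply; rewrite /r; apply: eq_imp_le; field.
  by rewrite gt_eqF.
have -> : y x z * A u u' v v' - sew12 (mulp y A) u u' v v' =
  (y x z - y u v) * A u u' v v' + (mulp y A u u' v v' - sew12 (mulp y A) u u' v v').
  by rewrite /mulp; ring.
apply: (le_trans (ler_normD _ _)).
apply: (le_trans (lerD (le_trans h1 E1) (le_trans h2 E2))).
by apply: eq_imp_le; field.
Qed.

(** * Convergence in Hoelder norm *)

Section HolderConvergence.
Variables (a b : R).
Hypotheses (a0 : 0 < a) (b0 : 0 < b).

Lemma cvge0_le (N : nat -> \bar R) : (forall n, (0 <= N n)%E) ->
  (N n @[n --> \oo] --> 0%E <->
   forall e : R, 0 < e -> \forall n \near \oo, (N n <= e%:E)%E).
Proof.
move=> N0; split=> [/fine_cvgP[Nfin /cvgrPdist_lt Nc] e e0|H].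
  have := Nc _ e0; apply: filterS2 Nfin => n fn.
  rewrite sub0r normrN => nn; rewrite -[N n]fineK// lee_fin.
  by apply: ltW; apply: le_lt_trans nn; exact: ler_norm.
apply/fine_cvgP; split.
  have := H 1 ltr01; apply: filterS => n Nn.
  by rewrite ge0_fin_numE//; apply: le_lt_trans Nn (ltry _).
apply/cvgrPdist_lt => e e0; have e20 : 0 < e / 2 by rewrite divr_gt0.
have := H _ e20; apply: filterS => n Nn; rewrite sub0r normrN.
rewrite ger0_norm ?fine_ge0//.
have fN : N n \is a fin_num by rewrite ge0_fin_numE//; apply: le_lt_trans Nn (ltry _).
by move: Nn; rewrite -[N n]fineK// lee_fin/=; lra.
Qed.

Lemma cvg_Pholder_mat (fn : nat -> incr R 2 2) (f : incr R 2 2)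
    (An : nat -> R -> R -> R -> R -> R) A :
  (forall n, eq_cube (fn n) (mat (An n))) -> eq_cube f (mat A) ->
  (forall n, cont4 (An n) /\ exists K, bounded4 a b K (An n)) ->
  cont4 A -> (exists K, bounded4 a b K A) ->
  (forall e, 0 < e -> \forall n \near \oo, bounded4 a b e
     (fun s1 s2 t1 t2 => An n s1 s2 t1 t2 - A s1 s2 t1 t2)) ->
  cvg_Pholder a b fn f.
Proof.
move=> fA fA' An4 cA [K HK] Ac; split.
- by move=> n; have [cAn [C HC]] := An4 n; exact: (Pholder_mat a0 b0 cAn HC).
- exact: (Pholder_mat a0 b0 cA HK).
- apply/cvge0_le => [n|e e0]; first exact: holder_norm_ge0.
  have := Ac _ e0; apply: filterS => n Hn.
  apply: (holder_norm_le (ltW e0)) => s t cs ct.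
  have [i1 i2] := cube2 cs; have [j1 j2] := cube2 ct.
  by rewrite /incr_sub fA// fA'// /mat; exact: Hn.
Qed.

Lemma cvg_Pholder_bounded (fn : nat -> incr R 2 2) (f : incr R 2 2)
    (An : nat -> R -> R -> R -> R -> R) A :
  (forall n, eq_cube (fn n) (mat (An n))) -> eq_cube f (mat A) ->
  cvg_Pholder a b fn f ->
  (forall n, exists K, bounded4 a b K (An n)) /\
  (forall e, 0 < e -> \forall n \near \oo, bounded4 a b e
     (fun s1 s2 t1 t2 => An n s1 s2 t1 t2 - A s1 s2 t1 t2)).
Proof.
move=> fA fA' [Pn P c]; split=> [n|e e0].
  exact: (Pholder_bound a0 b0 (Pn n) (fA n)).
have N0 n := holder_norm_ge0 a b (incr_sub (fn n) f).
have := (cvge0_le N0).1 c e e0; apply: filterS => n Hn.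
move=> s1 s2 t1 t2 i1 i2 j1 j2.
have ci := cube_pair i1 i2; have cj := cube_pair j1 j2.
have f0 s t : cube s -> cube t -> repeated s \/ repeated t ->
    incr_sub (fn n) f s t = 0.
  move=> cs ct rst; rewrite /incr_sub (P.1.2 _ _ cs ct rst).
  by rewrite ((Pn n).1.2 _ _ cs ct rst) subrr.
have := holder_norm_ge a0 b0 f0 Hn ci cj.
by rewrite /incr_sub fA// fA'// /mat !pair_rvE.
Qed.

End HolderConvergence.

End Partitions.

(** * The two Young integrals of a path *)

Section Paths.
Variable R : realType.
Implicit Types (A : R -> R -> R -> R -> R) (x y : R -> R -> R).

Section RegularSum.
Variables (a1 a2 K : R) (A : R -> R -> R -> R -> R) (f z : incr R 2 2).
Hypotheses (m1 : 1 < a1 + a1) (m2 : 1 < a2 + a2).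
Hypotheses (gA : bigerm a1 a2 a1 a2 K A) (cA : cont4 A).
Hypotheses (fA : eq_cube f (mat A)) (zA : eq_cube z (mat (sew12 A))).

(** Each of the two sewings contributes one term, of double regularity in the
    direction of that sewing. *)
Lemma regular_sum_sew12 : exists2 rho, eq_cube z (incr_add f rho) &
  regular_sum a1 a2 rho.
Proof.
have a10 : 0 < a1 by move: m1; lra.
have a20 : 0 < a2 by move: m2; lra.
exists (mat (fun s1 s2 t1 t2 => sew12 A s1 s2 t1 t2 - A s1 s2 t1 t2)).
  by move=> s t cs ct; rewrite zA// /incr_add fA// /mat; ring.
pose r1 s1 s2 t1 t2 := sew12 A s1 s2 t1 t2 - sew2 A s1 s2 t1 t2.
pose r2 s1 s2 t1 t2 := sew2 A s1 s2 t1 t2 - A s1 s2 t1 t2.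
have c2 := sew2_cont a20 a10 a20 m2 gA cA.
have c12 := sew12_cont a10 a20 a10 a20 m1 m2 gA cA.
exists 2%N, (fun i => if i == 0 then mat r1 else mat r2); split.
  move=> i; case: ifP => _; [left|right].
  - apply: (Pholder_mat _ a20 (cont4B c12 c2) _ (fun _ _ _ _ => erefl)).
      by rewrite mulr_gt0.
    move=> s1 s2 t1 t2 i1 i2 j1 j2; rewrite distrC mulr_natl mulr2n.
    exact: (sew12_dist a10 a20 a10 a20 m1 m2 gA).
  - apply: (Pholder_mat a10 _ (cont4B c2 cA) _ (fun _ _ _ _ => erefl)).
      by rewrite mulr_gt0.
    move=> s1 s2 t1 t2 i1 i2 j1 j2; rewrite distrC mulr_natl mulr2n.
    exact: (sew2_dist a20 a20 m2 gA).
move=> s t cs ct; rewrite big_ord_recl big_ord1 /= /mat /r1 /r2; ring.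
Qed.

End RegularSum.

Lemma x12hat_mat a1 a2 M x : 1 < a1 + a1 -> 1 < a2 + a2 -> hol2 a1 a2 M x ->
  young_defined (x12hat_germ x) /\ eq_cube (x12hat x) (mat (sew12 (xgerm x))).
Proof.
move=> m1 m2 hx; have a10 : 0 < a1 by lra.
have a20 : 0 < a2 by lra.
apply: (young_mat a10 a20 a10 a20 m1 m2 (xgerm_bigerm hx)).
  by apply: cont4_xgerm; exact: hol2_cont hx.
by move=> s t _ _; rewrite x12hat_germ_mat.
Qed.

(** The integrands are compared with the exponents min(g, 1), as smooth paths need
    not be Hoelder of exponent more than 1. The sums of the exponents of integrand
    and integrator still exceed 1. *)
Lemma young_glue_cvg (g1 g2 M : R) (phi : R -> R) k
    (xn : nat -> R -> R -> R) x (mn : nat -> incr R 2 2) (m : incr R 2 2)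
    (An : nat -> R -> R -> R -> R -> R) A :
  1 / 2 < g1 -> 1 / 2 < g2 -> class_C 4 phi -> (k <= 2)%N ->
  hol2 g1 g2 M x -> (forall n, exists K, hol2 1 1 K (xn n)) ->
  (forall e, 0 < e -> \forall n \near \oo,
     hol2 g1 g2 e (fun s t => xn n s t - x s t)) ->
  (forall n, biadditive (An n) /\ cont4 (An n)) -> biadditive A -> cont4 A ->
  (forall n, eq_cube (mn n) (mat (An n))) -> eq_cube m (mat A) ->
  cvg_Pholder g1 g2 mn m ->
  cvg_Pholder g1 g2
    (fun n => young (Defs.glue (path_incr (comp_path phi k (xn n))) (mn n) : incr R 2 2))
    (young (Defs.glue (path_incr (comp_path phi k x)) m : incr R 2 2)).
Proof.
move=> h1 h2 Cphi k2 hx hxn xc bAn bA cA mAn mA mc.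
have g10 : 0 < g1 by lra.
have g20 : 0 < g2 by lra.
pose a1 := Num.min g1 1; pose a2 := Num.min g2 1.
have a10 : 0 < a1 by rewrite lt_min g10 ltr01.
have a20 : 0 < a2 by rewrite lt_min g20 ltr01.
have a1g : 0 < a1 <= g1 by rewrite a10 ge_min lexx.
have a2g : 0 < a2 <= g2 by rewrite a20 ge_min lexx.
have a11 : 0 < a1 <= 1 by rewrite a10 ge_min lexx orbT.
have a21 : 0 < a2 <= 1 by rewrite a20 ge_min lexx orbT.
have m1 : 1 < a1 + g1 by rewrite /a1; case: (leP g1 1) => ?; lra.
have m2 : 1 < a2 + g2 by rewrite /a2; case: (leP g2 1) => ?; lra.
have k4 : (k.+2 <= 4)%N by [].
have [Abn Ac] := cvg_Pholder_bounded g10 g20 mAn mA mc.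
have [_ Pm _] := mc; have [C AC] := Pholder_bound g10 g20 Pm mA.
have hxa := hol2_exp a1g a2g hx; have M0 := hol2_ge0 hx.
have [K hy] := hol2_comp_path Cphi k4 hxa.
have hyn n : exists K, hol2 a1 a2 K (comp_path phi k (xn n)).
  have [Kn hn] := hxn n.
  exact: (hol2_comp_path Cphi k4 (hol2_exp a11 a21 hn)).
have gAn n : exists K, bigerm a1 a2 g1 g2 K (An n).
  by have [Kn HKn] := Abn n; exists Kn; apply: biadditive_bigerm; case: (bAn n).
have gA : bigerm a1 a2 g1 g2 C A by exact: biadditive_bigerm.
have cy := hol2_cont a10 a20 hy.
apply: (cvg_Pholder_mat g10 g20
  (An := fun n => sew12 (mulp (comp_path phi k (xn n)) (An n)))
  (A := sew12 (mulp (comp_path phi k x) A))).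
- move=> n; have [Kn hn] := hyn n; have [Cn gn] := gAn n.
  exact: (young_glue a10 a20 g10 g20 m1 m2 hn gn (bAn n).2 (mAn n)).2.
- exact: (young_glue a10 a20 g10 g20 m1 m2 hy gA cA mA).2.
- move=> n; have [Kn hn] := hyn n; have [Cn gn] := gAn n.
  have gyn := bigerm_mulp hn gn; split.
    apply: (sew12_cont a10 a20 g10 g20 m1 m2 gyn).
    by apply: cont4_mulp (bAn n).2; exact: hol2_cont hn.
  by eexists=> s1 s2 t1 t2; exact: (sew12_bound a10 a20 g10 g20 m1 m2 gyn).
- apply: (sew12_cont a10 a20 g10 g20 m1 m2 (bigerm_mulp hy gA)).
  exact: cont4_mulp.
- by eexists=> s1 s2 t1 t2; exact: (sew12_bound a10 a20 g10 g20 m1 m2 (bigerm_mulp hy gA)).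
move=> e e0.
have [h h0 H] := sew12_mulp_cvg a10 a20 g10 g20 m1 m2 hy bA AC e0.
have M10 : 0 <= M + 1 by rewrite addr_ge0.
have [d d0 D] := hol2_comp_path_cvg Cphi a1 a2 k4 M10 h0.
have d10 : 0 < Num.min d 1 by rewrite lt_min d0 ltr01.
have := xc _ d10; have := Ac _ h0; apply: filterS2 => n An_near xn_near.
have [Kn hn] := hyn n; have [Cn HCn] := Abn n.
apply: (H Kn Cn) => //; first exact: (bAn n).1.
have xna := hol2_exp a1g a2g xn_near.
apply: D.
- by apply: hol2_le hxa; rewrite lerDl.
- have mM : M + Num.min d 1 <= M + 1 by rewrite lerD2l ge_min lexx orbT.
  apply: hol2_eq (hol2_le mM (hol2D hxa xna)) => s t _ _.
  by rewrite addrC subrK.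
- by apply: hol2_le xna; rewrite ge_min lexx.
Qed.

(** Convergence of the rectangular increments, together with that on the axes, is
    convergence of the paths. *)
Lemma path_cvg (g1 g2 : R) (xn : nat -> R -> R -> R) x : 0 < g1 -> 0 < g2 ->
  cvg_Pholder g1 g2 (fun n => x12 (xn n)) (x12 x) -> axes_cvg g1 g2 xn x ->
  forall e, 0 < e -> \forall n \near \oo,
     hol2 g1 g2 e (fun s t => xn n s t - x s t).
Proof.
move=> g10 g20 rc [oc c1 c2] e e0; have e40 : 0 < e / 4 by rewrite divr_gt0.
have [_ Rc] := cvg_Pholder_bounded g10 g20
  (fun n s t _ _ => congr1 (fun f => f s t) (rect_mat (xn n)))
  (fun s t _ _ => congr1 (fun f => f s t) (rect_mat x)) rc.
have C1 := (cvge0_le (fun n => holder_norm_1d_ge0 g1 (fun s => xn n s 0 - x s 0))).1 c1 _ e40.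
have C2 := (cvge0_le (fun n => holder_norm_1d_ge0 g2 (fun t => xn n 0 t - x 0 t))).1 c2 _ e40.
move/cvgrPdist_lt : oc => /(_ _ e40) O.
have := Rc _ e40; apply: filterS2 (filterI O (filterI C1 C2)) => n [On [D1 D2]] Rn.
have -> : e = 4 * (e / 4) by field.
apply: (hol2_of_axes (ltW g10) (ltW g20)).
- move=> s1 s2 t1 t2 i1 i2 j1 j2.
  have -> : rect4 (fun s t => xn n s t - x s t) s1 s2 t1 t2 =
    rect4 (xn n) s1 s2 t1 t2 - rect4 x s1 s2 t1 t2 by rewrite /rect4; ring.
  exact: Rn.
- by move=> s1 s2 i1 i2; exact: (holder_norm_1d_le g10 D1).
- by move=> t1 t2 j1 j2; exact: (holder_norm_1d_le g20 D2).
- by rewrite distrC ltW.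
Qed.

Section SmoothPath.
Variables (x X : R -> R -> R) (phi : R -> R).
Hypotheses (xX : smooth_extension x X) (Cphi : class_C 4 phi).

Let sX : smooth X := xX.1.
Let XE s t : in01 s -> in01 t -> X s t = x s t := @xX.2 s t.
Let m11 : 1 < 1 + 1 :> R. Proof. lra. Qed.
Let o : 0 < 1 :> R. Proof. exact: ltr01. Qed.

Let hx : exists M, hol2 1 1 M x.
Proof. by apply: smooth_path_hol2; exists X. Qed.

Let smooth_cont w : cont2 (partials w X).
Proof.
move=> p; apply: (@continuous_comp _ _ _ (fun p : R * R => (clamp p.1, clamp p.2))
  (fun q : R * R => partials w X q.1 q.2) p); last exact: (sX w).1.
apply: (@continuous_pair _ _ _ (fun p : R * R => clamp p.1) (fun p : R * R => clamp p.2)).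
  by move=> q; apply: (continuous_comp (@fst_cont _ _ q)); exact: clamp_continuous.
by move=> q; apply: (continuous_comp (@snd_cont _ _ q)); exact: clamp_continuous.
Qed.

Let cont2M y z : cont2 y -> cont2 z -> cont2 (fun s t => y s t * z s t).
Proof. by move=> cy cz p; apply: continuousM; [exact: cy|exact: cz]. Qed.

Let density_eq A B rho : eq4 A B -> has_density A rho -> has_density B rho.
Proof.
move=> AB dA e e0; have [d d0 H] := dA e e0; exists d => // *.
by rewrite -AB//; exact: H.
Qed.

Let dX12 : has_density (rect4 x) (partial1 (partial2 X)).
Proof.
by apply: density_eq (rect4_density sX) => s1 s2 t1 t2 *; rewrite /rect4 !XE.
Qed.

Let dX12h : has_density (sew12 (xgerm x)) (fun s t => partial1 X s t * partial2 X s t).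
Proof.
have [M hM] := hx; apply: sew12_density (xgerm_bigerm hM) _.
by apply: density_eq (xgerm_density sX) => s1 s2 t1 t2 *; rewrite /xgerm !XE.
Qed.

Let dint_mat (f : incr R 2 2) A rho : eq_cube f (mat A) -> biadditive A ->
  has_density A rho -> cont2 rho -> eq_cube f (double_int rho).
Proof.
move=> fA bA dA cr; apply: eq_cube_trans fA _ => s t cs ct.
have [i1 i2] := cube2 cs; have [j1 j2] := cube2 ct.
exact: (density_unique bA (dint_biadditive cr) dA (dint_density cr)).
Qed.

(** With [k] = 1 and the rectangular increment, or [k] = 2 and the Young integral
    of (d1 x)(d2 x), both integrals fall under this statement. *)
Let integrator k (m : incr R 2 2) A C rho : (k <= 2)%N -> eq_cube m (mat A) ->
  bigerm 1 1 1 1 C A -> cont4 A -> has_density A rho -> cont2 rho ->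
  eq_cube (young (Defs.glue (path_incr (comp_path phi k x)) m : incr R 2 2))
    (double_int (fun s t => comp_path phi k x s t * rho s t)) /\
  forall s1 s2 t1 t2 : R, 0 <= s1 -> s1 <= s2 -> s2 <= 1 ->
    0 <= t1 -> t1 <= t2 -> t2 <= 1 ->
    is_RS_integral (comp_path phi k x) m s1 s2 t1 t2
      (young (Defs.glue (path_incr (comp_path phi k x)) m : incr R 2 2)
         (pair_rv s1 s2) (pair_rv t1 t2)).
Proof.
move=> k2 mA gA cA dA cr; have [M hM] := hx.
have k4 : (k.+2 <= 4)%N by [].
have [K hy] := hol2_comp_path Cphi k4 hM.
have gyA := bigerm_mulp hy gA; have cy := hol2_cont o o hy.
have [_ zE] := young_glue o o o o m11 m11 hy gA cA mA.
split.
  apply: (dint_mat zE); last exact: cont2M.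
    exact: (sew12_biadditive o o o o m11 m11 gyA).
  apply: (sew12_density gyA); apply: density_mulp dA; exact: (hol2_sup hy).
move=> s1 s2 t1 t2 s0 ss s1' t0 tt t1'.
rewrite ((eq_cube_pair _ _).2 zE); try by apply/andP; split; lra.
pose C' := Num.max C (4 * (K * C)).
apply: (RS_integral (K := C')) => //.
- by apply: bigerm_le gA; rewrite le_max lexx.
- by apply: bigerm_le gyA; rewrite le_max lexx orbT.
Qed.

Lemma smooth_young :
  [/\ eq_cube (x12 x) (double_int (partial1 (partial2 X))),
      eq_cube (x12hat x)
        (double_int (fun s t => partial1 X s t * partial2 X s t)),
      eq_cube (z1 phi x) (double_int (fun s t =>
         comp_path phi 1 x s t * partial1 (partial2 X) s t)),
      eq_cube (z2 phi x) (double_int (fun s t =>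
         comp_path phi 2 x s t * (partial1 X s t * partial2 X s t))) &
      forall s1 s2 t1 t2 : R, 0 <= s1 -> s1 <= s2 -> s2 <= 1 ->
        0 <= t1 -> t1 <= t2 -> t2 <= 1 ->
        is_RS_integral (comp_path phi 1 x) (x12 x) s1 s2 t1 t2
          (z1 phi x (pair_rv s1 s2) (pair_rv t1 t2)) /\
        is_RS_integral (comp_path phi 2 x) (x12hat x) s1 s2 t1 t2
          (z2 phi x (pair_rv s1 s2) (pair_rv t1 t2))].
Proof.
have [M hM] := hx; have cx := hol2_cont o o hM.
have xE : eq_cube (x12 x) (mat (rect4 x)).
  by move=> s t _ _; rewrite /x12 rect_mat.
have [_ hE] := x12hat_mat m11 m11 hM.
have gX := rect4_bigerm 1 1 hM.
have gG := xgerm_bigerm hM.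
have gH := bigerm_sew12 o o o o m11 m11 gG.
have cH := sew12_cont o o o o m11 m11 gG (cont4_xgerm cx).
have c12 : cont2 (partial1 (partial2 X)) := @smooth_cont [:: false; true].
have c1c2 : cont2 (fun s t => partial1 X s t * partial2 X s t).
  exact: (cont2M (@smooth_cont [:: false]) (@smooth_cont [:: true])).
have [z1E r1] := @integrator 1 _ _ _ _ isT xE gX (cont4_rect4 cx) dX12 c12.
have [z2E r2] := @integrator 2 _ _ _ _ isT hE gH cH dX12h c1c2.
split.
- exact: dint_mat xE (rect4_biadditive x) dX12 c12.
- exact: dint_mat hE (sew12_biadditive o o o o m11 m11 gG) dX12h c1c2.
- exact: z1E.
- exact: z2E.
- by move=> s1 s2 t1 t2 *; split; [exact: r1|exact: r2].
Qed.

End SmoothPath.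
End Paths.

(** * The theorem *)

Theorem theorem1p1 (R : realType) (gamma1 gamma2 : R) (x : R -> R -> R)
    (phi : R -> R) (hgamma1 : 1 / 2 < gamma1) (hgamma2 : 1 / 2 < gamma2)
    (hx : Pholder gamma1 gamma2 (rect x)) (hax : axes_holder gamma1 gamma2 x)
    (hphi : class_C 4 phi) :
  (* z^1 and z^2 (and x^{hat 1; hat 2}, from which z^2 is built) are well
     defined in the Young sense *)
  ([/\ young_defined (x12hat_germ x), young_defined (germ1 phi x) &
       young_defined (germ2 phi x)]) /\
  (* (i) *)
  (exists rho1 rho2 : incr R 2 2,
     [/\ eq_cube (z1 phi x) (incr_add (germ1 phi x) rho1),
         eq_cube (z2 phi x) (incr_add (germ2 phi x) rho2),
         regular_sum gamma1 gamma2 rho1 & regular_sum gamma1 gamma2 rho2]) /\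
  (* (ii) *)
  (forall X : R -> R -> R, smooth_extension x X ->
     [/\ eq_cube (x12 x) (double_int (partial1 (partial2 X))),
         eq_cube (x12hat x)
           (double_int (fun s t => partial1 X s t * partial2 X s t)),
         eq_cube (z1 phi x)
           (double_int (fun s t =>
              comp_path phi 1 x s t * partial1 (partial2 X) s t)),
         eq_cube (z2 phi x)
           (double_int (fun s t =>
              comp_path phi 2 x s t * (partial1 X s t * partial2 X s t))) &
         forall s1 s2 t1 t2 : R, 0 <= s1 -> s1 <= s2 -> s2 <= 1 ->
           0 <= t1 -> t1 <= t2 -> t2 <= 1 ->
           is_RS_integral (comp_path phi 1 x) (x12 x) s1 s2 t1 t2
             (z1 phi x (pair_rv s1 s2) (pair_rv t1 t2)) /\
           is_RS_integral (comp_path phi 2 x) (x12hat x) s1 s2 t1 t2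
             (z2 phi x (pair_rv s1 s2) (pair_rv t1 t2))]) /\
  (* (iii) *)
  (forall xn : nat -> R -> R -> R, (forall n, smooth_path (xn n)) ->
     cvg_Pholder gamma1 gamma2 (fun n => x12 (xn n)) (x12 x) ->
     cvg_Pholder gamma1 gamma2 (fun n => x12hat (xn n)) (x12hat x) ->
     axes_cvg gamma1 gamma2 xn x ->
     cvg_Pholder gamma1 gamma2 (fun n => z1 phi (xn n)) (z1 phi x) /\
     cvg_Pholder gamma1 gamma2 (fun n => z2 phi (xn n)) (z2 phi x)) /\
  (* (iv) *)
  (forall (s1 s2 t1 t2 : R) (pi1 pi2 : nat -> seq R),
     0 <= s1 -> s2 <= 1 -> 0 <= t1 -> t2 <= 1 ->
     (forall n, itv_partition s1 s2 (pi1 n)) ->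
     (forall n, itv_partition t1 t2 (pi2 n)) ->
     mesh s1 (pi1 n) @[n --> \oo] --> (0 : R) ->
     mesh t1 (pi2 n) @[n --> \oo] --> (0 : R) ->
     (left_sum (comp_path phi 1 x) (x12 x) s1 t1 (pi1 n) (pi2 n)
        @[n --> \oo] --> z1 phi x (pair_rv s1 s2) (pair_rv t1 t2)) /\
     (left_sum (comp_path phi 2 x) (x12hat x) s1 t1 (pi1 n) (pi2 n)
        @[n --> \oo] --> z2 phi x (pair_rv s1 s2) (pair_rv t1 t2))) /\
  (* (v) *)
  eq_cube (rect (fun s t => phi (x s t))) (incr_add (z1 phi x) (z2 phi x)).
Proof.
  (* your proof *)
Proof.
have g10 : 0 < gamma1 by lra.
have g20 : 0 < gamma2 by lra.
have m1 : 1 < gamma1 + gamma1 by lra.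
have m2 : 1 < gamma2 + gamma2 by lra.
have [M hM] := hol2_of_hyps g10 g20 hx hax.
have cx := hol2_cont g10 g20 hM.
have [K1 hy1] : exists K, hol2 gamma1 gamma2 K (comp_path phi 1 x).
  exact: (hol2_comp_path hphi _ hM).
have [K2 hy2] : exists K, hol2 gamma1 gamma2 K (comp_path phi 2 x).
  exact: (hol2_comp_path hphi _ hM).
have xE : eq_cube (x12 x) (mat (rect4 x)).
  by move=> s t _ _; rewrite /x12 rect_mat.
have [hD hE] := x12hat_mat m1 m2 hM.
have gX := rect4_bigerm gamma1 gamma2 hM.
have gG := xgerm_bigerm hM.
have bG := sew12_biadditive g10 g20 g10 g20 m1 m2 gG.
have gH := bigerm_sew12 g10 g20 g10 g20 m1 m2 gG.
have cX := cont4_rect4 cx.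
have cH := sew12_cont g10 g20 g10 g20 m1 m2 gG (cont4_xgerm cx).
have gyX := bigerm_mulp hy1 gX.
have gyH := bigerm_mulp hy2 gH.
have [D1 E1] : young_defined (germ1 phi x) /\
    eq_cube (z1 phi x) (mat (sew12 (mulp (comp_path phi 1 x) (rect4 x)))).
  exact: (young_glue g10 g20 g10 g20 m1 m2 hy1 gX cX xE).
have [D2 E2] : young_defined (germ2 phi x) /\
    eq_cube (z2 phi x) (mat (sew12 (mulp (comp_path phi 2 x) (sew12 (xgerm x))))).
  exact: (young_glue g10 g20 g10 g20 m1 m2 hy2 gH cH hE).
split; first by split.
split.
  have cyX := cont4_mulp (hol2_cont g10 g20 hy1) cX.
  have cyH := cont4_mulp (hol2_cont g10 g20 hy2) cH.
  have [r1 r1E r1R] := regular_sum_sew12 m1 m2 gyX cyX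
    (glue_mat (comp_path phi 1 x) xE) E1.
  have [r2 r2E r2R] := regular_sum_sew12 m1 m2 gyH cyH
    (glue_mat (comp_path phi 2 x) hE) E2.
  by exists r1, r2; split.
split; first by move=> X xX; exact: smooth_young.
split.
  move=> xn sxn c12 c12h cax.
  have hxn n : exists K, hol2 1 1 K (xn n) by exact: smooth_path_hol2.
  have xc := path_cvg g10 g20 c12 cax.
  have m11 : 1 < 1 + 1 :> R by lra.
  have o : 0 < 1 :> R by exact: ltr01.
  split.
  - apply: (young_glue_cvg hgamma1 hgamma2 hphi _ hM hxn xc
      (An := fun n => rect4 (xn n)) _ (rect4_biadditive x) cX _ xE c12) => //.
      move=> n; have [Kn hn] := hxn n; split; first exact: rect4_biadditive.
      by apply: cont4_rect4; exact: hol2_cont hn.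
    by move=> n s t _ _; rewrite /x12 rect_mat.
  - apply: (young_glue_cvg hgamma1 hgamma2 hphi _ hM hxn xc
      (An := fun n => sew12 (xgerm (xn n))) _ bG cH _ hE c12h) => //.
      move=> n; have [Kn hn] := hxn n; have gn := xgerm_bigerm hn; split.
        exact: (sew12_biadditive o o o o m11 m11 gn).
      apply: (sew12_cont o o o o m11 m11 gn).
      by apply: cont4_xgerm; exact: hol2_cont hn.
    by move=> n; have [Kn hn] := hxn n; have [] := x12hat_mat m11 m11 hn.
split.
  move=> s1 s2 t1 t2 pi1 pi2 s0 s1' t0 t1' P1 P2 M1 M2.
  have is1 := node_in01 (P1 0%N) s0 s1' (leq0n _).
  have is2 := node_in01 (P1 0%N) s0 s1' (leqnn _).
  have it1 := node_in01 (P2 0%N) t0 t1' (leq0n _).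
  have it2 := node_in01 (P2 0%N) t0 t1' (leqnn _).
  rewrite node0 in is1 it1; rewrite (node_size (P1 0%N)) in is2.
  rewrite (node_size (P2 0%N)) in it2.
  rewrite ((eq_cube_pair _ _).2 E1)// ((eq_cube_pair _ _).2 E2)//; split.
    exact: (left_sum_cvg g10 g20 g10 g20 m1 m2 gyX xE).
  exact: (left_sum_cvg g10 g20 g10 g20 m1 m2 gyH hE).
have B2 := segment_bounded M (class_C_continuous hphi (isT : (2 <= 4)%N)).
have B3 := segment_bounded M (class_C_continuous hphi (isT : (3 <= 4)%N)).
have B4 := segment_bounded M (class_C_continuous hphi (isT : (4 <= 4)%N)).
move: B2 B3 B4 => [B2 H2] [B3 H3] [B4 H4].
pose B := Num.max B2 (Num.max B3 B4).
have cov := change_of_variables m1 m2 hM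
  (fun u => class_C_derive hphi u (isT : (0 < 4)%N))
  (fun u => class_C_derive hphi u (isT : (1 < 4)%N))
  (fun u => class_C_derive hphi u (isT : (2 < 4)%N))
  (fun u => class_C_derive hphi u (isT : (3 < 4)%N)) (B := B) _ _ _ hy1 hy2.
have {}cov := cov _ _ _.
move=> s t cs ct; have [i1 i2] := cube2 cs; have [j1 j2] := cube2 ct.
rewrite rect_mat /incr_add E1// E2// /mat.
rewrite -(sew12_mulp_sew12 g10 g20 g10 g20 m1 m2 hy2 gG)//.
apply: cov => //.
- by move=> u uM; rewrite !le_max H2.
- by move=> u uM; rewrite !le_max H3// orbT.
- by move=> u uM; rewrite !le_max H4// !orbT.
Qed.
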